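(* Let $\nu$ be a symmetric Lévy measure on $\mathbb{R}^d\setminus\{0\}$ and let $\mathcal{L}=\mathcal{L}_\nu$. Assume that $\mathcal{L}_\nu$ has an associated heat kernel $P$ that is a very weak solution of $\partial_tu+\mathcal{L}u=0$ in $\mathbb{R}^d\times(0,T)$ for every $T>0$ and such that: (1) $P_t\in C(\mathbb{R}^d)$ and $P_t>0$ for all $t>0$; (2) for all $0<\varepsilon<\tau$ there is a constant $C_{\varepsilon,\tau}>1$ such that $C_{\varepsilon,\tau}^{-1}P_t(x)\le P_s(x)\le C_{\varepsilon,\tau}P_t(x)$ for all $x\in\mathbb{R}^d$ and $t,s\in[\varepsilon,\tau]$; (3) for every $R>0$ there is a constant $C_R>0$ such that $P_1(x-y)\le C_RP_1(y)$ for all $y\in\mathbb{R}^d$ and $x\in B_R(0)$. Let $\mu_0$ be a (possibly signed) Radon measure on $\mathbb{R}^d$ with $\int_{\mathbb{R}^d}P_1\,d|\mu_0|<\infty$. Then, for each $T>0$, the function $U(x,t)=\int_{\mathbb{R}^d}P_t(x-y)\,d\mu_0(y)$, $(x,t)\in\mathbb{R}^d\times(0,\infty)$, is a very weak solution of $\partial_tu+\mathcal{L}u=0$ in $\mathbb{R}^d\times(0,T)$ that belongs to $C(\mathbb{R}^d\times(0,T))\cap L^\infty((0,T);L^1_{P_1})$ and has initial trace $\mu_0$.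
   Context: Symmetric Lévy measure: a nonnegative Radon measure $\nu$ on $\mathbb{R}^d\setminus\{0\}$ with $\nu(B)=\nu(-B)$ for all Borel $B$ and $\int\min\{1,|y|^2\}\,d\nu(y)<\infty$. Operator (acting in the $x$ variable): $\mathcal{L}_\nu u(x)=\int_{\mathbb{R}^d}\Big(u(x)-\frac{u(x+y)+u(x-y)}2\Big)d\nu(y)$. Heat kernel: with $m(\xi)=\int_{\mathbb{R}^d}(1-\cos\langle\xi,y\rangle)\,d\nu(y)$, for each $t>0$ let $p_t$ be the law at time $t$ of the Lévy process with characteristic exponent $m$, i.e. the probability measure with $\int e^{i\langle\xi,x\rangle}p_t(dx)=e^{-tm(\xi)}$. $\mathcal{L}_\nu$ has an associated heat kernel $P(x,t)=P_t(x)$ if $p_t(dx)=P_t(x)\,dx$ with $P_t\in L^1(\mathbb{R}^d)$ for all $t>0$. $L^1_{P_1}=\{v\in L^1_{\rm loc}(\mathbb{R}^d):\int_{\mathbb{R}^d}|v|P_1\,dx<\infty\}$; $u\in L^\infty((0,T);L^1_{P_1})$ means $\operatorname{ess\,sup}_{t\in(0,T)}\int_{\mathbb{R}^d}|u(x,t)|P_1(x)\,dx<\infty$. Very weak solution: $u\in L^1_{\rm loc}(\mathbb{R}^d\times(0,T))$ such that, for all $\theta\in C_c^\infty(\mathbb{R}^d\times(0,T))$, $\int_0^T\int_{\mathbb{R}^d}|u||\mathcal{L}\theta|\,dx\,dt<\infty$ and $\int_0^T\int_{\mathbb{R}^d}u(\partial_t\theta-\mathcal{L}\theta)\,dx\,dt=0$.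 Initial trace: $u$ has initial trace $\mu_0$ if $\operatorname{ess\,lim}_{t\to0^+}\int_{\mathbb{R}^d}\psi(x)u(x,t)\,dx=\int_{\mathbb{R}^d}\psi\,d\mu_0$ for all $\psi\in C_c(\mathbb{R}^d)$. Signed Radon measures are elements of the dual of $C_c(\mathbb{R}^d)$, and $|\mu_0|$ is the total variation. $B_R(0)$ is the ball of radius $R$ centered at $0$. *)

(* Defs.v *)
From HB Require Import structures.
From mathcomp Require Import all_boot all_order all_algebra.
From mathcomp Require Import all_classical all_reals all_analysis.
From mathcomp Require Import measurable_realfun ess_sup_inf.
Set Implicit Arguments.
Unset Strict Implicit.
Unset Printing Implicit Defensive.
Import Order.TTheory GRing.Theory Num.Def Num.Theory.
Import numFieldNormedType.Exports.
Local Open Scope classical_set_scope.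
Local Open Scope ring_scope.

(* R^d is 'rV[R]_d with its library topology (that of the sup norm).  It is
   equipped with the Borel sigma-algebra, generated by the open sets. *)
HB.instance Definition _ (R : realType) (d : nat) :=
  @isMeasurable.Build (sigma_display (@open 'rV[R]_d)) 'rV[R]_d
    <<s @open 'rV[R]_d >> (@sigma_algebra0 _ setT _) (@sigma_algebraC _ _)
    (@sigma_algebra_bigcup _ setT _).

Definition cons_rV (R : realType) (d : nat) (p : R * 'rV[R]_d) : 'rV[R]_d.+1 :=
  \row_j (if unlift 0 j is Some k then p.2 0 k else p.1).

(* Lebesgue measure on R^d, as an iterated product measure; lebesgue_rV_box
   below gives its value on boxes. *)
Fixpoint lebesgue_rV (R : realType) (d : nat) : set 'rV[R]_d -> \bar R :=
  match d return set 'rV[R]_d -> \bar R with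
  | 0 => dirac (0 : 'rV[R]_0)
  | d'.+1 => pushforward (lebesgue_measure \x @lebesgue_rV R d')%E
               (@cons_rV R d')
  end.
Arguments lebesgue_rV : clear implicits.

Section lebesgue_rV_measure.
Context {R : realType}.

Lemma open_measurable_rV d (A : set 'rV[R]_d) : open A -> measurable A.
Proof. exact: sub_sigma_algebra. Qed.

Lemma open_bigcup_rat_ball d (A : set 'rV[R]_d) : open A ->
  exists F : 'rV[rat]_d * rat -> set 'rV[R]_d,
    (forall q, F q = set0 \/ F q = ball (map_mx ratr q.1 : 'rV[R]_d) (ratr q.2)) /\
    A = \bigcup_q F q.
Proof.
move=> oA.
exists (fun q => [set x | ball (map_mx ratr q.1 : 'rV[R]_d) (ratr q.2) x /\
   ball (map_mx ratr q.1 : 'rV[R]_d) (ratr q.2) `<=` A]); split=> [q|].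
  have [h|h] := pselect (ball (map_mx ratr q.1 : 'rV[R]_d) (ratr q.2) `<=` A).
    by right; apply/seteqP; split=> [x []|x bx] //; split.
  by left; apply/seteqP; split=> [x []|x].
apply/seteqP; split=> [x Ax|x [q _ [bx bA]]]; last exact: bA.
have /nbhs_ballP[e /= e0 eA] : nbhs x A by exact: open_nbhs_nbhs.
have e20 : 0 < e / 2 by rewrite divr_gt0.
have [r /itvP rP] := rat_in_itvoo e20.
have qP i : exists q : rat, ratr q \in `](x 0 i), (x 0 i + ratr r)[.
  by apply: rat_in_itvoo; rewrite ltrDl rP.
pose q : 'rV[rat]_d := \row_i sval (cid (qP i)).
have qx : ball (map_mx ratr q : 'rV[R]_d) (ratr r) x.
  split=> [|i j]; first by rewrite rP.
  rewrite !mxE ord1; case: cid => /= s /itvP sP.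
  by rewrite /ball/= gtr0_norm ?subr_gt0 ?sP// ltrBlDl sP.
exists (q, r) => //; split=> // y qy; apply: eA.
have : ball x (ratr r + ratr r) y by apply: ball_triangle qy; exact: ball_sym.
by apply: le_ball; rewrite (splitr e) lerD// ltW// rP.
Qed.

Lemma cons_rV_ball d (c : 'rV[R]_d.+1) r :
  @cons_rV R d @^-1` ball c r =
  ball (c 0 0) r `*` ball (\row_j c 0 (lift 0 j) : 'rV[R]_d) r.
Proof.
apply/seteqP; split=> [[x y]|[x y]] /=.
  move=> [r0 cr]; split.
    by have := cr 0 0; rewrite [cons_rV _ _ _]mxE unlift_none.
  split=> // i j; rewrite !ord1 mxE.
  by have := cr 0 (lift 0 j); rewrite [cons_rV _ _ _]mxE liftK.
move=> [cx [r0 cy]]; split=> // i j; rewrite !ord1 [cons_rV _ _ _]mxE.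
by case: unliftP => [k ->|->] //=; have := cy 0 k; rewrite mxE.
Qed.

Lemma measurable_cons_rV d : measurable_fun setT (@cons_rV R d).
Proof.
apply: (@measurability _ _ _ _ _ _ (@open 'rV[R]_d.+1)) => // _ [B oB <-].
rewrite setTI; have [F [Fball ->]] := open_bigcup_rat_ball oB.
rewrite preimage_bigcup; apply: countable_bigcupT_measurable => // q.
have [->|->] := Fball q; first by rewrite preimage_set0.
rewrite cons_rV_ball; apply: measurableX.
  exact: measurable_ball.
apply: open_measurable_rV; exact: ball_open.
Qed.

HB.instance Definition _ d :=
  isMeasurableFun.Build _ _ _ _ (@cons_rV R d) (@measurable_cons_rV d).

Lemma lebesgue_rV_sigma_finite_measure d :
  exists2 m : {sigma_finite_measure set 'rV[R]_d -> \bar R},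
    lebesgue_rV R d = m & forall r, (m (ball (0%R : 'rV[R]_d) r) < +oo)%E.
Proof.
elim: d => [|d [m leb_m m_fin]].
  exists (dirac (0%R : 'rV[R]_0)) => //= r.
  by rewrite diracE; case: (_ \in _); rewrite ltry.
have E : lebesgue_rV R d.+1 = pushforward (lebesgue_measure \x m)%E (@cons_rV R d).
  by rewrite /= leb_m.
have mcons := @measurable_cons_rV d.
pose pm : {measure set 'rV[R]_d.+1 -> \bar R} :=
  measure_function_pushforward__canonical__measure_function_Measure
    [the measure _ _ of (lebesgue_measure \x m)%E] mcons.
have Epm : lebesgue_rV R d.+1 = pm by [].
have m0 : lebesgue_rV R d.+1 set0 = 0%E by rewrite Epm measure0.
have mfin r : (lebesgue_rV R d.+1 (ball (0%R : 'rV[R]_d.+1) r) < +oo)%E.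
  have [r0|r0] := ltP 0 r; last first.
    have -> : ball (0%R : 'rV[R]_d.+1) r = set0.
      by apply/seteqP; split=> // x [+ _]; rewrite ltNge r0.
    by rewrite m0 ltry.
  rewrite E /pushforward cons_rV_ball product_measure1E; last 2 first.
  - exact: measurable_ball.
  - apply: open_measurable_rV; exact: ball_open.
  rewrite mxE [X in (X * _)%E](lebesgue_measure_ball _ (ltW r0)).
  have -> : \row_j (0%R : 'rV[R]_d.+1) 0 (lift 0 j) = 0 :> 'rV[R]_d.
    by apply/rowP => j; rewrite !mxE.
  by rewrite lte_mul_pinfty// lee_fin mulrn_wge0// ltW.
have sf : sigma_finite setT pm.
  exists (fun n => ball (0%R : 'rV[R]_d.+1) n.+1%:R).
    apply/esym/seteqP; split=> // x _.
    exists (truncn `|x|) => //.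
    by rewrite -ball_normE /= sub0r normrN truncnS_gt.
  move=> n; split; last by rewrite -Epm.
  by apply: (@open_measurable_rV d.+1); exact: ball_open.
pose ms := Measure_isSigmaFinite.Build _ _ _ pm sf.
exists (HB.pack_for {sigma_finite_measure set 'rV[R]_d.+1 -> \bar R}
  (Measure.sort pm) ms); first exact: Epm.
by move=> r; have := mfin r; rewrite Epm.
Qed.

Let lebesgue_rV0 d : lebesgue_rV R d set0 = 0%E.
Proof. by have [m -> _] := lebesgue_rV_sigma_finite_measure d. Qed.

Let lebesgue_rV_ge0 d A : (0 <= lebesgue_rV R d A)%E.
Proof. by have [m -> _] := lebesgue_rV_sigma_finite_measure d. Qed.

Let lebesgue_rV_semi_sigma_additive d : semi_sigma_additive (lebesgue_rV R d).
Proof.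
have [m -> _] := lebesgue_rV_sigma_finite_measure d.
exact: measure_semi_sigma_additive.
Qed.

HB.instance Definition _ d := isMeasure.Build _ _ _ (lebesgue_rV R d)
  (@lebesgue_rV0 d) (@lebesgue_rV_ge0 d) (@lebesgue_rV_semi_sigma_additive d).

Let lebesgue_rV_sigma_finite d : sigma_finite setT (lebesgue_rV R d).
Proof.
have [m E _] := lebesgue_rV_sigma_finite_measure d.
have [F FT Ffin] := sigma_finiteT m.
by exists F => // i; rewrite E.
Qed.

HB.instance Definition _ d :=
  @Measure_isSigmaFinite.Build _ _ _ (lebesgue_rV R d)
    (@lebesgue_rV_sigma_finite d).

Lemma measurable_box_rV d (a b : 'rV[R]_d) :
  measurable [set x : 'rV[R]_d | forall i, a 0 i < x 0 i < b 0 i].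
Proof.
have -> : [set x : 'rV[R]_d | forall i, a 0 i < x 0 i < b 0 i] =
    ~` \bigcup_i ~` ((fun x : 'rV[R]_d => x 0 i) @^-1` `]a 0 i, b 0 i[).
  rewrite setC_bigcup; under eq_bigcapr do rewrite setCK.
  apply/seteqP; split=> x /= h i; last by have /= := h i I; rewrite in_itv.
  by move=> _; rewrite /= in_itv /= h.
apply: measurableC; apply: countable_bigcupT_measurable => // i.
apply: measurableC; apply: open_measurable_rV.
by apply: open_comp (interval_open _ _) => // x _; exact: coord_continuous.
Qed.

Lemma lebesgue_rV_box d (a b : 'rV[R]_d) : (forall i, a 0 i <= b 0 i) ->
  lebesgue_rV R d [set x : 'rV[R]_d | forall i, a 0 i < x 0 i < b 0 i] =
  (\prod_i (b 0 i - a 0 i))%:E.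
Proof.
elim: d a b => [|d IH] a b ab.
  rewrite big_ord0 /= diracE mem_set// => -[].
  by case.
rewrite big_ord_recl EFinM /= /pushforward.
pose a' : 'rV[R]_d := \row_i a 0 (lift 0 i).
pose b' : 'rV[R]_d := \row_i b 0 (lift 0 i).
have -> : @cons_rV R d @^-1` [set x : 'rV[R]_d.+1 | forall i, a 0 i < x 0 i < b 0 i] =
    `]a 0 0, b 0 0[ `*` [set x : 'rV[R]_d | forall i, a' 0 i < x 0 i < b' 0 i].
  apply/seteqP; split=> [[x y] /= h|[x y] /= [+ h] i].
    split=> [|i]; first by have := h 0; rewrite [cons_rV _ _ _]mxE unlift_none in_itv.
    by have := h (lift 0 i); rewrite [cons_rV _ _ _]mxE liftK /= !mxE.
  rewrite in_itv /= [cons_rV _ _ _]mxE => xab.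
  by case: unliftP => [k ->|->] //=; have := h k; rewrite !mxE.
rewrite product_measure1E//; last exact: measurable_box_rV.
rewrite [X in (X * _)%E](lebesgue_measure_itv `]a 0 0, b 0 0[) /= IH; last first.
  by move=> i; rewrite !mxE.
rewrite lte_fin; congr (_ * _)%E; last first.
  by congr EFin; apply: eq_bigr => i _; rewrite !mxE.
case: ltP => //= ba; have -> : b 0 0 = a 0 0 by apply/eqP; rewrite eq_le ba ab.
by rewrite subrr.
Qed.

End lebesgue_rV_measure.

Section euclidean.
Context {R : realType} {d : nat}.
Implicit Types x y : 'rV[R]_d.

Definition dotv x y : R := \sum_i x 0 i * y 0 i.

(* The library norm `|x| of a row vector is the sup norm. *)
Definition enorm x : R := Num.sqrt (dotv x x).

End euclidean.

Section function_spaces.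
Context {R : realType} {d : nat}.

Definition supp {V : normedModType R} (f : V -> R) : set V :=
  closure [set z | f z != 0].

(* f is of class C^k: all iterated directional derivatives of order at most k
   exist everywhere and are continuous. *)
Fixpoint class_C {V : normedModType R} (k : nat) (f : V -> R) : Prop :=
  if k is k'.+1 then
    [/\ continuous f, forall v z, derivable f z v &
        forall v, class_C k' (fun z => 'D_v f z)]
  else continuous f.

Definition smooth {V : normedModType R} (f : V -> R) := forall k, class_C k f.

Definition Cc (f : 'rV[R]_d -> R) := continuous f /\ compact (supp f).

(* R^d x (0,T) *)
Definition cylinder (T : R) : set ('rV[R]_d * R) := [set z | 0 < z.2 < T].

(* Elements of C_c^oo(R^d x (0,T)), extended by 0 to R^d x R. *)
Definition test_function (T : R) (theta : 'rV[R]_d * R -> R) :=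
  [/\ smooth theta, compact (supp theta) & supp theta `<=` cylinder T].

Definition L1loc (v : 'rV[R]_d -> R) :=
  measurable_fun setT v /\
  forall K, compact K -> (\int[lebesgue_rV R d]_(x in K) `|v x|%:E < +oo)%E.

Definition L1loc_cylinder (T : R) (u : 'rV[R]_d * R -> R) :=
  measurable_fun (cylinder T) u /\
  forall K, compact K -> K `<=` cylinder T ->
    (\int[(lebesgue_rV R d \x lebesgue_measure)%E]_(z in K) `|u z|%:E < +oo)%E.

End function_spaces.

Section radon_measures.
Context {R : realType} {d : nat}.

(* A Borel measure on an open subset U of R^d that is finite on the compact
   subsets of U is automatically inner and outer regular. *)
Definition radon_on (U : set 'rV[R]_d) (mu : set 'rV[R]_d -> \bar R) :=
  forall K, compact K -> K `<=` U -> (mu K < +oo)%E.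

(* The dual of C_c(R^d) for its inductive limit topology: linear functionals
   whose restriction to the functions supported in a given compact set is
   bounded for the sup norm. *)
Definition Cc_dual (Lam : ('rV[R]_d -> R) -> R) :=
  (forall a f g, Cc f -> Cc g ->
     Lam (fun x => a * f x + g x) = a * Lam f + Lam g) /\
  (forall K, compact K -> exists C, forall f M, Cc f -> supp f `<=` K ->
     (forall x, `|f x| <= M) -> `|Lam f| <= C * M).

(* A signed Radon measure is an element of the dual of C_c(R^d), recorded here
   with its Jordan decomposition: the positive Radon measures, unique by the
   Riesz representation theorem, that are mutually singular and whose
   difference represents the functional.  Neither measure need be finite, so
   that the difference is not a charge in the sense of the library. *)
Record signed_radon := SignedRadon {
  sr_fun : ('rV[R]_d -> R) -> R ;
  sr_pos : {measure set 'rV[R]_d -> \bar R} ;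
  sr_neg : {measure set 'rV[R]_d -> \bar R} ;
  sr_dual : Cc_dual sr_fun ;
  sr_pos_radon : radon_on setT sr_pos ;
  sr_neg_radon : radon_on setT sr_neg ;
  sr_singular : exists A, [/\ measurable A, sr_pos (~` A) = 0%E & sr_neg A = 0%E] ;
  sr_funE : forall f, Cc f ->
    sr_fun f = \int[sr_pos]_x f x - \int[sr_neg]_x f x }.

Definition sr_total_variation (mu : signed_radon) :
    {measure set 'rV[R]_d -> \bar R} :=
  measure_add (sr_pos mu) (sr_neg mu).

(* Meaningful for f integrable with respect to sr_total_variation mu. *)
Definition sr_integral (mu : signed_radon) (f : 'rV[R]_d -> R) : R :=
  \int[sr_pos mu]_x f x - \int[sr_neg mu]_x f x.

End radon_measures.
Arguments signed_radon : clear implicits.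

Section levy.
Context {R : realType} {d : nat}.
Context (nu : {measure set 'rV[R]_d -> \bar R}).

(* A measure on R^d \ {0} is represented by its extension to R^d that does not
   charge the origin. *)
Definition symmetric_levy_measure :=
  [/\ nu [set 0] = 0%E,
      radon_on (~` [set 0]) nu,
      forall B : set 'rV[R]_d, measurable B -> nu [set - y | y in B] = nu B &
      (\int[nu]_y (Num.min 1 (enorm y ^+ 2))%:E < +oo)%E].

Definition levy_op (f : 'rV[R]_d -> R) (x : 'rV[R]_d) : R :=
  \int[nu]_y (f x - (f (x + y) + f (x - y)) / 2).

Definition levy_exponent (xi : 'rV[R]_d) : R :=
  \int[nu]_y (1 - cos (dotv xi y)).

(* Law at time t of the Levy process with exponent m = levy_exponent: the
   equation E[exp(i<xi,X>)] = exp(-t m(xi)) is split into its real and imaginary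
   parts, the right-hand side being real. *)
Definition levy_law (t : R) (p : probability 'rV[R]_d R) :=
  forall xi, \int[p]_x cos (dotv xi x) = expR (- (t * levy_exponent xi)) /\
             \int[p]_x sin (dotv xi x) = 0.

Definition heat_kernel (P : 'rV[R]_d * R -> R) :=
  forall t, 0 < t -> exists p : probability 'rV[R]_d R,
    [/\ levy_law t p,
        (lebesgue_rV R d).-integrable setT (fun x => (P (x, t))%:E) &
        forall A, measurable A ->
          p A = (\int[lebesgue_rV R d]_(x in A) (P (x, t))%:E)%E].

Definition very_weak_solution (T : R) (u : 'rV[R]_d * R -> R) :=
  L1loc_cylinder T u /\
  forall theta, test_function T theta ->
    let Ltheta x t := levy_op (fun x' => theta (x', t)) x in
    let dt_theta x t := derive1 (fun s => theta (x, s)) t in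
    (\int[lebesgue_measure]_(t in `]0%R, T[)
       \int[lebesgue_rV R d]_x (`|u (x, t)| * `|Ltheta x t|)%:E < +oo)%E /\
    (\int[lebesgue_measure]_(t in `]0%R, T[)
       \int[lebesgue_rV R d]_x (u (x, t) * (dt_theta x t - Ltheta x t))%:E
     = 0)%E.

End levy.

Section traces.
Context {R : realType} {d : nat}.

(* ess lim_{t -> 0+} f t = l *)
Definition ess_lim0 (f : R -> \bar R) (l : \bar R) :=
  forall V, nbhs l V -> exists2 delta : R, 0 < delta &
    {ae lebesgue_measure, forall t : R, 0 < t < delta -> V (f t)}.

(* The integrals are extended real valued: as the limit is finite, psi u(.,t)
   is forced to be integrable for a.e. small t. *)
Definition initial_trace (u : 'rV[R]_d * R -> R) (mu0 : signed_radon R d) :=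
  forall psi, Cc psi ->
    ess_lim0 (fun t => (\int[lebesgue_rV R d]_x (psi x * u (x, t))%:E)%E)
             (sr_fun mu0 psi)%:E.

(* L^1_w for the weight w *)
Definition L1_weight (w v : 'rV[R]_d -> R) :=
  L1loc v /\ (\int[lebesgue_rV R d]_x (`|v x| * w x)%:E < +oo)%E.

(* L^oo((0,T); L^1_w) *)
Definition Linfty_L1_weight (T : R) (w : 'rV[R]_d -> R)
    (u : 'rV[R]_d * R -> R) :=
  {ae lebesgue_measure, forall t : R, 0 < t < T ->
     L1_weight w (fun x => u (x, t))} /\
  (ess_sup lebesgue_measure
     ((fun t : R => \int[lebesgue_rV R d]_x (`|u (x, t)| * w x)%:E)
        \_ `]0%R, T[) < +oo)%E.

(* U(x,t) = int P_t(x - y) dmu0(y) *)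
Definition heat_extension (P : 'rV[R]_d * R -> R) (mu0 : signed_radon R d)
    (z : 'rV[R]_d * R) : R :=
  sr_integral mu0 (fun y => P (z.1 - y, z.2)).

End traces.

(* Main.v *)
From HB Require Import structures.
Require Import Defs.
From mathcomp Require Import all_boot all_order all_algebra.
From mathcomp Require Import all_classical all_reals all_analysis.
From mathcomp Require Import measurable_realfun ess_sup_inf.
From mathcomp Require Import ring lra.
Set Implicit Arguments.
Unset Strict Implicit.
Unset Printing Implicit Defensive.
Import Order.TTheory GRing.Theory Num.Def Num.Theory.
Import numFieldNormedType.Exports.
Local Open Scope classical_set_scope.
Local Open Scope ring_scope.

(** Split [mu0] into its positive and negative parts, which both integrate
    [P_1]: by linearity it suffices to study the potential
    [u(x,t) = int P_t(x - y) dmu(y)] of a positive measure [mu] with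
    [int P_1 dmu < oo].  Each claim about [u] is a claim about the kernel
    [(x,t) |-> P_t(x - y)] that holds with a bound by a multiple of [P_1(y)];
    dominated convergence and Fubini then carry it over to [u].

    The semigroup property.  The characteristic functions satisfy
    [exp(-t m) exp(-s m) = exp(-(t + s) m)].  As they determine finite measures
    ([charfun_unique]), the laws [p_t] form a convolution semigroup, and as the
    densities are continuous, [P_t * P_s = P_(t+s)] holds at every point
    ([heat_semigroup]).

    Small times.  The laws [p_t] concentrate at the origin as [t] tends to 0
    ([heat_concentration]).  Integrating [1 - cos] along the coordinate axes at
    a single frequency bounds the mass of a shell [r <= |x| <= r1]; the mass
    beyond [r1] is small uniformly in [t], because [P_(1+t) <= C P_1]
    ([heat_tight]).  Hence [P_t] is an approximation of the identity
    ([heat_dirac]), and together with the semigroup property this upgrades the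
    continuity of each [P_t] to joint continuity of [P] ([heat_continuous]),
    from which the continuity of [u] follows.

    The equation.  Each translate [P_t(x - y)] solves it, so that Fubini gives
    the equation for [u] as soon as
    [int int P_t(x - y) |L theta| dx dt <= C P_1(y)] ([heat_levy_test_le]).
    Here [L theta] is bounded but not compactly supported, and no decay of [P]
    is known beyond the comparison of [P_1] with its own translates.  Choose a
    test function [eta >= |theta|] and a compact set [K] off which both vanish.
    Off [K], [L] only averages values of the function over the jumps into [K],
    so that [|L theta| <= - L eta] there, and [|L theta| <= c 1_K - L eta]
    everywhere.  The equation satisfied by [P_t(x - y)] trades [- L eta] for
    [- d_t eta], which lives on [K]; and on [K] the kernel is at most a multiple
    of [P_1(y)].

    Time slices.  If [|psi(x)| <= C P_1(-x)], the semigroup property gives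
    [int |psi(x)| P_t(x - y) dx <= C P_(1+t)(-y) <= C' P_1(y)] for [t <= T].
    The function [P_1] is such a [psi], being comparable to its reflection, and
    this yields the bound in [L^oo(0,T; L^1_(P_1))] ([potential_L1]).  A function
    [psi] in [C_c] is another one: then [int psi(x) P_t(x - y) dx] converges to
    [psi(y)] and stays below [C' P_1(y)], so that the initial trace follows by
    dominated convergence ([potential_trace]). *)


(** * Borel sets and measurability *)

Section Borel.
Context {R : realType}.

Lemma closed_measurable_rV d (A : set 'rV[R]_d) : closed A -> measurable A.
Proof.
by move=> /closed_openC/open_measurable_rV/measurableC; rewrite setCK.
Qed.

Lemma continuous_measurable_rV d (f : 'rV[R]_d -> R) :
  continuous f -> measurable_fun setT f.
Proof.
move=> cf; apply: (measurability _ (RGenOpens.measurableE R)).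
move=> _ [_ [a [b ->] <-]]; rewrite setTI.
apply: open_measurable_rV; apply: open_comp => // x _; exact: cf.
Qed.

Lemma measurable_coord d (i : 'I_d) :
  measurable_fun setT (fun x : 'rV[R]_d => x 0 i).
Proof. by apply: continuous_measurable_rV; exact: coord_continuous. Qed.

Definition box d (a b : 'rV[R]_d) : set 'rV[R]_d :=
  [set x | forall i, a 0 i < x 0 i < b 0 i].

Lemma measurable_box d (a b : 'rV[R]_d) : measurable (box a b).
Proof. exact: measurable_box_rV. Qed.

Definition boxes d : set (set 'rV[R]_d) :=
  [set box a b | a in [set: 'rV[R]_d] & b in [set: 'rV[R]_d]].

Lemma ball_box d (c : 'rV[R]_d) r : 0 < r ->
  ball c r = box (c - const_mx r) (c + const_mx r).
Proof.
move=> r0; apply/seteqP; split=> [x [_ h] i|x /= h].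
  have := h 0 i; rewrite /ball /= ltr_distlC !mxE.
  by [].
by split=> // i j; rewrite ord1 /ball /= ltr_distlC; have := h j; rewrite !mxE.
Qed.

(** Boxes are a pi-system generating the Borel sets: every open set is a
    countable union of rational balls, and balls of the sup norm are boxes. *)
Lemma boxes_generate d : @measurable _ 'rV[R]_d = <<s @boxes d >>.
Proof.
apply/seteqP; split; last first.
  apply: smallest_sub; first exact: sigma_algebra_measurable.
  by move=> _ [a _ [b _ <-]]; exact: measurable_box.
apply: smallest_sub; first exact: smallest_sigma_algebra.
move=> A oA.
have [F [FE ->]] := open_bigcup_rat_ball oA.
suff Fm q : <<s @boxes d >> (F q).
  have : measurable (\bigcup_q (F q : set (g_sigma_algebraType (@boxes d)))).
    by apply: countable_bigcupT_measurable => // q; exact: Fm.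
  by [].
case: (FE q) => ->; first exact: sigma_algebra0.
have [r0|r0] := ltP 0 (ratr q.2 : R).
  by rewrite ball_box//; apply: sub_sigma_algebra; eexists => //; eexists.
suff -> : ball (map_mx ratr q.1 : 'rV[R]_d) (ratr q.2) = set0
  by exact: sigma_algebra0.
by apply/seteqP; split=> // x [+ _]; rewrite ltNge r0.
Qed.

Lemma boxes_setI d : setI_closed (@boxes d).
Proof.
move=> _ _ [a _ [b _ <-]] [a' _ [b' _ <-]].
exists (\row_i Num.max (a 0 i) (a' 0 i)) => //.
exists (\row_i Num.min (b 0 i) (b' 0 i)) => //.
apply/seteqP; split=> x /=.
  move=> h; split=> i; have := h i; rewrite !mxE gt_max lt_min.
    by move=> /andP[/andP[-> _] /andP[-> _]].
  by move=> /andP[/andP[_ ->] /andP[_ ->]].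
move=> [h h'] i; rewrite !mxE gt_max lt_min.
by have /andP[-> ->] := h i; have /andP[-> ->] := h' i.
Qed.

Lemma bigcup_ball0 (V : normedModType R) :
  \bigcup_n ball (0 : V) n.+1%:R = [set: V].
Proof.
apply/seteqP; split=> // x _; exists (truncn `|x|) => //.
by rewrite -ball_normE /= sub0r normrN truncnS_gt.
Qed.

Lemma measure_unique_box d (m1 m2 : {measure set 'rV[R]_d -> \bar R}) :
  (forall n, (m1 (ball (0%R : 'rV[R]_d) n.+1%:R) < +oo)%E) ->
  (forall a b : 'rV[R]_d, m1 (box a b) = m2 (box a b)) ->
  forall A, measurable A -> m1 A = m2 A.
Proof.
move=> fin1 m12 A mA.
apply: (measure_unique (@boxes d) (fun n => ball (0 : 'rV[R]_d) n.+1%:R)) => //.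
- exact: boxes_generate.
- exact: boxes_setI.
- by move=> n; rewrite ball_box ?ltr0Sn//; eexists => //; eexists.
- exact: bigcup_ball0.
- by move=> _ [a _ [b _ <-]]; exact: m12.
Qed.

Lemma measurable_fun_rV d disp (T : measurableType disp) (f : T -> 'rV[R]_d) :
  (forall i, measurable_fun setT (fun t => f t 0 i)) -> measurable_fun setT f.
Proof.
move=> mf; apply: (@measurability _ _ _ _ _ _ (@boxes d)).
  exact: boxes_generate.
move=> _ [_ [a _ [b _ <-]] <-]; rewrite setTI.
have -> : f @^-1` box a b =
    ~` \bigcup_i ~` ((fun t => f t 0 i) @^-1` `]a 0 i, b 0 i[).
  rewrite setC_bigcup; under eq_bigcapr do rewrite setCK.
  apply/seteqP; split=> x /= h i; last by have /= := h i I; rewrite in_itv.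
  by move=> _; rewrite /= in_itv /= h.
apply: measurableC; apply: countable_bigcupT_measurable => // i.
by apply: measurableC; rewrite -[X in measurable X]setTI; exact: mf.
Qed.

Lemma measurable_subr_rV d :
  measurable_fun setT (fun p : 'rV[R]_d * 'rV[R]_d => p.1 - p.2).
Proof.
apply: measurable_fun_rV => i.
apply: (eq_measurable_fun (fun p : 'rV[R]_d * 'rV[R]_d => p.1 0 i - p.2 0 i)).
  by move=> p _; rewrite !mxE.
apply: measurable_funB.
  by apply: (measurableT_comp (measurable_coord i)); exact: measurable_fst.
by apply: (measurableT_comp (measurable_coord i)); exact: measurable_snd.
Qed.

Lemma measurable_addr_rV d :
  measurable_fun setT (fun p : 'rV[R]_d * 'rV[R]_d => p.1 + p.2).
Proof.
apply: measurable_fun_rV => i.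
apply: (eq_measurable_fun (fun p : 'rV[R]_d * 'rV[R]_d => p.1 0 i + p.2 0 i)).
  by move=> p _; rewrite !mxE.
apply: measurable_funD.
  by apply: (measurableT_comp (measurable_coord i)); exact: measurable_fst.
by apply: (measurableT_comp (measurable_coord i)); exact: measurable_snd.
Qed.

Lemma measurable_shift d (a : 'rV[R]_d) :
  measurable_fun setT (fun x : 'rV[R]_d => x + a).
Proof.
apply: (@measurableT_comp _ _ _ _ _ _
  (fun p : 'rV[R]_d * 'rV[R]_d => p.1 + p.2) _ (fun x => (x, a))).
  exact: measurable_addr_rV.
by apply: measurable_fun_pair; [exact: measurable_id|exact: measurable_cst].
Qed.

Lemma open_bigcup_rat_ball_prod d (A : set ('rV[R]_d * R)) : open A ->
  exists F : ('rV[rat]_d * rat) * (rat * rat) -> set ('rV[R]_d * R),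
    (forall q, measurable (F q)) /\ A = \bigcup_q F q.
Proof.
move=> oA.
pose B (q : ('rV[rat]_d * rat) * (rat * rat)) : set ('rV[R]_d * R) :=
  ball (map_mx ratr q.1.1 : 'rV[R]_d) (ratr q.1.2) `*`
  ball (ratr q.2.1 : R) (ratr q.2.2).
have mB q : measurable (B q).
  apply: measurableX; last exact: measurable_ball.
  by apply: open_measurable_rV; exact: ball_open.
exists (fun q => if `[< B q `<=` A >] then B q else set0); split=> [q|].
  by case: asboolP.
apply/seteqP; split=> [[x t] Axt|x [q _]]; last first.
  by case: asboolP => // BA /BA.
have /nbhs_ballP[e /= e0 eA] : nbhs (x, t) A by exact: open_nbhs_nbhs.
have e20 : 0 < e / 2 by rewrite divr_gt0.
have [r /itvP rP] := rat_in_itvoo e20.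
have r0 : 0 < ratr r :> R by rewrite rP.
have qP (z : R) : exists q : rat, ratr q \in `]z, z + ratr r[.
  by apply: rat_in_itvoo; rewrite ltrDl.
pose q : 'rV[rat]_d := \row_i sval (cid (qP (x 0 i))).
pose s := sval (cid (qP t)).
have qx : ball (map_mx ratr q : 'rV[R]_d) (ratr r) x.
  split=> [|i j]; first by rewrite rP.
  rewrite !mxE ord1; case: cid => /= u /itvP uP.
  by rewrite /ball/= gtr0_norm ?subr_gt0 ?uP// ltrBlDl uP.
have st : ball (ratr s : R) (ratr r) t.
  rewrite /s; case: cid => /= u /itvP uP.
  by rewrite /ball/= gtr0_norm ?subr_gt0 ?uP// ltrBlDl uP.
exists ((q, r), (s, r)) => //.
have re : ratr r + ratr r <= e by rewrite (splitr e) lerD// ltW// rP.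
case: asboolP => [_|]; first by split.
case=> -[y w] /= [qy sw]; apply: eA.
split=> /=.
  apply: le_ball re _ _; apply: ball_triangle qy; exact: ball_sym.
by apply: le_ball re _ _; apply: ball_triangle sw; exact: ball_sym.
Qed.

(** Second countability: the Borel sets of the product space are those of the
    product sigma-algebra. *)
Lemma open_measurable_prod d (A : set ('rV[R]_d * R)) : open A -> measurable A.
Proof.
move=> /open_bigcup_rat_ball_prod[F [mF ->]].
exact: countable_bigcupT_measurable.
Qed.

Lemma closed_measurable_prod d (A : set ('rV[R]_d * R)) :
  closed A -> measurable A.
Proof.
by move=> /closed_openC/open_measurable_prod/measurableC; rewrite setCK.
Qed.

Lemma continuous_measurable_prod d (D : set ('rV[R]_d * R))
    (f : 'rV[R]_d * R -> R) : open D ->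
  {within D, continuous f} -> measurable_fun D f.
Proof.
move=> oD; rewrite (continuous_open_subspace f oD) => cf mD.
apply: (measurability _ (RGenOpens.measurableE R)) => //.
move=> _ [_ [a [b ->] <-]].
apply: open_measurable_prod; rewrite openE => z [Dz fz].
apply: filterI; first by move: oD; rewrite openE; exact.
apply: (cf z); first exact/mem_set.
by apply: open_nbhs_nbhs; split => //; exact: interval_open.
Qed.

End Borel.

(** * Densities and translation invariance *)

Section Density.
Context {R : realType} {disp : measure_display} {T : measurableType disp}.
Variables (mu nu : {measure set T -> \bar R}) (g : T -> R).
Hypothesis mg : measurable_fun setT g.
Hypothesis g0 : forall x, 0 <= g x.
Hypothesis nuE : forall A, measurable A -> nu A = (\int[mu]_(x in A) (g x)%:E)%E.

Import HBNNSimple.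

Let integral_density_nnsfun (h : {nnsfun T >-> R}) :
  (\int[nu]_x (h x)%:E = \int[mu]_x ((h x)%:E * (g x)%:E))%E.
Proof.
have mEg : measurable_fun setT (EFin \o g) by exact/measurable_EFinP.
under eq_integral do rewrite fimfunE -fsumEFin//.
rewrite ge0_integral_fsum//; last 2 first.
  - by move=> r; exact/measurable_EFinP/measurableT_comp.
  - by move=> n x _; rewrite EFinM nnfun_muleindic_ge0.
under [RHS]eq_integral => x _.
  rewrite fimfunE -fsumEFin// ge0_mule_fsuml; last first.
    by move=> r; rewrite EFinM nnfun_muleindic_ge0.
  over.
rewrite [RHS]ge0_integral_fsum//; last 2 first.
  - move=> r; apply: emeasurable_funM => //.
    exact/measurable_EFinP/measurableT_comp.
  - move=> n x _; apply: mule_ge0; last by rewrite lee_fin.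
    by rewrite EFinM nnfun_muleindic_ge0.
apply: eq_fsbigr => r _; rewrite integralZl_indic_nnsfun//= integral_indic//.
rewrite setIT nuE//.
have [r0|r0] := ltP r 0.
  rewrite preimage_nnfun0// integral_set0 mule0.
  by rewrite integral0_eq// => x _; rewrite indic0 mulr0 mul0e.
rewrite integral_mkcond -ge0_integralZl//=.
- by apply: eq_integral => x _; rewrite epatch_indic EFinM -muleA [X in (_ * X)%E]muleC.
- by apply: (iffLR (measurable_restrictT _ _)) => //; exact: measurable_funTS.
- by move=> x _; rewrite patchE; case: ifPn; rewrite ?lee_fin.
Qed.

(** The simple function case is the defining relation between the measures;
    monotone convergence does the rest. *)
Lemma ge0_integral_density (f : T -> \bar R) :
  measurable_fun setT f -> (forall x, 0 <= f x)%E ->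
  (\int[nu]_x f x = \int[mu]_x (f x * (g x)%:E))%E.
Proof.
move=> mf f0; pose h := nnsfun_approx measurableT mf.
have mEg : measurable_fun setT (EFin \o g) by exact/measurable_EFinP.
have hf x : f x = lim ((h n x)%:E @[n --> \oo]).
  apply/esym/cvg_lim => //.
  exact: (@cvg_nnsfun_approx _ _ _ _ measurableT _ mf (fun x _ => f0 x) x I).
under eq_integral do rewrite hf.
rewrite monotone_convergence//; last 3 first.
  - by move=> n; exact/measurable_EFinP.
  - by move=> n x _; rewrite lee_fin.
  - by move=> x _ a b ab; rewrite lee_fin; exact/lefP/nd_nnsfun_approx.
under eq_fun do rewrite integral_density_nnsfun.
rewrite -monotone_convergence//; last 3 first.
  - by move=> n; apply: emeasurable_funM => //; exact/measurable_EFinP.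
  - by move=> n x _; rewrite mule_ge0 ?lee_fin.
  - move=> x _ a b ab; rewrite lee_wpmul2r ?lee_fin//.
    exact/lefP/nd_nnsfun_approx.
apply: eq_integral => x _; apply/cvg_lim => //; apply: cvgeZr => //.
exact: (@cvg_nnsfun_approx _ _ _ _ measurableT _ mf (fun x _ => f0 x) x I).
Qed.

End Density.

Section Translation.
Context {R : realType}.

Lemma lebesgue_rV_ball_lty d r :
  (lebesgue_rV R d (ball (0%R : 'rV[R]_d) r) < +oo)%E.
Proof. by have [m -> ->] := @lebesgue_rV_sigma_finite_measure R d. Qed.

(** It suffices to compare the measures on boxes, where both are the product
    of the side lengths. *)
Lemma lebesgue_rV_translate d (a : 'rV[R]_d) (A : set 'rV[R]_d) : measurable A ->
  lebesgue_rV R d ((fun x => x + a) @^-1` A) = lebesgue_rV R d A.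
Proof.
move=> mA; apply/esym.
have ms := @measurable_shift R d a.
pose m2 : {measure set 'rV[R]_d -> \bar R} :=
  measure_function_pushforward__canonical__measure_function_Measure
    (lebesgue_rV R d) ms.
apply: (@measure_unique_box R d (lebesgue_rV R d) m2) => // [n|b c].
  exact: lebesgue_rV_ball_lty.
rewrite /m2 /= /pushforward.
have [bc|] := pselect (forall i, b 0 i <= c 0 i); last first.
  move=> /existsNP[i /negP]; rewrite -ltNge => cb.
  have -> : box b c = set0.
    by apply/seteqP; split=> // x /(_ i)/andP[bx xc]; lra.
  by rewrite preimage_set0 !measure0.
have -> : (fun x => x + a) @^-1` box b c = box (b - a) (c - a).
  by apply/seteqP; split=> x /= h i; have := h i; rewrite !mxE; lra.
rewrite /box !lebesgue_rV_box//; last by move=> i; rewrite !mxE lerD2r.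
by congr EFin; apply: eq_bigr => i _; rewrite !mxE; ring.
Qed.

Lemma ge0_integral_translate d (a : 'rV[R]_d) (f : 'rV[R]_d -> \bar R) :
  measurable_fun setT f -> (forall x, 0 <= f x)%E ->
  (\int[lebesgue_rV R d]_x f (x + a)%R = \int[lebesgue_rV R d]_x f x)%E.
Proof.
move=> mf f0; have ms := @measurable_shift R d a.
rewrite -[LHS](@ge0_integral_pushforward _ _ _ _ _ _ ms (lebesgue_rV R d) setT)//.
by apply: eq_measure_integral => A mA _; exact: lebesgue_rV_translate.
Qed.

Lemma integral_translate d (a : 'rV[R]_d) (f : 'rV[R]_d -> \bar R) :
  measurable_fun setT f ->
  (\int[lebesgue_rV R d]_x f (x + a)%R = \int[lebesgue_rV R d]_x f x)%E.
Proof.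
move=> mf; rewrite integralE [RHS]integralE; congr (_ - _)%E.
  rewrite -(@ge0_integral_translate d a f^\+%E)//.
    by apply: eq_integral => x _; rewrite !funeposE.
  exact: measurable_funepos.
rewrite -(@ge0_integral_translate d a f^\-%E)//.
  by apply: eq_integral => x _; rewrite !funenegE.
exact: measurable_funeneg.
Qed.

Lemma ge0_integral_translate_prod d (a : 'rV[R]_d) (f : 'rV[R]_d * R -> \bar R) :
  measurable_fun setT f -> (forall x, 0 <= f x)%E ->
  (\int[lebesgue_rV R d \x lebesgue_measure]_z f ((z.1 + a)%R, z.2) =
   \int[lebesgue_rV R d \x lebesgue_measure]_z f z)%E.
Proof.
move=> mf f0.
rewrite !(fubini_tonelli2 _)//; last first.
  apply: (@measurableT_comp _ _ _ _ _ _ f _ (fun z : 'rV[R]_d * R => (z.1 + a, z.2))) => //.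
  apply: measurable_fun_pair => //.
  by apply: (measurableT_comp (@measurable_shift R d a)); exact: measurable_fst.
apply: eq_integral => t _; rewrite /fubini_G /=.
rewrite (ge0_integral_translate a (f := fun x => f (x, t)))//.
exact: measurable_fun_pair1.
Qed.

End Translation.

(** * Dominated convergence along filters *)

Section Convergence.
Context {R : realType}.

Lemma cvg_within_seq (V : pseudoMetricType R) (T : topologicalType)
    (D : set V) (p : V) (f : V -> T) (l : T) :
  (forall u : nat -> V, (forall n, D (u n)) -> u n @[n --> \oo] --> p ->
     f (u n) @[n --> \oo] --> l) ->
  f x @[x --> within D (nbhs p)] --> l.
Proof.
move=> fu A Al; apply: contrapT => nA.
have /choice[u uP] : forall n, exists x : V,
    [/\ ball p n.+1%:R^-1 x, D x & ~ A (f x)].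
  move=> n; apply: contrapT => /forallNP h; apply: nA.
  rewrite /= /within /=; apply/nbhs_ballP.
  exists n.+1%:R^-1 => /=; first by rewrite invr_gt0.
  by move=> x bx Dx; apply: contrapT => nAx; exact: (h x).
have up : u n @[n --> \oo] --> p.
  apply/cvg_ballP => e e0; near=> n.
  have [b _ _] := uP n; apply: le_ball b.
  by apply: ltW; near: n; exact: near_infty_natSinv_lt (PosNum e0).
have /fu /(_ up) /(_ A Al) : forall n, D (u n) by move=> n; have [] := uP n.
by move=> [N _ /(_ N (leqnn N))] /=; have [] := uP N.
Unshelve. all: by end_near. Qed.

Lemma cvgn_Rintegral disp (Y : measurableType disp)
    (mu : {measure set Y -> \bar R}) (f : nat -> Y -> R) (l g : Y -> R) :
  (forall n, measurable_fun setT (f n)) -> measurable_fun setT l ->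
  mu.-integrable setT (EFin \o g) ->
  (forall n y, `|f n y| <= g y) ->
  (forall y, f n y @[n --> \oo] --> l y) ->
  \int[mu]_y f n y @[n --> \oo] --> \int[mu]_y l y.
Proof.
move=> mf ml ig fg fl.
have [il _ Il] : [/\ mu.-integrable setT (EFin \o l),
    (\int[mu]_y `|(f n y)%:E - (l y)%:E| @[n --> \oo] --> 0)%E &
    (\int[mu]_y (f n y)%:E @[n --> \oo] --> \int[mu]_y (l y)%:E)%E].
  apply: (@dominated_convergence _ _ _ mu setT measurableT
    (fun n y => (f n y)%:E) (EFin \o l) (EFin \o g)) => //.
  - by move=> n; apply/measurable_EFinP; exact: mf.
  - exact/measurable_EFinP.
  - by apply: aeW => y _; apply: cvg_EFin; [exact: nearW|exact: fl].
  - by apply: aeW => y n _ /=; rewrite lee_fin fg.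
apply: fine_cvg; rewrite fineK//; exact: integrable_fin_num.
Qed.

(** Sequential dominated convergence suffices: in a pseudometric space,
    limits within a set are detected by sequences. *)
Lemma cvg_Rintegral disp (Y : measurableType disp)
    (mu : {measure set Y -> \bar R}) (V : pseudoMetricType R) (D : set V)
    (p : V) (f : V -> Y -> R) (l g : Y -> R) :
  (forall v, D v -> measurable_fun setT (f v)) -> measurable_fun setT l ->
  mu.-integrable setT (EFin \o g) ->
  (forall v y, D v -> `|f v y| <= g y) ->
  (forall y, f v y @[v --> within D (nbhs p)] --> l y) ->
  \int[mu]_y f v y @[v --> within D (nbhs p)] --> \int[mu]_y l y.
Proof.
move=> mf ml ig fg fl; apply: cvg_within_seq => u Du up.
apply: (cvgn_Rintegral (f := fun n => f (u n)) (g := g)) => // [n|n y|y].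
- exact: mf.
- exact: fg.
- apply: cvg_trans (fl y) => A /=; rewrite /within /= => nA.
  have := up _ nA; rewrite /nbhs /= => -[N _ h]; exists N => // n Nn /=.
  exact: (h n Nn (Du n)).
Qed.

Lemma cvg_within_interior (V : topologicalType) (T : topologicalType)
    (D : set V) (p : V) (f : V -> T) (l : T) : nbhs p D ->
  f x @[x --> within D (nbhs p)] --> l -> f x @[x --> p] --> l.
Proof.
move=> Dp fl A /fl; rewrite /within /= => h.
by apply: filterS2 Dp h => x Dx; exact.
Qed.

Lemma bounded_integrable disp (Y : measurableType disp)
    (mu : {measure set Y -> \bar R}) (f : Y -> R) (M : R) :
  (mu setT < +oo)%E -> measurable_fun setT f -> (forall y, `|f y| <= M) ->
  mu.-integrable setT (EFin \o f).
Proof.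
move=> mufin mf fM; apply: measurable_bounded_integrable => //.
exists M; split; first exact: num_real.
by move=> r Mr y _ /=; rewrite (le_trans (fM y))// ltW.
Qed.

End Convergence.

(** * Characteristic functions determine finite measures *)

Section Dotv.
Context {R : realType} {d : nat}.
Implicit Types x y z : 'rV[R]_d.

Lemma dotvDl x y z : dotv (x + y) z = dotv x z + dotv y z.
Proof.
by rewrite /dotv -big_split; apply: eq_bigr => i _; rewrite !mxE mulrDl.
Qed.

Lemma dotvDr x y z : dotv x (y + z) = dotv x y + dotv x z.
Proof.
by rewrite /dotv -big_split; apply: eq_bigr => i _; rewrite !mxE mulrDr.
Qed.

Lemma dotvNl x z : dotv (- x) z = - dotv x z.
Proof.
by rewrite /dotv -sumrN; apply: eq_bigr => i _; rewrite !mxE mulNr.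
Qed.

Lemma dotv0l z : dotv 0 z = 0.
Proof. by rewrite /dotv big1// => i _; rewrite !mxE mul0r. Qed.

Lemma dotv_delta (c : R) (i : 'I_d) z : dotv (c *: delta_mx 0 i) z = c * z 0 i.
Proof.
rewrite /dotv (bigD1 i)//= !mxE !eqxx mulr1 big1 ?addr0// => j ji.
by rewrite !mxE eqxx (negbTE ji) mulr0 mul0r.
Qed.

Lemma measurable_dotv x : measurable_fun setT (dotv x).
Proof.
rewrite /dotv; apply: measurable_sum => i.
by apply: measurable_funM => //; exact: measurable_coord.
Qed.

End Dotv.

Section Trigo.
Context {R : realType}.

Lemma measurable_cos : measurable_fun setT (@cos R).
Proof. by apply: continuous_measurable_fun; exact: continuous_cos. Qed.

Lemma measurable_sin : measurable_fun setT (@sin R).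
Proof. by apply: continuous_measurable_fun; exact: continuous_sin. Qed.

End Trigo.

Section TrigPoly.
Context {R : realType} {d : nat}.

(** The span of the functions integrated by characteristic functions; the
    phase [b] merges sines and cosines, and makes the product-to-sum formula
    a closure property. *)
Inductive trig_poly : ('rV[R]_d -> R) -> Prop :=
| trig_poly_cos (c : R) xi b : trig_poly (fun x => c * cos (dotv xi x + b))
| trig_polyD f g : trig_poly f -> trig_poly g -> trig_poly (fun x => f x + g x).

Lemma trig_poly_cst (c : R) : trig_poly (fun=> c).
Proof.
rewrite (_ : (fun=> c) = (fun x => c * cos (dotv 0 x + 0))); first exact: trig_poly_cos.
by apply/funext => x; rewrite dotv0l addr0 cos0 mulr1.
Qed.

Lemma trig_polyM f g : trig_poly f -> trig_poly g ->
  trig_poly (fun x => f x * g x).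
Proof.
elim=> [c xi b|f1 f2 _ IH1 _ IH2] tg; last first.
  rewrite (_ : (fun x => _) = (fun x => f1 x * g x + f2 x * g x)).
    by apply: trig_polyD; [exact: IH1|exact: IH2].
  by apply/funext => x; rewrite mulrDl.
elim: tg => [c' xi' b'|g1 g2 _ IH1 _ IH2]; last first.
  rewrite (_ : (fun x => _) = (fun x => c * cos (dotv xi x + b) * g1 x +
      c * cos (dotv xi x + b) * g2 x)); first exact: trig_polyD.
  by apply/funext => x; rewrite mulrDr.
rewrite (_ : (fun x => _) = (fun x =>
    (c * c' / 2) * cos (dotv (xi + xi') x + (b + b')) +
    (c * c' / 2) * cos (dotv (xi - xi') x + (b - b')))).
  by apply: trig_polyD; exact: trig_poly_cos.
apply/funext => x; rewrite !dotvDl dotvNl.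
rewrite (_ : dotv xi x + dotv xi' x + (b + b') =
  (dotv xi x + b) + (dotv xi' x + b')); last by ring.
rewrite (_ : dotv xi x - dotv xi' x + (b - b') =
  (dotv xi x + b) - (dotv xi' x + b')); last by ring.
set A := dotv xi x + b; set B := dotv xi' x + b'.
by rewrite (cosD A B) (cosB A B); field.
Qed.

Lemma trig_polyZ (c : R) f : trig_poly f -> trig_poly (fun x => c * f x).
Proof. by move=> tf; apply: trig_polyM => //; exact: trig_poly_cst. Qed.

Lemma trig_polyX f n : trig_poly f -> trig_poly (fun x => f x ^+ n).
Proof.
move=> tf; elim: n => [|n IH].
  rewrite (_ : (fun x => _) = (fun=> 1)); first exact: trig_poly_cst.
  by apply/funext => x; rewrite expr0.
rewrite (_ : (fun x => _) = (fun x => f x * f x ^+ n)); first exact: trig_polyM.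
by apply/funext => x; rewrite exprS.
Qed.

Lemma trig_poly_prod (I : Type) (r : seq I) (f : I -> 'rV[R]_d -> R) :
  (forall i, trig_poly (f i)) -> trig_poly (fun x => \prod_(i <- r) f i x).
Proof.
move=> tf; elim: r => [|i r IH].
  rewrite (_ : (fun x => _) = (fun=> 1)); first exact: trig_poly_cst.
  by apply/funext => x; rewrite big_nil.
rewrite (_ : (fun x => _) = (fun x => f i x * \prod_(j <- r) f j x)).
  exact: trig_polyM.
by apply/funext => x; rewrite big_cons.
Qed.

Lemma trig_poly_sin (k a : R) (i : 'I_d) : trig_poly (fun x => sin ((x 0 i - a) * k)).
Proof.
rewrite (_ : (fun x => _) = (fun x =>
  1 * cos (dotv (k *: delta_mx 0 i) x + (- (a * k) - pi / 2)))).
  exact: trig_poly_cos.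
apply/funext => x; rewrite dotv_delta mul1r.
rewrite (_ : k * _ + _ = (x 0 i - a) * k - pi / 2); last by ring.
by rewrite cosBpihalf.
Qed.

Lemma trig_poly_bounded f : trig_poly f ->
  measurable_fun setT f /\ exists M, forall x, `|f x| <= M.
Proof.
elim=> [c xi b|f1 f2 _ [m1 [M1 h1]] _ [m2 [M2 h2]]]; split.
- apply: measurable_funM => //; apply: measurableT_comp => //.
    exact: measurable_cos.
  by apply: measurable_funD => //; exact: measurable_dotv.
- exists `|c| => x; rewrite normrM ler_piMr//; exact: cos_max.
- exact: measurable_funD.
- by exists (M1 + M2) => x; rewrite (le_trans (ler_normD _ _))// lerD.
Qed.

Definition same_charfun (p q : {measure set 'rV[R]_d -> \bar R}) := forall xi,
  \int[p]_x cos (dotv xi x) = \int[q]_x cos (dotv xi x) /\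
  \int[p]_x sin (dotv xi x) = \int[q]_x sin (dotv xi x).

Variables p q : {measure set 'rV[R]_d -> \bar R}.
Hypothesis pfin : (p setT < +oo)%E.
Hypothesis qfin : (q setT < +oo)%E.
Hypothesis pq : same_charfun p q.

Let int_cos (m : {measure set 'rV[R]_d -> \bar R}) xi : (m setT < +oo)%E ->
  m.-integrable setT (EFin \o (fun x => cos (dotv xi x))).
Proof.
move=> mfin; apply: (bounded_integrable (M := 1)) => // [|x]; last exact: cos_max.
apply: (measurableT_comp measurable_cos).
exact: measurable_dotv.
Qed.

Let int_sin (m : {measure set 'rV[R]_d -> \bar R}) xi : (m setT < +oo)%E ->
  m.-integrable setT (EFin \o (fun x => sin (dotv xi x))).
Proof.
move=> mfin; apply: (bounded_integrable (M := 1)) => // [|x]; last exact: sin_max.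
apply: (measurableT_comp measurable_sin).
exact: measurable_dotv.
Qed.

Lemma trig_poly_same f : trig_poly f -> \int[p]_x f x = \int[q]_x f x.
Proof.
elim=> [c xi b|f1 f2 t1 IH1 t2 IH2]; last first.
  have [m1 [M1 h1]] := trig_poly_bounded t1.
  have [m2 [M2 h2]] := trig_poly_bounded t2.
  by rewrite !RintegralD ?IH1 ?IH2//;
    first [exact: bounded_integrable h1|exact: bounded_integrable h2].
have E (m : {measure set 'rV[R]_d -> \bar R}) : (m setT < +oo)%E ->
    \int[m]_x (c * cos (dotv xi x + b)) =
    (c * cos b) * \int[m]_x cos (dotv xi x) -
    (c * sin b) * \int[m]_x sin (dotv xi x).
  move=> mfin.
  have ic := int_cos xi mfin; have isn := int_sin xi mfin.
  rewrite -RintegralZl// -RintegralZl// -RintegralB//; last 2 first.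
  - exact: (integrableZl measurableT (c * cos b) ic).
  - exact: (integrableZl measurableT (c * sin b) isn).
  by apply: eq_Rintegral => x _; rewrite cosD; ring.
by rewrite !E//; have [-> ->] := pq xi.
Qed.

End TrigPoly.

Section SignIter.
Context {R : realType}.
Implicit Types u t a b : R.

(** The odd cubic with attracting fixed points -1 and 1: its iterates tend to
    the sign function on [-1, 1], and they turn trigonometric polynomials
    into trigonometric polynomials. *)
Definition cubic u : R := (3 * u - u ^+ 3) / 2.

Lemma cubicN u : cubic (- u) = - cubic u.
Proof. by rewrite /cubic; field. Qed.

Lemma iter_cubicN n u : iter n cubic (- u) = - iter n cubic u.
Proof. by elim: n => //= n ->; rewrite cubicN. Qed.

Lemma cubic_itv u : 0 <= u <= 1 -> u <= cubic u <= 1.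
Proof.
move=> /andP[u0 u1]; rewrite /cubic; apply/andP; split.
  have : 0 <= u * (1 - u) * (1 + u) by rewrite !mulr_ge0//; lra.
  have -> : u * (1 - u) * (1 + u) = u - u ^+ 3 by ring.
  lra.
have : 0 <= (1 - u) ^+ 2 * (u + 2) by rewrite mulr_ge0// ?sqr_ge0//; lra.
have -> : (1 - u) ^+ 2 * (u + 2) = 2 - (3 * u - u ^+ 3) by ring.
lra.
Qed.

Lemma iter_cubic_itv n u : 0 <= u <= 1 -> u <= iter n cubic u <= 1.
Proof.
move=> u01; elim: n => [|n /andP[IH1 IH2]] /=.
  by case/andP: u01 => _ ->; rewrite lexx.
have /andP[h1 ->] : iter n cubic u <= cubic (iter n cubic u) <= 1.
  by apply: cubic_itv; rewrite IH2 andbT (le_trans _ IH1)//; case/andP: u01.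
by rewrite andbT (le_trans IH1).
Qed.

(** One step multiplies the defect [1 - v] by [(1 - v) (v + 2) / 2], which is at
    most [1 - u / 2] as long as [v >= u]. *)
Lemma iter_cubic_geo n u : 0 <= u <= 1 ->
  1 - iter n cubic u <= (1 - u / 2) ^+ n.
Proof.
move=> u01; have /andP[u0 u1] := u01; elim: n => [|n IH] /=.
  by rewrite expr0; lra.
have /andP[h1 h2] := iter_cubic_itv n u01.
set v := iter n cubic u in IH h1 h2 *.
rewrite exprS; apply: le_trans (_ : (1 - u / 2) * (1 - v) <= _).
  have -> : 1 - cubic v = (1 - v) * ((1 - v) * (v + 2) / 2).
    by rewrite /cubic; field.
  rewrite mulrC ler_wpM2r//; first lra.
  have -> : (1 - v) * (v + 2) / 2 = 1 - v / 2 - v ^+ 2 / 2 by field.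
  have := sqr_ge0 v; lra.
by rewrite ler_wpM2l//; lra.
Qed.

Lemma iter_cubic0 n : iter n cubic 0 = 0.
Proof. by elim: n => //= n ->; rewrite /cubic; field. Qed.

Lemma norm_iter_cubic n u : -1 <= u <= 1 -> `|iter n cubic u| <= 1.
Proof.
move=> /andP[u1 u2]; rewrite ler_norml; have [u0|u0] := leP 0 u.
  by have /andP[? ?] := iter_cubic_itv n (introT andP (conj u0 u2)); lra.
have h : 0 <= - u <= 1 by lra.
by have := iter_cubic_itv n h; rewrite iter_cubicN; lra.
Qed.

Lemma cvg_iter_cubic u : -1 <= u <= 1 ->
  iter n cubic u @[n --> \oo] --> Num.sg u.
Proof.
have pos v : 0 < v <= 1 -> iter n cubic v @[n --> \oo] --> (1 : R).
  move=> /andP[v0 v1].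
  apply: (@squeeze_cvgr _ _ _ _ (fun n => 1 - (1 - v / 2) ^+ n) (fun=> 1)).
  - near=> n; have h : 0 <= v <= 1 by rewrite ltW.
    have /andP[_ ->] := iter_cubic_itv n h; rewrite andbT.
    by have := iter_cubic_geo n h; lra.
  - rewrite -[X in _ --> X](subr0 1); apply: cvgB; first exact: cvg_cst.
    by apply: cvg_expr; rewrite ger0_norm; lra.
  - exact: cvg_cst.
move=> /andP[u1 u2]; have [u0|u0|<-] := ltgtP 0 u.
- by rewrite gtr0_sg//; apply: pos; rewrite u0.
- rewrite ltr0_sg// -[u]opprK; under eq_fun do rewrite iter_cubicN.
  by apply: cvgN; apply: pos; lra.
- rewrite sgr0; under eq_fun do rewrite iter_cubic0; exact: cvg_cst.
Unshelve. all: by end_near. Qed.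

(** A trigonometric approximation of the indicator of the open interval from [a]
    to [b]: first [n], then [k] tends to infinity.  The period is a multiple of
    [k.+1], so that in the limit the sine has the sign of its argument.  The value
    [1/2] that [(sg (t - a) - sg (t - b)) / 2] takes at the endpoints is sent to
    [0] by [u * (2 * u - 1)], which fixes [0] and [1]. *)
Definition window a b (k n : nat) t : R :=
  let u := (iter n cubic (sin ((t - a) * k.+1%:R^-1)) -
            iter n cubic (sin ((t - b) * k.+1%:R^-1))) / 2 in u * (2 * u - 1).

Definition window_lim a b (k : nat) t : R :=
  let u := (Num.sg (sin ((t - a) * k.+1%:R^-1)) -
            Num.sg (sin ((t - b) * k.+1%:R^-1))) / 2 in u * (2 * u - 1).

Lemma sin_itv t : -1 <= sin t <= 1.
Proof. by rewrite -ler_norml sin_max. Qed.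

Lemma window_bounded a b k n t : `|window a b k n t| <= 3.
Proof.
rewrite /window /=.
have := norm_iter_cubic n (sin_itv ((t - a) * k.+1%:R^-1)).
have := norm_iter_cubic n (sin_itv ((t - b) * k.+1%:R^-1)).
move: (iter n _ _) (iter n _ _) => x y; rewrite !ler_norml => hx hy.
by nra.
Qed.

Lemma cvg_window a b k t :
  window a b k n t @[n --> \oo] --> window_lim a b k t.
Proof.
have h c := cvg_iter_cubic (sin_itv ((t - c) * k.+1%:R^-1)).
have hu : (iter n cubic (sin ((t - a) * k.+1%:R^-1)) -
    iter n cubic (sin ((t - b) * k.+1%:R^-1))) / 2 @[n --> \oo] -->
    (Num.sg (sin ((t - a) * k.+1%:R^-1)) -
     Num.sg (sin ((t - b) * k.+1%:R^-1))) / 2.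
  by apply: cvgM; [apply: cvgB; exact: h|exact: cvg_cst].
apply: cvgM => //; apply: cvgB; last exact: cvg_cst.
by apply: cvgM => //; exact: cvg_cst.
Qed.

Lemma near_sg_sin t : \forall k \near \oo,
  Num.sg (sin (t * k.+1%:R^-1)) = Num.sg t.
Proof.
have pos (v : R) : 0 < v -> \forall k \near \oo, 0 < sin (v * k.+1%:R^-1).
  move=> v0; exists (truncn v) => // k /= vk; apply: sin2_gt0.
  rewrite divr_gt0//= ltr_pdivrMr//.
  have : v < k.+1%:R.
    by rewrite (lt_le_trans (truncnS_gt v))// ler_nat.
  have : (1 : R) <= k.+1%:R by rewrite ler1n.
  lra.
have [t0|t0|<-] := ltgtP 0 t.
- by move: (pos _ t0); apply: filterS => k h; rewrite !gtr0_sg.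
- have Nt0 : 0 < - t by rewrite oppr_gt0.
  move: (pos _ Nt0); apply: filterS => k; rewrite mulNr sinN oppr_gt0 => h.
  by rewrite !ltr0_sg.
- by apply: nearW => k; rewrite mul0r sin0.
Qed.

Lemma cvg_window_lim a b t : a < b ->
  window_lim a b k t @[k --> \oo] --> ((a < t < b)%R%:R : R).
Proof.
move=> ab; apply: cvg_near_cst.
move: (near_sg_sin (t - a)) (near_sg_sin (t - b)); apply: filterS2 => k.
rewrite /window_lim /= => -> ->.
have sgp c : c < t -> Num.sg (t - c) = 1 by move=> ct; rewrite gtr0_sg ?subr_gt0.
have sgn c : t < c -> Num.sg (t - c) = -1 by move=> ct; rewrite ltr0_sg ?subr_lt0.
have sg0 c : c = t -> Num.sg (t - c) = 0 by move=> ->; rewrite subrr sgr0.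
have [ta|ta|ta] := ltgtP a t; have [tb|tb|tb] := ltgtP t b => /=;
  first [by have := lt_trans ta tb; lra|by lra|
    rewrite ?(sgp _ ta) ?(sgn _ ta) ?(sg0 _ ta) ?(sgp _ tb) ?(sgn _ tb)
      ?(sg0 _ (esym tb)); field]; exact: isT.
Qed.


End SignIter.

Section CharfunUnique.
Context {R : realType} {d : nat}.
Variables p q : {measure set 'rV[R]_d -> \bar R}.
Hypothesis pfin : (p setT < +oo)%E.
Hypothesis qfin : (q setT < +oo)%E.
Hypothesis pq : same_charfun p q.

Let same_lim (f : nat -> 'rV[R]_d -> R) (l : 'rV[R]_d -> R) (M : R) :
  (forall n, measurable_fun setT (f n)) ->
  (forall n x, `|f n x| <= M) ->
  (forall x, f n x @[n --> \oo] --> l x) ->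
  (forall n, \int[p]_x f n x = \int[q]_x f n x) ->
  measurable_fun setT l /\ \int[p]_x l x = \int[q]_x l x.
Proof.
move=> mf fM fl fpq.
have ml : measurable_fun setT l.
  by apply: (measurable_fun_cvg mf) => x _; exact: fl.
split=> //.
have cvgl (m : {measure set 'rV[R]_d -> \bar R}) : (m setT < +oo)%E ->
    \int[m]_x f n x @[n --> \oo] --> \int[m]_x l x.
  move=> mfin; apply: (cvgn_Rintegral (g := fun=> M)) => //.
  exact: (bounded_integrable (M := `|M|)).
have := cvgl q qfin; under eq_fun do rewrite -fpq.
by move=> h; apply: (cvg_unique _ (cvgl p pfin) h).
Qed.

Lemma trig_poly_window a b k n (i : 'I_d) :
  trig_poly (fun x : 'rV[R]_d => window a b k n (x 0 i)).
Proof.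
have tc c : trig_poly (fun x : 'rV[R]_d =>
    iter n (@cubic R) (sin ((x 0 i - c) * k.+1%:R^-1))).
  elim: n => [|n IH] /=; first exact: trig_poly_sin.
  set f := (fun x : 'rV[R]_d => iter n _ _) in IH.
  rewrite (_ : (fun x => _) = (fun x => (3 / 2) * f x + (- 1 / 2) * f x ^+ 3)).
    by apply: trig_polyD; apply: trig_polyZ => //; exact: trig_polyX.
  by apply/funext => x; rewrite /cubic -/(f x); field.
have tu : trig_poly (fun x : 'rV[R]_d =>
    (iter n (@cubic R) (sin ((x 0 i - a) * k.+1%:R^-1)) * 2^-1 +
    (- 2^-1) * iter n (@cubic R) (sin ((x 0 i - b) * k.+1%:R^-1)))).
  apply: trig_polyD; last exact: trig_polyZ.
  by apply: trig_polyM => //; exact: trig_poly_cst.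
have := trig_polyM tu (trig_polyD (trig_polyZ 2 tu) (trig_poly_cst (-1))).
congr trig_poly; apply/funext => x; rewrite /window /=.
by field.
Qed.

(** The indicators of open boxes are iterated bounded limits of trigonometric
    polynomials, on which the two integrals agree. *)
Lemma charfun_unique A : measurable A -> p A = q A.
Proof.
apply: measure_unique_box => [n|a b].
  apply: le_lt_trans pfin; apply: le_measure; rewrite ?inE//.
  by apply: open_measurable_rV; exact: ball_open.
have [ab|] := pselect (forall i, a 0 i < b 0 i); last first.
  move=> /existsNP[i /negP]; rewrite -leNgt => ba.
  have -> : box a b = set0.
    by apply/seteqP; split=> // x /(_ i)/andP[bx xc]; lra.
  by rewrite !measure0.
have bnd (f : 'I_d -> R) : (forall i, `|f i| <= 3) ->
    `|\prod_i f i| <= 3 ^+ d.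
  move=> h; rewrite normr_prod -[X in _ ^+ X]card_ord -prodr_const.
  by apply: ler_prod => i _; rewrite normr_ge0 h.
have step1 k : measurable_fun setT
      (fun x : 'rV[R]_d => \prod_i window_lim (a 0 i) (b 0 i) k (x 0 i)) /\
    \int[p]_x (\prod_i window_lim (a 0 i) (b 0 i) k (x 0 i)) =
    \int[q]_x (\prod_i window_lim (a 0 i) (b 0 i) k (x 0 i)).
  have tw n : trig_poly (fun x : 'rV[R]_d =>
      \prod_i window (a 0 i) (b 0 i) k n (x 0 i)).
    by apply: trig_poly_prod => i; exact: trig_poly_window.
  apply: (same_lim (f := fun n x => \prod_i window (a 0 i) (b 0 i) k n (x 0 i))
    (M := 3 ^+ d)).
  - by move=> n; have [] := trig_poly_bounded (tw n).
  - by move=> n x; apply: bnd => i; exact: window_bounded.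
  - move=> x; apply: cvg_big => [|i _]; last exact: cvg_window.
    exact: mul_continuous.
  - by move=> n; exact: trig_poly_same.
have blim k (x : 'rV[R]_d) : `|\prod_i window_lim (a 0 i) (b 0 i) k (x 0 i)| <= 3 ^+ d.
  apply: bnd => i; rewrite /window_lim /=.
  by case: sgrP => _; case: sgrP => _; rewrite ler_norml; apply/andP; split; lra.
have [_ h] : measurable_fun setT
      (fun x : 'rV[R]_d => \prod_i ((a 0 i < x 0 i < b 0 i)%R%:R : R)) /\
    \int[p]_x (\prod_i ((a 0 i < x 0 i < b 0 i)%R%:R : R)) =
    \int[q]_x (\prod_i ((a 0 i < x 0 i < b 0 i)%R%:R : R)).
  apply: (same_lim (fun k => (step1 k).1) blim _ (fun k => (step1 k).2)) => x.
  apply: cvg_big => [|i _]; last exact: cvg_window_lim.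
  exact: mul_continuous.
have boxE (x : 'rV[R]_d) : \prod_i ((a 0 i < x 0 i < b 0 i)%R%:R : R) = \1_(box a b) x.
  rewrite indicE; case: (boolP (x \in box a b)) => [/set_mem xab|].
    by apply: big1 => i _; rewrite (xab i).
  rewrite notin_setE => /existsNP[i /negP/negbTE xi].
  by rewrite (bigD1 i)//= xi mul0r.
have E (m : {measure set 'rV[R]_d -> \bar R}) : (m setT < +oo)%E ->
    m (box a b) = (\int[m]_x (\prod_i ((a 0 i < x 0 i < b 0 i)%R%:R : R)))%:E.
  move=> mfin; rewrite /Rintegral; under eq_integral do rewrite boxE.
  rewrite integral_indic ?setIT//; last exact: measurable_box.
  rewrite fineK// ge0_fin_numE//; apply: le_lt_trans mfin.
  by apply: le_measure; rewrite ?inE//; exact: measurable_box.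
by rewrite !E// h.
Qed.

End CharfunUnique.

(** * Pointwise bounds on the heat kernel *)

Section Enorm.
Context {R : realType} {d : nat}.
Implicit Types x : 'rV[R]_d.

Lemma ler_coord_norm x i : `|x 0 i| <= `|x|.
Proof.
rewrite [`|x|]mx_normrE.
exact: (@le_bigmax _ _ _ 0 (fun ij : 'I_1 * 'I_d => `|x ij.1 ij.2|) (0, i)).
Qed.

Lemma norm_rV_le x c : 0 <= c -> (forall i, `|x 0 i| <= c) -> `|x| <= c.
Proof.
move=> c0 h; rewrite [`|x|]mx_normrE; apply: bigmax_le => // -[i j] _ /=.
by rewrite ord1.
Qed.

Lemma dotvv_ge0 x : 0 <= dotv x x.
Proof. by apply: sumr_ge0 => i _; rewrite -expr2 sqr_ge0. Qed.

Lemma enorm_sqr x : enorm x ^+ 2 = dotv x x.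
Proof. by rewrite sqr_sqrtr// dotvv_ge0. Qed.

Lemma norm_le_enorm x : `|x| <= enorm x.
Proof.
apply: norm_rV_le => [|i]; first exact: sqrtr_ge0.
rewrite -sqrtr_sqr ler_sqrt ?dotvv_ge0// /dotv (bigD1 i)//= -expr2 lerDl.
by apply: sumr_ge0 => j _; rewrite -expr2 sqr_ge0.
Qed.

Lemma enorm_le_norm x : enorm x <= d%:R * `|x|.
Proof.
rewrite -[leRHS]ger0_norm ?mulr_ge0// -[leRHS]sqrtr_sqr ler_sqrt ?sqr_ge0//.
rewrite exprMn /dotv.
apply: (@le_trans _ _ (\sum_(i < d) `|x| ^+ 2)).
  apply: ler_sum => i _; rewrite -expr2 -[leLHS]real_normK ?num_real//.
  by rewrite lerXn2r ?nnegrE ?ler_coord_norm.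
rewrite sumr_const card_ord -[leLHS]mulr_natl ler_wpM2r ?sqr_ge0//.
by case: (d) => [|n]; rewrite ?expr0n//= ler_eXnr// ler1n.
Qed.

End Enorm.

(** The assumptions on the kernel other than the equation that it solves,
    bundled so as to be passed as a single hypothesis. *)
Record regular_heat_kernel {R : realType} {d : nat}
    (nu : {measure set 'rV[R]_d -> \bar R}) (P : 'rV[R]_d * R -> R) : Prop :=
  RegularHeatKernel {
    rhk_heat : heat_kernel nu P ;
    rhk_cont_pos : forall t : R, 0 < t ->
      continuous (fun x : 'rV[R]_d => P (x, t)) /\
      forall x : 'rV[R]_d, 0 < P (x, t) ;
    rhk_time : forall eps tau : R, 0 < eps -> eps < tau ->
      exists2 C : R, 1 < C & forall (x : 'rV[R]_d) (t s : R),
        eps <= t <= tau -> eps <= s <= tau ->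
        C^-1 * P (x, t) <= P (x, s) <= C * P (x, t) ;
    rhk_space : forall r : R, 0 < r ->
      exists2 C : R, 0 < C & forall x y : 'rV[R]_d,
        enorm x < r -> P (x - y, 1) <= C * P (y, 1) }.

Section HeatKernelBounds.
Context {R : realType} {d : nat}.
Variables (nu : {measure set 'rV[R]_d -> \bar R}) (P : 'rV[R]_d * R -> R).
Hypothesis HP : regular_heat_kernel nu P.

Local Notation lam := (lebesgue_rV R d).

Lemma heat_ge0 x t : 0 < t -> 0 <= P (x, t).
Proof. by move=> /(rhk_cont_pos HP)[_ h]; exact: ltW. Qed.

Lemma measurable_heat (t : R) : 0 < t -> measurable_fun setT (fun x => P (x, t)).
Proof. by move=> /(rhk_cont_pos HP)[h _]; exact: continuous_measurable_rV. Qed.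

Lemma measurable_heatB (x : 'rV[R]_d) (t : R) : 0 < t ->
  measurable_fun setT (fun y : 'rV[R]_d => P (x - y, t)).
Proof.
move=> t0; apply: continuous_measurable_rV => y.
apply: (@continuous_comp _ _ _ (fun y : 'rV[R]_d => x - y) (fun z => P (z, t))).
  by apply: continuousB; [exact: cst_continuous|exact: cvg_id].
exact: (rhk_cont_pos HP t0).1.
Qed.

Lemma integral_heat t : 0 < t -> (\int[lam]_x (P (x, t))%:E = 1)%E.
Proof.
move=> /(rhk_heat HP)[p [_ _ pE]].
by rewrite -pE// probability_setT.
Qed.

Lemma integrable_heat t : 0 < t -> lam.-integrable setT (fun x => (P (x, t))%:E).
Proof. by move=> /(rhk_heat HP)[p []]. Qed.

Lemma ge0_integral_heat_law t (p : probability 'rV[R]_d R) f : 0 < t ->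
  (forall A, measurable A -> p A = (\int[lam]_(x in A) (P (x, t))%:E)%E) ->
  measurable_fun setT f -> (forall x, 0 <= f x)%E ->
  (\int[p]_x f x = \int[lam]_x (f x * (P (x, t))%:E))%E.
Proof.
move=> t0 pE mf f0; apply: ge0_integral_density => //.
- exact: measurable_heat.
- by move=> x; exact: heat_ge0.
Qed.

(** The comparison of times is applied on an interval enlarged so as to
    contain 1. *)
Lemma heat_le_heat1 eps tau : 0 < eps ->
  exists2 C : R, 0 < C & forall x t, eps <= t <= tau ->
    P (x, t) <= C * P (x, 1).
Proof.
move=> e0; have [||C C1 h] := rhk_time HP (eps := Num.min eps 2^-1) (tau := Num.max tau 1).
- by rewrite lt_min e0 invr_gt0/=.
- by rewrite lt_max; apply/orP; right; rewrite gt_min; apply/orP; right; lra.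
exists C => [|x t /andP[et tt]]; first by rewrite (lt_trans _ C1).
have := h x 1 t; rewrite !ge_min !le_max et tt lexx !orbT/=.
have -> : (2^-1 <= 1 :> R) by lra.
by rewrite orbT => /(_ isT isT)/andP[].
Qed.

Lemma heat_shift_le eps tau r : 0 < eps ->
  exists2 C : R, 0 < C & forall x y t, `|x| <= r -> eps <= t <= tau ->
    P (x - y, t) <= C * P (y, 1).
Proof.
move=> e0; have [C1 C10 h1] := heat_le_heat1 tau e0.
have r'0 : 0 < d%:R * Num.max r 0 + 1 by rewrite ltr_wpDl ?mulr_ge0// le_max lexx orbT.
have [C2 C20 h2] := rhk_space HP r'0.
exists (C1 * C2) => [|x y t xr tt]; first exact: mulr_gt0.
rewrite (le_trans (h1 _ _ tt))// -mulrA ler_pM2l//; apply: h2.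
apply: le_lt_trans (enorm_le_norm x) _.
rewrite (@le_lt_trans _ _ (d%:R * Num.max r 0)) ?ltrDl//.
by rewrite ler_wpM2l// le_max xr.
Qed.

(** The comparison with translates, at the zero translation. *)
Lemma heatN_le : exists2 C : R, 0 < C & forall x, P (x, 1) <= C * P (- x, 1).
Proof.
have [C C0 h] := @heat_shift_le 1 1 0 ltr01.
exists C => // x; have := h 0 (- x) 1; rewrite normr0 !lexx sub0r opprK.
exact.
Qed.

Lemma lebesgue_rV_ball_gt0 (c : 'rV[R]_d) r : 0 < r -> (0 < lam (ball c r))%E.
Proof.
move=> r0; rewrite ball_box// /box lebesgue_rV_box => [|i].
  by rewrite lte_fin; apply: prodr_gt0 => i _; rewrite !mxE; lra.
by rewrite !mxE; lra.
Qed.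

(** The mass of [P_1] on a unit ball is at most 1, while its values there are
    all comparable to the value at the centre. *)
Lemma heat1_bounded : exists M : R, forall x, P (x, 1) <= M.
Proof.
have [C C0 h] := @heat_shift_le 1 1 1 ltr01.
pose B := ball (0 : 'rV[R]_d) (1 : R).
have B0 : (0 < lam B)%E := @lebesgue_rV_ball_gt0 0 1 ltr01.
have Boo : (lam B < +oo)%E := @lebesgue_rV_ball_lty R d 1.
have mB : measurable B.
  by apply: open_measurable_rV; exact: ball_open.
have BE : lam B = (fine (lam B))%:E.
  by rewrite fineK// ge0_fin_numE.
have b0 : 0 < fine (lam B) by rewrite fine_gt0// B0.
exists (C / fine (lam B)) => y.
rewrite ler_pdivlMr// -lee_fin EFinM -BE.
rewrite -integral_cst//.
apply: (@le_trans _ _ (\int[lam]_(x in B) (C * P (x - y, 1))%:E)%E).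
  apply: ge0_le_integral => //.
  - by move=> x _; rewrite lee_fin heat_ge0.
  - apply/measurable_EFinP; apply: measurable_funM => //.
    apply: measurable_funTS; apply: (measurableT_comp (measurable_heat ltr01)).
    exact: measurable_shift.
  - move=> x; rewrite /B -ball_normE /= sub0r normrN => /ltW x1.
    rewrite lee_fin; have := h x (x - y) 1 x1; rewrite !lexx subKr; exact.
apply: (@le_trans _ _ (\int[lam]_x (C * P (x - y, 1))%:E)%E).
  apply: ge0_subset_integral => //.
    apply/measurable_EFinP; apply: measurable_funM => //.
    apply: (measurableT_comp (measurable_heat ltr01)).
    exact: measurable_shift.
  by move=> x _; rewrite lee_fin mulr_ge0 ?heat_ge0// ltW.
have mP1 : measurable_fun setT (fun x => (P (x, 1))%:E).
  by apply/measurable_EFinP; exact: measurable_heat.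
under eq_integral do rewrite EFinM.
rewrite ge0_integralZl ?lee_fin ?(ltW C0)//.
- rewrite (ge0_integral_translate (- y) (f := fun x => (P (x, 1))%:E))//.
    by rewrite integral_heat// mule1.
  by move=> x; rewrite lee_fin heat_ge0.
- by apply: (measurableT_comp mP1); exact: measurable_shift.
- by move=> x _; rewrite lee_fin heat_ge0.
Qed.

Lemma heat_bounded t : 0 < t -> exists M : R, forall x, P (x, t) <= M.
Proof.
move=> t0; have [M hM] := heat1_bounded; have [C C0 h] := heat_le_heat1 t t0.
exists (C * M) => x; rewrite (le_trans (h x t _)) ?lexx//.
by rewrite ler_pM2l.
Qed.

End HeatKernelBounds.

(** * The semigroup property *)

Section ProductExpectation.
Context {R : realType} {d1 d2 : measure_display}.
Context {T1 : measurableType d1} {T2 : measurableType d2}.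
Variables (m1 : probability T1 R) (m2 : probability T2 R).

Lemma Rintegral_prodM (f : T1 -> R) (g : T2 -> R) :
  measurable_fun setT f -> measurable_fun setT g ->
  (forall x, `|f x| <= 1) -> (forall y, `|g y| <= 1) ->
  (m1 \x m2)%E.-integrable setT (fun z => (f z.1 * g z.2)%:E) /\
  \int[(m1 \x m2)%E]_z (f z.1 * g z.2) =
  (\int[m1]_x f x) * (\int[m2]_y g y).
Proof.
move=> mf mg f1 g1.
have m1oo : (m1 setT < +oo)%E by rewrite probability_setT ltry.
have m2oo : (m2 setT < +oo)%E by rewrite probability_setT ltry.
have if_ : m1.-integrable setT (EFin \o f) by exact: bounded_integrable f1.
have ig : m2.-integrable setT (EFin \o g) by exact: bounded_integrable g1.
have m12 : ((m1 \x m2) setT < +oo)%E.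
  rewrite -setXTT product_measure1E//. by rewrite [X in (X * _)%E](probability_setT m1) [X in (_ * X)%E](probability_setT m2) mule1 ltry.
have ifg : (m1 \x m2)%E.-integrable setT (EFin \o (fun z => f z.1 * g z.2)).
  apply: (bounded_integrable (M := 1)) => // [|z].
    by apply: measurable_funM; exact: measurableT_comp.
  by rewrite normrM mulr_ile1.
split=> //; rewrite /Rintegral -integral12_prod_meas1// /fubini_F /=.
have gE : (\int[m2]_y (g y)%:E = (\int[m2]_y g y)%:E)%E.
  by rewrite fineK//; exact: integrable_fin_num.
have fE : (\int[m1]_x (f x)%:E = (\int[m1]_x f x)%:E)%E.
  by rewrite fineK//; exact: integrable_fin_num.
under eq_integral => x _.
  under eq_integral do rewrite EFinM.
  rewrite integralZl// gE -EFinM mulrC EFinM.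
  over.
by rewrite /= integralZl// fE -EFinM mulrC.
Qed.

End ProductExpectation.

Section Pushforward.
Context {R : realType} {d1 d2 : measure_display}.
Context {X : measurableType d1} {Y : measurableType d2}.
Variables (m : {measure set X -> \bar R}) (phi : X -> Y).
Hypothesis mphi : measurable_fun setT phi.

Definition pushforward_measure : {measure set Y -> \bar R} :=
  measure_function_pushforward__canonical__measure_function_Measure m mphi.

Lemma Rintegral_pushforward (f : Y -> R) :
  measurable_fun setT f -> m.-integrable setT (EFin \o (f \o phi)) ->
  \int[pushforward_measure]_y f y = \int[m]_x f (phi x).
Proof.
move=> mf intf; rewrite /Rintegral (integral_pushforward mphi)//.
exact/measurable_EFinP.
Qed.

End Pushforward.

Section ContinuousDensity.
Context {R : realType} {d : nat}.
Local Notation lam := (lebesgue_rV R d).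

(** If [f > g] at a point, the inequality persists with a margin on a ball,
    whose measure is positive and finite. *)
Let le_continuous_of_integral (f g : 'rV[R]_d -> R) :
  continuous f -> continuous g ->
  (forall A, measurable A ->
    \int[lam]_(x in A) (f x)%:E = \int[lam]_(x in A) (g x)%:E)%E ->
  forall x, f x <= g x.
Proof.
move=> cf cg fg x0; rewrite leNgt; apply/negP => gf.
pose e := (f x0 - g x0) / 3.
have e0 : 0 < e by rewrite divr_gt0 ?subr_gt0.
have : nbhs x0 [set x | `|f x0 - f x| < e /\ `|g x0 - g x| < e].
  apply: filterI.
    by have /cvgrPdist_lt /(_ e e0) := cf x0.
  by have /cvgrPdist_lt /(_ e e0) := cg x0.
move=> /nbhs_ballP[r /= r0 rB]; set B := ball x0 r in rB.
have mB : measurable B by apply: open_measurable_rV; exact: ball_open.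
have B0 : (0 < lam B)%E by exact: lebesgue_rV_ball_gt0.
have Boo : (lam B < +oo)%E.
  apply: (@le_lt_trans _ _ (lam (ball (0 : 'rV[R]_d) (`|x0| + r)))).
    apply: le_measure; rewrite ?inE//.
      by apply: open_measurable_rV; exact: ball_open.
    move=> x; rewrite /B -!ball_normE /= => xr; rewrite sub0r normrN.
    by rewrite -(subrK x0 x) addrC (le_lt_trans (ler_normD _ _))// ltrD2l distrC.
  exact: lebesgue_rV_ball_lty.
have bnd (h : 'rV[R]_d -> R) : continuous h ->
    (forall x, B x -> `|h x0 - h x| < e) -> lam.-integrable B (EFin \o h).
  move=> ch hB; apply: measurable_bounded_integrable => //.
    by apply: measurable_funTS; exact: continuous_measurable_rV.
  exists (`|h x0| + e); split; first exact: num_real.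
  move=> M hM x Bx /=; rewrite (le_trans _ (ltW hM))//.
  rewrite -(subrK (h x0) (h x)) addrC (le_trans (ler_normD _ _))//.
  by rewrite lerD2l distrC ltW// hB.
have fB : lam.-integrable B (EFin \o f) by apply: bnd => // x /rB[].
have gB : lam.-integrable B (EFin \o g) by apply: bnd => // x /rB[].
have := fg B mB; apply/eqP; rewrite gt_eqF//.
rewrite -sube_gt0 ?integrable_fin_num//.
rewrite -integralB_EFin//; apply: (@lt_le_trans _ _ (\int[lam]_(x in B) e%:E)%E).
  by rewrite integral_cst// mule_gt0.
apply: ge0_le_integral => //.
- by move=> x _; rewrite lee_fin ltW.
- by apply: emeasurable_funB; [exact: measurable_int fB|exact: measurable_int gB].
- move=> x /rB[]; rewrite !ltr_distlC /e => /andP[h1 h2] /andP[h3 h4].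
  by rewrite /= lee_fin; lra.
Qed.

Lemma eq_continuous_of_integral (f g : 'rV[R]_d -> R) :
  continuous f -> continuous g ->
  (forall A, measurable A ->
    \int[lam]_(x in A) (f x)%:E = \int[lam]_(x in A) (g x)%:E)%E ->
  forall x, f x = g x.
Proof.
move=> cf cg fg x; apply/eqP; rewrite eq_le.
by rewrite !le_continuous_of_integral// => A mA; rewrite fg.
Qed.

End ContinuousDensity.

Section Semigroup.
Context {R : realType} {d : nat}.
Variables (nu : {measure set 'rV[R]_d -> \bar R}) (P : 'rV[R]_d * R -> R).
Hypothesis HP : regular_heat_kernel nu P.

Local Notation lam := (lebesgue_rV R d).

Lemma integrable_heatM t (f : 'rV[R]_d -> R) M : 0 < t ->
  measurable_fun setT f -> (forall x, `|f x| <= M) ->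
  lam.-integrable setT (fun x => (f x * P (x, t))%:E).
Proof.
move=> t0 mf fM.
apply: (le_integrable measurableT _ _ (integrableZl measurableT `|M| (integrable_heat HP t0))).
  apply/measurable_EFinP; apply: measurable_funM => //.
  exact: (measurable_heat HP t0).
move=> x _ /=; rewrite lee_fin !normrM normr_id ler_wpM2r//.
by rewrite (le_trans (fM x))// ler_norm.
Qed.

Lemma heat_norm_bounded t : 0 < t ->
  exists2 M : R, 0 <= M & forall x, `|P (x, t)| <= M.
Proof.
move=> t0; have [M h] := heat_bounded HP t0; exists M => [|x].
  by rewrite (le_trans _ (h 0))// (heat_ge0 HP).
by rewrite ger0_norm ?h// (heat_ge0 HP).
Qed.

Lemma continuous_heat_conv (t s : R) : 0 < t -> 0 < s ->
  continuous (fun x : 'rV[R]_d => \int[lam]_y (P (x - y, t) * P (y, s))).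
Proof.
move=> t0 s0 x; have [M M0 hM] := heat_norm_bounded t0.
apply: (@cvg_within_interior _ _ setT); first exact: filterT.
apply: (cvg_Rintegral (g := fun y => M * P (y, s))).
- move=> v _; apply: measurable_funM; first exact: (measurable_heatB HP).
  exact: (measurable_heat HP).
- apply: measurable_funM; first exact: (measurable_heatB HP).
  exact: (measurable_heat HP).
- exact: (integrableZl measurableT M (integrable_heat HP s0)).
- by move=> v y _; rewrite normrM [X in _ * X]ger0_norm ?ler_wpM2r ?(heat_ge0 HP).
- move=> y; apply: cvg_within_filter; apply: cvgM; last exact: cvg_cst.
  apply: (continuous_comp (f := fun z : 'rV[R]_d => z - y) (g := fun z => P (z, t))).
    by apply: continuousB; [exact: cvg_id|exact: cst_continuous].
  exact: (rhk_cont_pos HP t0).1.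
Qed.

(** The characteristic function of a sum of independent variables is the
    product of the characteristic functions. *)
Lemma levy_law_add t s (pt ps pts : probability 'rV[R]_d R)
    (A : set 'rV[R]_d) :
  levy_law nu t pt -> levy_law nu s ps -> levy_law nu (t + s) pts ->
  measurable A ->
  (pt \x ps)%E ((fun z : 'rV[R]_d * 'rV[R]_d => z.1 + z.2) @^-1` A) = pts A.
Proof.
move=> lt ls lts mA.
have madd := @measurable_addr_rV R d.
have ptoo := probability_setT pt; have psoo := probability_setT ps.
pose q := pushforward_measure (pt \x ps)%E madd.
apply: (charfun_unique (p := q) (q := pts)) => //.
- rewrite /q /= /pushforward preimage_setT -setXTT product_measure1E//.
  by rewrite [X in (X * _)%E]ptoo [X in (_ * X)%E]psoo mule1 ltry.
- by rewrite [X in (X < _)%E](probability_setT pts) ltry.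
have mc xi : measurable_fun setT (fun x : 'rV[R]_d => cos (dotv xi x)).
  exact: (measurableT_comp measurable_cos (measurable_dotv xi)).
have ms xi : measurable_fun setT (fun x : 'rV[R]_d => sin (dotv xi x)).
  exact: (measurableT_comp measurable_sin (measurable_dotv xi)).
have c1 xi (x : 'rV[R]_d) : `|cos (dotv xi x)| <= 1 by exact: cos_max.
have s1 xi (x : 'rV[R]_d) : `|sin (dotv xi x)| <= 1 by exact: sin_max.
move=> xi.
have [icc Ecc] := Rintegral_prodM pt ps (mc xi) (mc xi) (c1 xi) (c1 xi).
have [iss Ess] := Rintegral_prodM pt ps (ms xi) (ms xi) (s1 xi) (s1 xi).
have [isc Esc] := Rintegral_prodM pt ps (ms xi) (mc xi) (s1 xi) (c1 xi).
have [ics Ecs] := Rintegral_prodM pt ps (mc xi) (ms xi) (c1 xi) (s1 xi).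
have [ct st] := lt xi; have [cs ss] := ls xi; have [cts sts] := lts xi.
have EC : (fun x => cos (dotv xi x)) \o (fun z => z.1 + z.2) =
    (fun z : 'rV[R]_d * 'rV[R]_d => cos (dotv xi z.1) * cos (dotv xi z.2) -
    sin (dotv xi z.1) * sin (dotv xi z.2)).
  by apply/funext => z /=; rewrite dotvDr cosD.
have ES : (fun x => sin (dotv xi x)) \o (fun z => z.1 + z.2) =
    (fun z : 'rV[R]_d * 'rV[R]_d => sin (dotv xi z.1) * cos (dotv xi z.2) +
    cos (dotv xi z.1) * sin (dotv xi z.2)).
  by apply/funext => z /=; rewrite dotvDr sinD.
rewrite cts sts; split.
  rewrite (Rintegral_pushforward madd (mc xi)); last first.
    by rewrite EC; exact: (integrableB measurableT icc iss).
  transitivity (\int[(pt \x ps)%E]_z (cos (dotv xi z.1) * cos (dotv xi z.2) -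
      sin (dotv xi z.1) * sin (dotv xi z.2))); first by rewrite -EC.
  rewrite RintegralB// Ecc Ess ct cs st ss mulr0 subr0 -expRD.
  by congr expR; ring.
rewrite (Rintegral_pushforward madd (ms xi)); last first.
  by rewrite ES; exact: (integrableD measurableT isc ics).
transitivity (\int[(pt \x ps)%E]_z (sin (dotv xi z.1) * cos (dotv xi z.2) +
    cos (dotv xi z.1) * sin (dotv xi z.2))); first by rewrite -ES.
by rewrite RintegralD// Esc Ecs ct cs st ss mulr0 mul0r addr0.
Qed.

Lemma ge0_heat_semigroup (x : 'rV[R]_d) (t s : R) : 0 < t -> 0 < s ->
  (\int[lam]_y (P (x - y, t) * P (y, s))%:E =
   (\int[lam]_y (P (x - y, t) * P (y, s)))%:E)%E.
Proof.
move=> t0 s0; rewrite fineK//; apply: integrable_fin_num => //.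
have [M M0 hM] := heat_norm_bounded t0.
by apply: (integrable_heatM (f := fun y => P (x - y, t)) s0 (measurable_heatB HP x t0)) => y.
Qed.

(** Both sides are the mass that the law at time [t + s] gives to [A]: the
    convolution is the density of the sum. *)
Lemma integral_heat_conv (t s : R) (A : set 'rV[R]_d) : 0 < t -> 0 < s -> measurable A ->
  (\int[lam]_(x in A) (\int[lam]_y (P (x - y, t) * P (y, s)))%:E =
   \int[lam]_(x in A) (P (x, (t + s)%R))%:E)%E.
Proof.
move=> t0 s0 mA.
have [pt [lt _ ptE]] := rhk_heat HP t0.
have [ps [ls _ psE]] := rhk_heat HP s0.
have [pts [lts _ ptsE]] := rhk_heat HP (addr_gt0 t0 s0).
rewrite -ptsE// -(levy_law_add lt ls lts mA).
have madd := @measurable_addr_rV R d.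
set B := (fun z : 'rV[R]_d * 'rV[R]_d => z.1 + z.2) @^-1` A.
have mB : measurable B by rewrite -[X in measurable X]setTI; exact: madd.
have mPt : measurable_fun setT (fun z : 'rV[R]_d * 'rV[R]_d => P (z.1 - z.2, t)).
  by apply: (measurableT_comp (measurable_heat HP t0)); exact: measurable_subr_rV.
pose G (z : 'rV[R]_d * 'rV[R]_d) := (\1_A z.1 * P (z.1 - z.2, t))%:E.
have mG : measurable_fun setT G.
  apply/measurable_EFinP; apply: measurable_funM => //.
  by apply: (@measurableT_comp _ _ _ _ _ _ (\1_A : 'rV[R]_d -> R)).
have G0 z : (0 <= G z)%E.
  by rewrite lee_fin mulr_ge0 ?(heat_ge0 HP).
have mPs : measurable_fun setT
    (fun z : 'rV[R]_d * 'rV[R]_d => (P (z.2, s))%:E).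
  apply/measurable_EFinP.
  by apply: (measurableT_comp (measurable_heat HP s0)); exact: measurable_snd.
have -> : (pt \x ps)%E B = (\int[pt \x ps]_z (\1_B z)%:E)%E.
  by rewrite integral_indic ?setIT.
rewrite fubini_tonelli2//; last exact/measurable_EFinP.
transitivity (\int[ps]_y \int[lam]_x G (x, y))%E; last first.
  apply: eq_integral => y _; rewrite /fubini_G.
  rewrite (ge0_integral_heat_law HP t0 ptE); last 2 first.
  - by apply/measurable_EFinP; exact: measurable_fun_pair1.
  - by move=> x; rewrite lee_fin.
  rewrite -(ge0_integral_translate y)//; last exact: measurable_fun_pair1.
  by apply: eq_integral => x _; rewrite /G /= addrK EFinM.
rewrite (ge0_integral_heat_law HP s0 psE); last 2 first.
- exact: measurable_fun_fubini_tonelli_G.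
- by move=> y; apply: integral_ge0.
transitivity (\int[lam]_y \int[lam]_x (G (x, y) * (P (y, s))%:E))%E; last first.
  apply: eq_integral => y _; rewrite ge0_integralZr// ?lee_fin ?(heat_ge0 HP)//.
  exact: measurable_fun_pair1.
rewrite -(fubini_tonelli (fun z => G z * (P (z.2, s))%:E))%E//; last 2 first.
- exact: emeasurable_funM.
- by move=> z; rewrite mule_ge0// lee_fin (heat_ge0 HP).
rewrite integral_mkcond; apply: eq_integral => x _.
rewrite patchE; case: ifPn => [xA|xA].
  rewrite -ge0_heat_semigroup//; apply: eq_integral => y _.
  by rewrite /G /= indicE xA mul1r EFinM.
rewrite integral0_eq// => y _.
by rewrite /G /= indicE (negbTE xA) mul0r mul0e.
Qed.

(** The Chapman-Kolmogorov identity holds at every point, both sides being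
    continuous. *)
Lemma heat_semigroup (x : 'rV[R]_d) (t s : R) : 0 < t -> 0 < s ->
  \int[lam]_y (P (x - y, t) * P (y, s)) = P (x, t + s).
Proof.
move=> t0 s0; have cc := continuous_heat_conv t0 s0.
have [cP _] := rhk_cont_pos HP (addr_gt0 t0 s0).
set f := (fun x : 'rV[R]_d => \int[lam]_y (P (x - y, t) * P (y, s))) in cc.
have fg A : measurable A -> (\int[lam]_(x in A) (f x)%:E =
   \int[lam]_(x in A) (P (x, t + s)%R)%:E)%E by exact: integral_heat_conv.
exact: (eq_continuous_of_integral cc cP fg).
Qed.

End Semigroup.

(** * Concentration at small times *)

Section Concentration.
Context {R : realType} {d : nat}.
Variables (nu : {measure set 'rV[R]_d -> \bar R}) (P : 'rV[R]_d * R -> R).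
Hypothesis HP : regular_heat_kernel nu P.

Local Notation lam := (lebesgue_rV R d).
Local Notation V := 'rV[R]_d.

Lemma measurable_norm_rV : measurable_fun setT (fun x : V => `|x|).
Proof. by apply: continuous_measurable_rV; exact: norm_continuous. Qed.

Definition norm_gt (r : R) : set V := [set x | r < `|x|].
Definition norm_ge (r : R) : set V := [set x | r <= `|x|].

Lemma measurable_norm_gt r : measurable (norm_gt r).
Proof.
rewrite -[X in measurable X]setTI.
have -> : norm_gt r = (fun x : V => `|x|) @^-1` `]r, +oo[.
  by apply/seteqP; split=> x /=; rewrite in_itv/= andbT.
exact: measurable_norm_rV.
Qed.

Lemma measurable_norm_ge r : measurable (norm_ge r).
Proof.
rewrite -[X in measurable X]setTI.
have -> : norm_ge r = (fun x : V => `|x|) @^-1` `[r, +oo[.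
  by apply/seteqP; split=> x /=; rewrite in_itv/= andbT.
exact: measurable_norm_rV.
Qed.

Lemma probability_norm_gt (p : probability V R) (eps : R) : 0 < eps ->
  exists n : nat, (p (norm_gt n%:R) <= eps%:E)%E.
Proof.
move=> e0; pose F n := ~` norm_gt (n%:R).
have mF n : measurable (F n) by apply: measurableC; exact: measurable_norm_gt.
have UF : \bigcup_n F n = setT.
  apply/seteqP; split=> // x _; exists (truncn `|x|).+1 => //=.
  by rewrite /F /norm_gt /=; apply/negP; rewrite -leNgt ltW// truncnS_gt.
have h : p (F n) @[n --> \oo] --> p (\bigcup_n F n).
  apply: nondecreasing_cvg_mu => //; first exact: bigcup_measurable.
  move=> m n mn; apply/subsetPset => x; rewrite /F /norm_gt /= => /negP; rewrite -leNgt => xm.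
  by apply/negP; rewrite -leNgt (le_trans xm)// ler_nat.
move: h; rewrite UF probability_setT => /fine_cvgP[_ /cvgrPdist_lt /(_ eps e0)].
move=> [n _ /(_ n (leqnn n))] /=; exists n.
have pF : p (F n) \is a fin_num by rewrite fin_num_measure.
have -> : norm_gt (n%:R) = ~` F n by rewrite /F setCK.
rewrite probability_setC// -(fineK pF) -EFinB lee_fin.
by apply: le_trans (ltW _); last eassumption; rewrite ler_norm.
Qed.

(** Let [X] and [Y] be independent with laws [p_1] and [p_t].  If [Y] is far from
    the origin and [X] is not, then [X + Y] is far from the origin; but [X + Y]
    has the density [P_(1+t) <= C P_1]. *)
Lemma heat_tight eps : 0 < eps -> exists2 r : R, 0 < r &
  forall t (p : probability V R), 0 < t <= 1 -> levy_law nu t p ->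
    (p (norm_gt r) <= eps%:E)%E.
Proof.
move=> e0.
have [p1 [l1 i1 p1E]] := rhk_heat HP ltr01.
have [C C0 hC] := heat_le_heat1 HP 2 ltr01.
have h20 : 0 < 2^-1 :> R by rewrite invr_gt0.
have [n hn] := probability_norm_gt p1 h20.
have eC0 : 0 < eps / (2 * C) by rewrite divr_gt0// mulr_gt0.
have [m hm] := probability_norm_gt p1 eC0.
(* [X] stays within [n] with probability 1/2; [q] is the law of [X + Y]. *)
exists (m%:R + n%:R + 1) => [|t p /andP[t0 t1] lp].
  by rewrite ltr_wpDl// addr_ge0.
have t10 : 0 < 1 + t by rewrite addr_gt0.
have [q [lq iq qE]] := rhk_heat HP t10.
pose A := norm_gt (m%:R).
have mA : measurable A by exact: measurable_norm_gt.
have qA : (q A <= C%:E * p1 A)%E.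
  rewrite qE// p1E// -ge0_integralZl//; last 3 first.
  - apply/measurable_EFinP; apply: measurable_funTS.
    exact: (measurable_heat HP).
  - by move=> x _; rewrite lee_fin (heat_ge0 HP).
  - by rewrite lee_fin ltW.
  apply: ge0_le_integral => //.
  - by move=> x _; rewrite lee_fin (heat_ge0 HP).
  - apply/measurable_EFinP; apply: measurable_funTS.
    exact: (measurable_heat HP).
  - apply/measurable_EFinP; apply: measurable_funTS; apply: measurable_funM => //.
    exact: (measurable_heat HP).
  - by move=> x _; rewrite lee_fin hC//; lra.
pose B := norm_gt (m%:R + n%:R + 1).
have mB : measurable B by exact: measurable_norm_gt.
pose D := ~` norm_gt (n%:R).
have mD : measurable D by apply: measurableC; exact: measurable_norm_gt.
have pD : (2^-1%:E <= p1 D)%E.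
  rewrite /D probability_setC; last exact: measurable_norm_gt.
  have pf : p1 (norm_gt n%:R) \is a fin_num.
    by rewrite fin_num_measure//; exact: measurable_norm_gt.
  move: hn; rewrite -(fineK pf) -EFinB !lee_fin; lra.
(* Independence of [X] in [D] and [Y] in [B], which together put [X + Y] in [A]. *)
have DB : (p1 D * p B <= q A)%E.
  rewrite -(levy_law_add l1 lp lq mA) -product_measure1E//.
  apply: le_measure; rewrite ?inE.
  - exact: measurableX.
  - by rewrite -[X in measurable X]setTI; exact: measurable_addr_rV.
  - move=> [x y] /= [/negP]; rewrite -leNgt /B /A /norm_gt /= => xn yB.
    have : `|y| <= `|x + y| + `|x|.
      by rewrite -{1}(addKr x y) [- x + _]addrC ler_normB.
    lra.
have pBf : p B \is a fin_num by rewrite fin_num_measure.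
have : (2^-1%:E * p B <= C%:E * (eps / (2 * C))%:E)%E.
  apply: le_trans (_ : p1 D * p B <= _)%E; first by rewrite lee_wpmul2r.
  apply: le_trans DB _; apply: le_trans qA _.
  by rewrite lee_wpmul2l// lee_fin ltW.
rewrite -(fineK pBf) -!EFinM !lee_fin.
have -> : C * (eps / (2 * C)) = eps / 2 by field; rewrite gt_eqF.
by lra.
Qed.

Lemma cos_le_of_ge (r c : R) : 0 < c <= `|r| -> `|r| <= 1 -> cos r <= cos c.
Proof.
move=> /andP[c0 cr] r1; have p2 := @pi_ge2 R.
by rewrite -(cos_norm r) leNgt ltr_cos ?in_itv/= -?leNgt//; lra.
Qed.

(** Tightness confines the mass to a ball of radius [r1], on which the
    frequencies [e_i / r1] are free of aliasing: off the ball of radius [r]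
    one of the terms [1 - cos (x_i / r1)] is bounded below, while their
    expectations [1 - exp (- t m)] tend to 0. *)
Lemma heat_concentration r eps : 0 < r -> 0 < eps ->
  exists2 del : R, 0 < del & forall t (p : probability V R),
    0 < t < del -> levy_law nu t p ->
    (p (norm_ge r) <= eps%:E)%E.
Proof.
move=> r0 e0.
have e20 : 0 < eps / 2 by rewrite divr_gt0.
have [r0' r0'0 htight] := heat_tight e20.
pose r1 := Num.max r r0'.
have r10 : 0 < r1 by rewrite lt_max r0.
have rr1 : r / r1 <= 1 by rewrite ler_pdivrMr// mul1r le_max lexx.
(* The smallest value of [1 - cos (s / r1)] over [r <= s <= r1]. *)
pose k := 1 - cos (r / r1).
have k0 : 0 < k.
  rewrite subr_gt0 -[ltRHS]cos0 ltr_cos ?in_itv/= ?lexx ?pi_ge0 ?divr_gt0//.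
  by rewrite ltW ?divr_gt0//=; have := pi_ge2 R; lra.
pose xi i : V := r1^-1 *: delta_mx 0 i.
pose S t := \sum_(i < d) (1 - expR (- (t * levy_exponent nu (xi i)))).
have S0 : S t @[t --> (0 : R)] --> (0 : R).
  have S00 : S 0 = 0.
    by rewrite /S big1// => i _; rewrite mul0r oppr0 expR0 subrr.
  rewrite -[X in _ --> X]S00.
  apply: cvg_big => [|i _]; first exact: add_continuous.
  apply: cvgB; first exact: cvg_cst.
  apply: continuous_cvg; first exact: continuous_expR.
  by apply: cvgN; apply: cvgM; [exact: cvg_id|exact: cvg_cst].
have ke0 : 0 < k * (eps / 2) by rewrite mulr_gt0.
have /cvgrPdist_lt /(_ _ ke0) /nbhs_ballP[del /= del0 hdel] := S0.
exists (Num.min del 1) => [|t p /andP[t0]]; first by rewrite lt_min del0 ltr01.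
rewrite lt_min => /andP[tdel t1] lp.
have St : S t < k * (eps / 2).
  have : ball (0 : R) del t by rewrite /ball /= sub0r normrN gtr0_norm.
  by move=> /hdel; rewrite sub0r normrN; apply: le_lt_trans; exact: ler_norm.
pose A := norm_ge (r); pose B := norm_gt (r0').
have mA : measurable A by exact: measurable_norm_ge.
have mB : measurable B by exact: measurable_norm_gt.
have pB : (p B <= (eps / 2)%:E)%E by apply: htight lp; rewrite t0 ltW.
have mc i : measurable_fun setT (fun x : V => cos (dotv (xi i) x)).
  exact: (measurableT_comp measurable_cos (measurable_dotv (xi i))).
have poo : (p setT < +oo)%E by rewrite probability_setT ltry.
have ic i : p.-integrable setT (EFin \o (fun x : V => 1 - cos (dotv (xi i) x))).
  apply: (bounded_integrable (M := 2)) => // [|x]; first exact: measurable_funB.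
  have := cos_max (dotv (xi i) x); rewrite !ler_norml; lra.
have IS : (\int[p]_x (\sum_(i < d) (1 - cos (dotv (xi i) x)))%:E = (S t)%:E)%E.
  under eq_integral do rewrite -sumEFin.
  rewrite integral_sum//.
  rewrite -sumEFin; apply: eq_bigr => i _.
  have icos : p.-integrable setT (EFin \o (fun x : V => cos (dotv (xi i) x))).
    by apply: (bounded_integrable (M := 1)) => // x; exact: cos_max.
  have icst : p.-integrable setT (EFin \o (fun _ : V => 1 : R)).
    by apply: (bounded_integrable (M := 1)) => // x; rewrite normr1.
  rewrite integralB_EFin//= integral_cst//= [X in (1 * X)%E]probability_setT mule1.
  have [<- _] := lp (xi i).
  by rewrite EFinB fineK//; exact: integrable_fin_num.
have pAB : (p (A `\` B) <= (eps / 2)%:E)%E.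
  have mAB : measurable (A `\` B) by exact: measurableD.
  have pf : p (A `\` B) \is a fin_num by rewrite fin_num_measure.
  suff : (k%:E * p (A `\` B) <= (k * (eps / 2))%:E)%E.
    by rewrite -(fineK pf) -EFinM !lee_fin ler_pM2l.
  rewrite -integral_cst//; apply: (@le_trans _ _ (S t)%:E); last by rewrite lee_fin ltW.
  rewrite -IS; apply: (@le_trans _ _
    (\int[p]_(x in A `\` B) (\sum_(i < d) (1 - cos (dotv (xi i) x)))%:E)%E).
    apply: ge0_le_integral => //.
    - by move=> x _; rewrite lee_fin ltW.
    - apply/measurable_EFinP; apply: measurable_funTS; apply: measurable_sum => i.
      exact: measurable_funB.
    - move=> x [rx /negP]; rewrite -leNgt => xr0; rewrite lee_fin.
      (* The coordinate realizing the sup norm provides the large term. *)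
      have xn0 : mx_norm x != 0 by rewrite gt_eqF// (lt_le_trans r0 rx).
      have [[i0 i] /= xE] := mx_norm_neq0 xn0; rewrite ord1 in xE.
      rewrite (bigD1 i)//= /k; apply: ler_wpDr.
        by apply: sumr_ge0 => j _; rewrite subr_ge0 cos_le1.
      rewrite lerD2l lerN2 dotv_delta; apply: cos_le_of_ge.
        rewrite divr_gt0//= normrM -xE [`|r1^-1|]gtr0_norm ?invr_gt0//.
        by rewrite [leRHS]mulrC ler_pM2r ?invr_gt0.
      rewrite normrM -xE [`|r1^-1|]gtr0_norm ?invr_gt0// mulrC.
      by rewrite ler_pdivrMr// mul1r (le_trans xr0)// le_max lexx orbT.
  apply: ge0_subset_integral => //.
    apply/measurable_EFinP; apply: measurable_sum => i; exact: measurable_funB.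
  move=> x _; rewrite lee_fin; apply: sumr_ge0 => i _.
  by rewrite subr_ge0 cos_le1.
apply: (@le_trans _ _ (p (A `\` B) + p B)%E).
  apply: le_trans (measureU2 _ _ _) => //; last exact: measurableD.
  apply: le_measure; rewrite ?inE//.
    by apply: measurableU => //; exact: measurableD.
  by move=> x Ax; have [Bx|nBx] := pselect (B x); [right|left].
by rewrite [leRHS](_ : _ = (eps / 2)%:E + (eps / 2)%:E)%E ?leeD// -EFinD -splitr.
Qed.

End Concentration.

(** * Joint continuity in space and time *)

Section JointContinuity.
Context {R : realType} {d : nat}.
Variables (nu : {measure set 'rV[R]_d -> \bar R}) (P : 'rV[R]_d * R -> R).
Hypothesis HP : regular_heat_kernel nu P.

Local Notation lam := (lebesgue_rV R d).
Local Notation V := 'rV[R]_d.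

Lemma Rintegral_heat t : 0 < t -> \int[lam]_x P (x, t) = 1.
Proof. by move=> t0; rewrite /Rintegral (integral_heat HP). Qed.

(** Near the origin [f] is close to [f 0], and the rest of the space carries
    little mass. *)
Lemma heat_dirac (f : V -> R) M : measurable_fun setT f ->
  (forall x, `|f x| <= M) -> f x @[x --> (0 : V)] --> f 0 ->
  \int[lam]_x (f x * P (x, t)) @[t --> 0^'+] --> f 0.
Proof.
move=> mf fM f0; apply/cvgrPdist_le => e e0.
have M0 : 0 <= M by rewrite (le_trans _ (fM 0)).
have e20 : 0 < e / 2 by rewrite divr_gt0.
have /cvgrPdist_lt /(_ _ e20) /nbhs_ballP[r /= r0 hr] := f0.
pose K := 2 * M + 1.
have K0 : 0 < K by rewrite /K; lra.
have eK0 : 0 < e / 2 / K by rewrite divr_gt0.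
have [del del0 hdel] := heat_concentration HP r0 eK0.
near=> t.
have t0 : 0 < t by [].
have tdel : t < del by near: t; exact: nbhs_right_lt.
have [p [lp _ pE]] := rhk_heat HP t0.
have pA : (p (@norm_ge R d r) <= (e / 2 / K)%:E)%E by apply: hdel lp; rewrite t0.
have iP : lam.-integrable setT (EFin \o (fun x => P (x, t))).
  exact: (integrable_heat HP).
have ifP := integrable_heatM HP t0 mf fM.
have if0P : lam.-integrable setT (fun x => (f 0 * P (x, t))%:E).
  exact: (integrableZl measurableT (f 0) iP).
have igP : lam.-integrable setT (fun x => ((f 0 - f x) * P (x, t))%:E).
  have := integrableB measurableT if0P ifP; apply: eq_integrable => // x _.
  by rewrite /= mulrBl.
have -> : f 0 - \int[lam]_x (f x * P (x, t)) =
    \int[lam]_x ((f 0 - f x) * P (x, t)).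
  rewrite -[X in X - _]mulr1 -(Rintegral_heat t0) -RintegralZl// -RintegralB//.
  by apply: eq_Rintegral => x _; rewrite mulrBl.
apply: le_trans (le_normr_Rintegral _ igP) _ => //.
rewrite -lee_fin /Rintegral fineK; last first.
  by apply: integrable_fin_num => //; exact: (integrable_abse igP).
have mA : measurable (@norm_ge R d r) by exact: measurable_norm_ge.
have mEP : measurable_fun setT (fun x => (P (x, t))%:E).
  by apply/measurable_EFinP; exact: (measurable_heat HP).
apply: (@le_trans _ _ (\int[lam]_x ((e / 2)%:E * (P (x, t))%:E +
    K%:E * ((\1_(norm_ge r) x)%:E * (P (x, t))%:E)))%E).
  apply: ge0_le_integral => //.
  - apply/measurable_EFinP; apply: measurableT_comp => //.
    apply: measurable_funM; last exact: (measurable_heat HP).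
    exact: measurable_funB.
  - apply: emeasurable_funD; first exact: emeasurable_funM.
    by do 2 apply: emeasurable_funM => //; exact/measurable_EFinP.
  - move=> x _; rewrite -!EFinM -EFinD lee_fin normrM [`|P _|]ger0_norm ?(heat_ge0 HP)//.
    rewrite mulrA -mulrDl ler_wpM2r ?(heat_ge0 HP)// indicE.
    case: (boolP (x \in _)) => [_|]; rewrite /= ?mulr1 ?mulr0 ?addr0.
      rewrite (le_trans (ler_normB _ _))// /K.
      by have := fM 0; have := fM x; lra.
    rewrite notin_setE /norm_ge /= => /negP; rewrite -ltNge => xr.
    by apply/ltW/hr; rewrite -ball_normE /= sub0r normrN.
have P0 x : (0 <= (P (x, t))%:E)%E by rewrite lee_fin (heat_ge0 HP).
rewrite ge0_integralD//; last 4 first.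
- by move=> x _; rewrite mule_ge0// lee_fin ltW.
- exact: emeasurable_funM.
- by move=> x _; rewrite !mule_ge0// lee_fin// ltW.
- by do 2 apply: emeasurable_funM => //; exact/measurable_EFinP.
rewrite !ge0_integralZl// ?lee_fin ?(ltW K0) ?(ltW e20)//; last 2 first.
- by apply: emeasurable_funM => //; exact/measurable_EFinP.
- by move=> x _; rewrite mule_ge0// lee_fin.
have -> : (\int[lam]_x ((\1_(norm_ge r) x)%:E * (P (x, t))%:E) =
    p (@norm_ge R d r))%E.
  rewrite -(ge0_integral_heat_law HP t0 pE) ?integral_indic ?setIT//.
  exact/measurable_EFinP.
rewrite (integral_heat HP)// mule1.
have -> : e%:E = ((e / 2)%:E + (e / 2)%:E)%E by rewrite -EFinD -splitr.
apply: leeD => //.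
apply: (@le_trans _ _ (K%:E * (e / 2 / K)%:E)%E).
  by rewrite lee_wpmul2l// lee_fin ltW.
by rewrite -EFinM lee_fin mulrC divfK// gt_eqF.
Unshelve. all: by end_near. Qed.

(** With [t = a + (t - a)], the semigroup property writes the increments of
    [P_t] as averages of the increments of [P_a] with weight [P_(t-a) <= C
    P_1]: this is a modulus of continuity common to all times between [2 a]
    and [tau]. *)
Let modulus a (x x' : V) : R :=
  \int[lam]_y (`|P (x - y, a) - P (x' - y, a)| * P (y, 1)).

Let modulus_bounded a : 0 < a ->
  exists M, forall x x' : V, `|modulus a x x'| <= M.
Proof.
move=> a0; have [M M0 hM] := heat_norm_bounded HP a0.
exists (2 * M) => x x'.
have iPM : lam.-integrable setT (fun y : V => (2 * M * P (y, 1))%:E).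
  exact: (integrableZl measurableT (2 * M) (integrable_heat HP ltr01)).
have bnd (y : V) : `|P (x - y, a) - P (x' - y, a)| <= 2 * M.
  by rewrite (le_trans (ler_normB _ _))//; have := hM (x - y); have := hM (x' - y); lra.
have iD : lam.-integrable setT (fun y : V => (`|P (x - y, a) - P (x' - y, a)| * P (y, 1))%:E).
  apply: (integrable_heatM HP ltr01 (M := 2 * M)) => [|y]; last by rewrite normr_id.
  by apply: measurableT_comp => //; apply: measurable_funB; exact: (measurable_heatB HP).
rewrite ger0_norm; last first.
  by apply: Rintegral_ge0 => y _; rewrite mulr_ge0// (heat_ge0 HP).
apply: (@le_trans _ _ (\int[lam]_y (2 * M * P (y, 1)))).
  by apply: le_Rintegral => // y _; rewrite ler_wpM2r// (heat_ge0 HP).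
rewrite RintegralZl//; last exact: (integrable_heat HP).
by rewrite Rintegral_heat// mulr1.
Qed.

Let continuous_modulus a (x : V) : 0 < a -> continuous (modulus a x).
Proof.
move=> a0 x'; have [M M0 hM] := heat_norm_bounded HP a0.
apply: (@cvg_within_interior _ _ setT); first exact: filterT.
have mD (v : V) : measurable_fun setT
    (fun y : V => `|P (x - y, a) - P (v - y, a)| * P (y, 1)).
  apply: measurable_funM; last exact: (measurable_heat HP).
  by apply: measurableT_comp => //; apply: measurable_funB; exact: (measurable_heatB HP).
apply: (cvg_Rintegral (g := fun y => 2 * M * P (y, 1))) => //.
- exact: (integrableZl measurableT (2 * M) (integrable_heat HP ltr01)).
- move=> v y _; rewrite normrM normr_id [`|P (y, _)|]ger0_norm ?(heat_ge0 HP)//.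
  rewrite ler_wpM2r ?(heat_ge0 HP)// (le_trans (ler_normB _ _))//.
  by have := hM (x - y); have := hM (v - y); lra.
- move=> y; apply: cvg_within_filter; apply: cvgM; last exact: cvg_cst.
  apply: cvg_norm; apply: cvgB; first exact: cvg_cst.
  apply: (continuous_comp (f := fun z : V => z - y) (g := fun z => P (z, a))).
    by apply: continuousB; [exact: cvg_id|exact: cst_continuous].
  exact: (rhk_cont_pos HP a0).1.
Qed.

Let modulus_diag a x : modulus a x x = 0.
Proof.
rewrite /modulus /Rintegral integral0_eq//= => y _.
by rewrite subrr normr0 mul0r.
Qed.

Let heat_modulus a tau : 0 < a -> exists2 C : R, 0 < C & forall t (x x' : V),
  2 * a <= t <= tau -> `|P (x, t) - P (x', t)| <= C * modulus a x x'.
Proof.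
move=> a0; have [C C0 hC] := heat_le_heat1 HP tau a0.
exists C => // t x x' /andP[at_ tt].
have ta0 : 0 < t - a by rewrite subr_gt0; lra.
have [M M0 hM] := heat_norm_bounded HP a0.
have semi (z : V) := heat_semigroup HP z a0 ta0.
rewrite [a + _]addrC subrK in semi.
have iD (z : V) : lam.-integrable setT (fun y : V => (P (z - y, a) * P (y, t - a))%:E).
  by apply: (integrable_heatM HP ta0 (M := M)) => //; exact: (measurable_heatB HP).
rewrite -!semi -(RintegralB measurableT (iD x) (iD x')).
have iB : lam.-integrable setT
    (fun y : V => (P (x - y, a) * P (y, t - a) - P (x' - y, a) * P (y, t - a))%:E).
  exact: (integrableB measurableT (iD x) (iD x')).
apply: le_trans (le_normr_Rintegral _ iB) _ => //.
have iM : lam.-integrable setT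
    (fun y : V => (`|P (x - y, a) - P (x' - y, a)| * P (y, 1))%:E).
  apply: (integrable_heatM HP ltr01 (M := 2 * M)) => [|y].
    by apply: measurableT_comp => //; apply: measurable_funB; exact: (measurable_heatB HP).
  rewrite normr_id (le_trans (ler_normB _ _))//.
  by have := hM (x - y); have := hM (x' - y); lra.
rewrite /modulus -RintegralZl//.
apply: le_Rintegral => //.
- exact: (integrable_abse iB).
- exact: (integrableZl measurableT C iM).
- move=> y _ /=; rewrite -mulrBl normrM [`|P (y, _)|]ger0_norm ?(heat_ge0 HP)//.
  rewrite mulrCA ler_wpM2l//; apply: hC; lra.
Qed.

(** The uniform modulus handles the space variable.  For the time variable,
    [P_(r+h)(x0) - P_r(x0)] averages the spatial increments of [P_r] at [x0]
    against [P_h], and [P_h] is an approximation of the identity. *)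
Lemma heat_continuous (x0 : V) t0 : 0 < t0 -> {for (x0, t0), continuous P}.
Proof.
move=> t00.
have a0 : 0 < t0 / 4 by rewrite divr_gt0.
have [C C0 hC] := heat_modulus (2 * t0) a0.
have [M hM] := modulus_bounded a0.
set a := t0 / 4 in a0 hC hM.
have cm := @continuous_modulus a x0 a0.
pose f (y : V) := modulus a x0 (x0 - y).
have cf : continuous f.
  move=> y; apply: (continuous_comp (f := fun y : V => x0 - y) (g := modulus a x0)).
    by apply: continuousB; [exact: cst_continuous|exact: cvg_id].
  exact: cm.
have mf : measurable_fun setT f by exact: continuous_measurable_rV.
have f0 : f 0 = 0 by rewrite /f subr0 modulus_diag.
have fd : \int[lam]_x (f x * P (x, t)) @[t --> 0^'+] --> f 0.
  exact: (heat_dirac mf (fun y => hM x0 (x0 - y)) (cf 0)).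
(* Increments forward in time; the smaller of the two times plays the
   role of [r]. *)
have time r h : 2 * a <= r <= 2 * t0 -> 0 < h ->
    `|P (x0, r + h) - P (x0, r)| <= C * \int[lam]_y (f y * P (y, h)).
  move=> /andP[r1 r2] h0; have r0 : 0 < r by lra.
  have [M' M'0 hM'] := heat_norm_bounded HP r0.
  rewrite -(heat_semigroup HP x0 r0 h0).
  have iD : lam.-integrable setT (fun y : V => (P (x0 - y, r) * P (y, h))%:E).
    by apply: (integrable_heatM HP h0 (M := M')) => //; exact: (measurable_heatB HP).
  have iP : lam.-integrable setT (fun y : V => (P (x0, r) * P (y, h))%:E).
    exact: (integrableZl measurableT (P (x0, r)) (integrable_heat HP h0)).
  have ifP : lam.-integrable setT (fun y : V => (f y * P (y, h))%:E).
    exact: (integrable_heatM HP h0 mf (fun y => hM x0 (x0 - y))).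
  have iB : lam.-integrable setT
      (fun y : V => (P (x0 - y, r) * P (y, h) - P (x0, r) * P (y, h))%:E).
    exact: (integrableB measurableT iD iP).
  rewrite -[X in _ - X]mulr1 -(Rintegral_heat h0) -RintegralZl//; last first.
    exact: (integrable_heat HP).
  rewrite -RintegralB//.
  apply: le_trans (le_normr_Rintegral _ iB) _ => //.
  rewrite -RintegralZl//; apply: le_Rintegral => //.
  - exact: (integrable_abse iB).
  - exact: (integrableZl measurableT C ifP).
  - move=> y _ /=; rewrite -mulrBl normrM [`|P (y, _)|]ger0_norm ?(heat_ge0 HP)//.
    by rewrite mulrA ler_wpM2r ?(heat_ge0 HP)// distrC hC// r1.
apply/cvgrPdist_le => e e0.
have e30 : 0 < e / (2 * C) by rewrite divr_gt0// mulr_gt0.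
have : \forall h \near 0^'+, \int[lam]_y (f y * P (y, h)) <= e / (2 * C).
  move/cvgrPdist_le : fd => /(_ _ e30); rewrite f0; apply: filterS => h.
  by rewrite sub0r normrN; apply: le_trans; exact: ler_norm.
move=> -[del /= del0 hdel].
have /cvgrPdist_le /(_ _ e30) /nbhs_ballP[rho /= rho0 hrho] := cm x0.
exists (ball x0 rho, ball t0 (Num.min del (t0 / 2))) => /=.
  by split; apply: nbhsx_ballx => //; rewrite lt_min del0 divr_gt0.
move=> [x t] /= [xr]; rewrite /ball/= lt_min => /andP[tdel].
rewrite ltr_distlC => /andP[t1 t2].
have t12 : 2 * a <= t <= 2 * t0 by rewrite /a; lra.
have Hx : `|P (x0, t) - P (x, t)| <= e / 2.
  apply: le_trans (hC _ x0 x t12) _.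
  have := hrho _ xr; rewrite modulus_diag sub0r normrN => h.
  have -> : e / 2 = C * (e / (2 * C)) by field; rewrite gt_eqF.
  by rewrite ler_pM2l// (le_trans (ler_norm _)).
have Ht : `|P (x0, t0) - P (x0, t)| <= e / 2.
  have -> : e / 2 = C * (e / (2 * C)) by field; rewrite gt_eqF.
  have key r h : 2 * a <= r <= 2 * t0 -> 0 < h < del ->
      `|P (x0, r + h) - P (x0, r)| <= C * (e / (2 * C)).
    move=> rr /andP[h0 hd]; apply: le_trans (time _ _ rr h0) _.
    rewrite ler_pM2l//; apply: hdel => //.
    by rewrite /ball/= sub0r normrN gtr0_norm.
  have [tt|tt|<-] := ltgtP t t0.
  - have := key t (t0 - t) t12; rewrite [t + _]addrC subrK; apply.
    by move: tdel; rewrite ltr_distlC; lra.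
  - have t0a : 2 * a <= t0 <= 2 * t0 by rewrite /a; lra.
    have := key t0 (t - t0) t0a; rewrite [t0 + _]addrC subrK distrC; apply.
    by move: tdel; rewrite ltr_distlC; lra.
  - by rewrite subrr normr0 mulr_ge0// ltW.
have -> : P (x0, t0) - P (x, t) =
  (P (x0, t0) - P (x0, t)) + (P (x0, t) - P (x, t)) by ring.
by rewrite (le_trans (ler_normD _ _))//; lra.
Qed.

End JointContinuity.

(** * Smooth bump functions *)

Section ClassC.
Context {R : realType} {V : normedModType R}.
Implicit Types f g : V -> R.

Lemma class_CS k f : class_C k.+1 f -> class_C k f.
Proof.
elim: k f => [|k IH] f [cf df h]; first exact: cf.
by split=> // v; apply: IH; exact: h.
Qed.

Lemma class_C_cst k (c : R) : class_C k (fun _ : V => c).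
Proof.
elim: k c => [|k IH] c /=; first by move=> x; exact: cst_continuous.
split=> [x|v z|v]; first exact: cst_continuous.
  exact: derivable_cst.
rewrite (_ : (fun z => 'D_v _ z) = (fun=> 0)); first exact: IH.
by apply/funext => z; rewrite derive_cst.
Qed.

Lemma class_CD k f g : class_C k f -> class_C k g ->
  class_C k (fun z => f z + g z).
Proof.
elim: k f g => [|k IH] f g; first by move=> cf cg z; apply: cvgD; [exact: cf|exact: cg].
move=> [cf df hf] [cg dg hg]; split.
- by move=> z; apply: cvgD; [exact: cf|exact: cg].
- by move=> v z; apply: derivableD.
- move=> v; rewrite (_ : (fun z => 'D_v _ z) = (fun z => 'D_v f z + 'D_v g z)).
    exact: (IH _ _ (hf v) (hg v)).
  by apply/funext => z; exact: deriveD.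
Qed.

Lemma class_CM k f g : class_C k f -> class_C k g ->
  class_C k (fun z => f z * g z).
Proof.
elim: k f g => [|k IH] f g; first by move=> cf cg z; apply: cvgM; [exact: cf|exact: cg].
move=> Cf Cg; have [cf df hf] := Cf; have [cg dg hg] := Cg; split.
- by move=> z; apply: cvgM; [exact: cf|exact: cg].
- by move=> v z; apply: derivableM.
- move=> v; rewrite (_ : (fun z => 'D_v _ z) = (fun z => f z * 'D_v g z + g z * 'D_v f z)).
    apply: class_CD.
      exact: (IH _ _ (class_CS Cf) (hg v)).
    exact: (IH _ _ (class_CS Cg) (hf v)).
  by apply/funext => z; exact: deriveM.
Qed.

Lemma class_C_prod k (I : Type) (r : seq I) (f : I -> V -> R) :
  (forall i, class_C k (f i)) -> class_C k (fun z => \prod_(i <- r) f i z).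
Proof.
move=> Cf; elim: r => [|i r IH].
  rewrite (_ : (fun z => _) = (fun=> 1)); first exact: class_C_cst.
  by apply/funext => z; rewrite big_nil.
rewrite (_ : (fun z => _) = (fun z => f i z * \prod_(j <- r) f j z)).
  exact: class_CM.
by apply/funext => z; rewrite big_cons.
Qed.

Lemma smooth_continuous f : smooth f -> continuous f.
Proof. by move=> /(_ 0%N). Qed.

Lemma smooth_derivable f v z : smooth f -> derivable f z v.
Proof. by move=> /(_ 1%N)[]. Qed.

Lemma smooth_derive f v : smooth f -> smooth (fun z => 'D_v f z).
Proof. by move=> sf k; have [_ _] := sf k.+1; exact. Qed.

End ClassC.

Section Flat.
Context {R : realType}.

(** The family indexed by [n] is stable under differentiation up to linear
    combinations, so that smoothness follows by induction on the order. *)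
Definition flat (n : nat) (x : R) : R :=
  if 0 < x then x^-1 ^+ n * expR (- x^-1) else 0.

Lemma flat_ge0 n x : 0 <= flat n x.
Proof.
rewrite /flat; case: ifPn => // x0.
by rewrite mulr_ge0 ?expR_ge0// exprn_ge0// invr_ge0 ltW.
Qed.

(** Compare with one term of the exponential series of [1 / x]. *)
Lemma flat_le n x : flat n x <= n.+1`!%:R * `|x|.
Proof.
rewrite /flat; case: ifPn => x0; last by rewrite mulr_ge0.
rewrite gtr0_norm// expRN ler_pdivrMr ?expR_gt0//.
have u0 : 0 < x^-1 by rewrite invr_gt0.
have f0 : 0 < n.+1`!%:R :> R by rewrite ltr0n fact_gt0.
have := expR_ge1Dxn n (ltW u0).
set w := expR _ => hw.
have h2 : x^-1 ^+ n.+1 / n.+1`!%:R <= w by lra.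
have -> : x^-1 ^+ n = n.+1`!%:R * x * (x^-1 ^+ n.+1 / n.+1`!%:R).
  rewrite exprS; field; rewrite !gt_eqF//.
by rewrite ler_wpM2l// mulr_ge0// ltW.
Qed.

Lemma flat_near0 n (x : R) : x < 0 -> \forall y \near x, 0 = flat n y.
Proof.
move=> x0; near=> y; rewrite /flat ltNge ltW//=.
by near: y; exact: lt_nbhsl.
Unshelve. all: by end_near. Qed.

Lemma flat_is_derive n (x : R) :
  is_derive x 1 (flat n) (flat n.+2 x - n%:R * flat n.+1 x).
Proof.
have [x0|x0|->] := ltgtP x 0.
- have -> : flat n.+2 x - n%:R * flat n.+1 x = 0.
    by rewrite /flat ltNge (ltW x0)/= mulr0 subr0.
  have := flat_near0 n x0.
  by move/(@near_eq_is_derive _ _ _ (fun=> 0) (flat n) x 1 0); apply.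
- have E : \forall y \near x, y^-1 ^+ n * expR (- y^-1) = flat n y.
    near=> y; rewrite /flat ifT//.
    by near: y; exact: lt_nbhsr.
  have xn0 : x != 0 by rewrite gt_eqF.
  apply: (near_eq_is_derive E).
  have dV : is_derive x 1 (fun y : R => y^-1) (- x ^- 2).
    by apply: (is_derive_eq (@is_deriveV _ id x 1 1 xn0 _)); rewrite /= [_ *: _]mulr1.
  have dh : is_derive x^-1 1 (fun u : R => u ^+ n * expR (- u))
      (n%:R * x^-1 ^+ n.-1 * expR (- x^-1) - x^-1 ^+ n * expR (- x^-1)).
    have dN : is_derive x^-1 1 (expR \o -%R) (expR (- x^-1) * (-1)).
      by apply: is_derive1_comp; exact: is_deriveN.
    have dX := is_deriveX n (is_derive_id x^-1 (1 : R)).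
    have -> : (fun u : R => u ^+ n * expR (- u)) =
        ((@id R) ^+ n) * (expR \o -%R).
      by apply/funext => u; rewrite mulrfctE exprfctE.
    apply: (is_derive_eq (is_deriveM dX dN)).
    rewrite exprfctE /= -![_ *: _]/(_ * _); ring.
  apply: (is_derive_eq (is_derive1_comp dh dV)).
  have H (u : R) k : k%:R * u ^+ k.-1 * u ^+ 2 = k%:R * u ^+ k.+1.
    by case: k => [|k]; rewrite ?mul0r//= -mulrA -exprD addn2.
  rewrite /flat x0 -exprVn; set u := x^-1; set w := expR (- u).
  rewrite [RHS](_ : _ = u ^+ n.+2 * w - (n%:R * u ^+ n.+1) * w); last by ring.
  by rewrite -H !exprS; ring.
- have fl0 m : flat m 0 = 0 by rewrite /flat ltxx.
  rewrite !fl0 mulr0 subr0.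
  have cv : h^-1 *: (flat n (h *: 1 + 0) - flat n 0) @[h --> 0^'] --> (0 : R).
    apply/cvgr0Pnorm_le => e e0; near=> h.
    rewrite fl0 subr0 addr0 [_ *: 1]mulr1 normrM.
    have h0 : h != 0 by near: h; exact: nbhs_dnbhs_neq.
    have -> : `|h^-1| * `|flat n h| = flat n.+1 h.
      rewrite /flat; case: ifPn => hp; last by rewrite normr0 mulr0.
      rewrite !ger0_norm ?invr_ge0 ?ltW// ?exprS ?mulrA//.
      by rewrite mulr_gt0 ?expR_gt0// exprn_gt0// invr_gt0.
    apply: le_trans (flat_le _ _) _.
    rewrite -ler_pdivlMl; last by rewrite ltr0n fact_gt0.
    near: h; apply: dnbhs0_le.
    by rewrite mulr_gt0// invr_gt0 ltr0n fact_gt0.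
  apply: DeriveDef; first by apply/cvg_ex; exists 0.
  exact/cvg_lim.
Unshelve. all: by end_near. Qed.

End Flat.

Section FlatAffine.
Context {R : realType} {V : normedModType R}.
Variables (l : V -> R) (c : R).
Hypothesis l_lin : forall (h : R) v z, l (h *: v + z) = h * l v + l z.
Hypothesis l_cont : continuous l.

Lemma continuous_flat n : continuous (@flat R n).
Proof.
move=> x; apply: (@differentiable_continuous _ R^o R^o).
apply/derivable1_diffP; exact: (@ex_derive _ _ _ _ _ _ _ (flat_is_derive n x)).
Qed.

Lemma flat_affine_is_derive n v z :
  is_derive z v (fun z => flat n (l z + c))
    (l v * (flat n.+2 (l z + c) - n%:R * flat n.+1 (l z + c))).
Proof.
set y := l z + c.
have [dy Dy] := flat_is_derive n y.
have diffy : differentiable (@flat R n) y by apply/derivable1_diffP.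
have dl : derivable (@flat R n) y (l v) by exact: diff_derivable.
have Dl : 'D_(l v) (@flat R n) y = l v * (flat n.+2 y - n%:R * flat n.+1 y).
  rewrite -Dy !deriveE// -[X in 'd _ _ X]mulr1.
  by rewrite -[X in 'd _ _ X]/(l v *: (1 : R)) linearZ.
have E : (fun h : R => h^-1 *: (flat n (l (h *: v + z) + c) - flat n (l z + c))) =
    (fun h : R => h^-1 *: (flat n (h *: l v + y) - flat n y)).
  by apply/funext => h; rewrite l_lin -addrA.
apply: DeriveDef.
  by move: dl; rewrite /derivable /= -E.
by rewrite -Dl /derive /= -E.
Qed.

(** Differentiation maps the span of these functions to itself, which makes
    the induction on [k] go through for all [n] at once. *)
Lemma class_C_flat_affine k n : class_C k (fun z => flat n (l z + c)).
Proof.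
have cont m : continuous (fun z => flat m (l z + c)).
  move=> z; apply: continuous_cvg; first exact: continuous_flat.
  by apply: cvgD; [exact: l_cont|exact: cvg_cst].
elim: k n => [|k IH] n; first exact: cont.
split=> // [v z|v].
  exact: (@ex_derive _ _ _ _ _ _ _ (flat_affine_is_derive n v z)).
rewrite (_ : (fun z => 'D_v _ z) = (fun z => l v *
    (flat n.+2 (l z + c) + (- n%:R) * flat n.+1 (l z + c)))).
  apply: class_CM; first exact: class_C_cst.
  apply: class_CD; first exact: IH.
  by apply: class_CM; [exact: class_C_cst|exact: IH].
by apply/funext => z; have [_ ->] := flat_affine_is_derive n v z; rewrite mulNr.
Qed.

End FlatAffine.

Section Bump.
Context {R : realType} {d : nat}.
Local Notation V := 'rV[R]_d.
Local Notation VT := ('rV[R]_d * R)%type.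

Definition slab (r e tau : R) : set VT := [set z | `|z.1| <= r /\ e <= z.2 <= tau].

Lemma compact_slab r e tau : compact (slab r e tau).
Proof.
have -> : slab r e tau = [set x : V | `|x| <= r] `*` `[e, tau]%classic.
  by apply/seteqP; split=> -[x t]; rewrite /slab /= in_itv.
apply: compact_setX; last exact: segment_compact.
apply: bounded_closed_compact.
  exists r; split; first exact: num_real.
  by move=> M rM x /= xr; rewrite (le_trans xr)// ltW.
rewrite (_ : [set x : V | `|x| <= r] = (fun x : V => `|x|) @^-1` [set s | s <= r])//.
apply: closed_comp; last exact: closed_le.
by move=> x _; exact: norm_continuous.
Qed.

Lemma closed_slab r e tau : closed (slab r e tau).
Proof. by apply: compact_closed; [exact: norm_hausdorff|exact: compact_slab]. Qed.

Lemma measurable_slab r e tau : measurable (slab r e tau).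
Proof. by apply: closed_measurable_prod; exact: closed_slab. Qed.

Lemma slab_measure_lty r e tau :
  ((lebesgue_rV R d \x lebesgue_measure)%E (slab r e tau) < +oo)%E.
Proof.
pose B := ball (0 : V) (r + 1).
have mB : measurable B by apply: open_measurable_rV; exact: ball_open.
apply: (@le_lt_trans _ _ ((lebesgue_rV R d \x lebesgue_measure)%E (B `*` `[e, tau]%classic))).
  apply: le_measure; rewrite ?inE.
  - exact: measurable_slab.
  - exact: measurableX.
  - move=> [x t] [/= xr et]; split => //=.
    by rewrite /B -ball_normE /= sub0r normrN (le_lt_trans xr)// ltrDl.
rewrite product_measure1E// lte_mul_pinfty//.
- rewrite ge0_fin_numE//; exact: lebesgue_rV_ball_lty.
- rewrite [X in (X < _)%E](lebesgue_measure_itv `[e, tau])/=; case: ifP => _; first exact: ltry.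
  exact: ltry.
Qed.

Definition boxbump (r e tau : R) (z : VT) : R :=
  (\prod_i (flat 0 (z.1 0 i + r) * flat 0 (- z.1 0 i + r))) *
  (flat 0 (z.2 - e) * flat 0 (- z.2 + tau)).

Lemma smooth_bump r e tau : smooth (boxbump r e tau).
Proof.
have c1 (i : 'I_d) : continuous (fun z : VT => z.1 0 i).
  move=> z; apply: (continuous_comp (f := fst) (g := fun x : V => x 0 i)).
    exact: cvg_fst.
  exact: coord_continuous.
have c2 : continuous (fun z : VT => z.2) by move=> z; exact: cvg_snd.
move=> k; apply: class_CM; last first.
  apply: class_CM; apply: class_C_flat_affine => //.
    by move=> h v z; rewrite /= opprD mulrN.
  by move=> z; apply: cvgN; exact: c2.
apply: class_C_prod => i; apply: class_CM; apply: class_C_flat_affine.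
- by move=> h v z; rewrite /= !mxE.
- exact: c1.
- by move=> h v z; rewrite /= !mxE opprD mulrN.
- by move=> z; apply: cvgN; exact: c1.
Qed.

Lemma bump_ge0 r e tau z : 0 <= boxbump r e tau z.
Proof.
by rewrite mulr_ge0 ?prodr_ge0// => [i _|]; rewrite mulr_ge0// flat_ge0.
Qed.

Lemma bump_out r e tau z : 0 <= r -> ~ slab r e tau z -> boxbump r e tau z = 0.
Proof.
move=> r0 nz; apply: contrapT => /eqP; rewrite mulf_eq0 negb_or mulf_eq0 negb_or.
have fl x : flat 0 x != 0 -> 0 < x.
  by rewrite /flat; case: ifP => // _; rewrite eqxx.
move=> /andP[/prodf_neq0 h /andP[/fl e1 /fl e2]]; apply: nz; split; last lra.
apply: norm_rV_le => // i; have := h i isT; rewrite mulf_eq0 negb_or.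
by move=> /andP[/fl h1 /fl h2]; rewrite ler_norml; lra.
Qed.

Lemma flat0_homo (x y : R) : x <= y -> flat 0 x <= flat 0 y.
Proof.
move=> xy; rewrite {1}/flat; case: ifPn => x0; last exact: flat_ge0.
have y0 : 0 < y by exact: lt_le_trans xy.
by rewrite /flat y0 !expr0 !mul1r ler_expR lerN2 lef_pV2.
Qed.

Lemma flat_gt0 n (x : R) : 0 < x -> 0 < flat n x.
Proof.
by move=> x0; rewrite /flat x0 mulr_gt0 ?expR_gt0// exprn_gt0// invr_gt0.
Qed.

(** The factors are nondecreasing functions of the distance to the faces of
    the larger slab. *)
Lemma bump_lower r e tau e' : e < e' -> exists2 c : R, 0 < c &
  forall z, slab r e' tau z -> c <= boxbump (r + 1) e (tau + 1) z.
Proof.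
move=> ee'; exists ((\prod_(i < d) (flat 0 1 * flat 0 1)) * (flat 0 (e' - e) * flat 0 1)).
  rewrite mulr_gt0 ?prodr_gt0// => [i _|]; rewrite mulr_gt0 ?flat_gt0//.
  by rewrite subr_gt0.
move=> z [zr /andP[ez zt]]; rewrite /boxbump ler_pM//.
- by rewrite prodr_ge0// => i _; rewrite mulr_ge0// flat_ge0.
- by rewrite mulr_ge0// flat_ge0.
- apply: ler_prod => i _; rewrite mulr_ge0 ?flat_ge0//=.
  have := le_trans (ler_coord_norm z.1 i) zr; rewrite ler_norml => /andP[h1 h2].
  by rewrite ler_pM ?flat_ge0// flat0_homo//; lra.
- by rewrite ler_pM ?flat_ge0// flat0_homo//; lra.
Qed.

End Bump.

(** * The operator on test functions *)

Section DirectionalLipschitz.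
Context {R : realType} {V : normedModType R}.
Implicit Types (f : V -> R) (z v w : V).

Lemma derivable_shift f v z w : derivable f (z + w) v ->
  derivable (fun z => f (z + w)) z v /\
  'D_v (fun z => f (z + w)) z = 'D_v f (z + w).
Proof.
have E : (fun h : R => h^-1 *: (f ((h *: v + z) + w) - f (z + w))) =
    (fun h : R => h^-1 *: (f (h *: v + (z + w)) - f (z + w))).
  by apply/funext => h; rewrite addrA.
move=> df; split; first by move: df; rewrite /derivable /= -E.
by rewrite /derive /= -E.
Qed.

Lemma line_is_derive f v z (s : R) : derivable f (s *: v + z) v ->
  is_derive s 1 (fun s : R => f (s *: v + z)) ('D_v f (s *: v + z)).
Proof.
have E : (fun h : R => h^-1 *: (f ((h *: 1 + s) *: v + z) - f (s *: v + z))) =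
    (fun h : R => h^-1 *: (f (h *: v + (s *: v + z)) - f (s *: v + z))).
  by apply/funext => h; rewrite [h *: 1]mulr1 scalerDl addrA.
move=> df; apply: DeriveDef; first by move: df; rewrite /derivable /= -E.
by rewrite /derive /= -E.
Qed.

Lemma dir_lipschitz f v M z (s : R) : (forall z, derivable f z v) ->
  (forall z, `|'D_v f z| <= M) -> `|f (s *: v + z) - f z| <= `|s| * M.
Proof.
move=> df fM.
pose g (s : R) := f (s *: v + z).
have dg (u : R) : is_derive u 1 g ('D_v f (u *: v + z)) by exact: line_is_derive.
have cg : continuous g.
  move=> u; apply: (@differentiable_continuous _ R^o R^o).
  by apply/derivable1_diffP; exact: (@ex_derive _ _ _ _ _ _ _ (dg u)).
have g0 : g 0 = f z by rewrite /g scale0r add0r.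
have [s0|s0] := leP 0 s.
  have [|c _] := @MVT_segment R g _ 0 s s0 (fun x _ => dg x).
    exact: continuous_subspaceT.
  by rewrite g0 subr0 => ->; rewrite normrM mulrC ler_wpM2l.
have [|c _] := @MVT_segment R g _ s 0 (ltW s0) (fun x _ => dg x).
  exact: continuous_subspaceT.
rewrite g0 sub0r -[f z - g s]opprB => /(congr1 -%R); rewrite opprK => ->.
by rewrite normrN normrM normrN mulrC ler_wpM2l.
Qed.

Lemma coord_lipschitz f M (I : Type) (r : seq I) (v : I -> V) (y : I -> R) z :
  (forall i z, derivable f z (v i)) -> (forall i z, `|'D_(v i) f z| <= M) ->
  `|f (\sum_(i <- r) y i *: v i + z) - f z| <= (\sum_(i <- r) `|y i|) * M.
Proof.
move=> df fM; elim: r z => [|i r IH] z.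
  by rewrite !big_nil add0r subrr normr0 mul0r.
rewrite !big_cons mulrDl -addrA; set w := \sum_(j <- r) _ in IH *.
have -> : f (y i *: v i + (w + z)) - f z =
    (f (y i *: v i + (w + z)) - f (w + z)) + (f (w + z) - f z).
  by rewrite [RHS]addrA subrK.
apply: le_trans (ler_normD _ _) _.
by apply: lerD; [exact: dir_lipschitz|exact: IH].
Qed.

(** The first difference [f (z + w) - f z] has directional derivatives that are
    themselves first differences, so the mean value theorem applies twice. *)
Lemma second_difference f M (I : Type) (r : seq I) (v : I -> V) (y : I -> R) z w :
  w = \sum_(i <- r) y i *: v i ->
  (forall i z, derivable f z (v i)) ->
  (forall i j z, derivable (fun z => 'D_(v i) f z) z (v j)) ->
  (forall i j z, `|'D_(v j) (fun z => 'D_(v i) f z) z| <= M) ->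
  `|(f (z + w) - f z) - (f z - f (z - w))| <= (\sum_(i <- r) `|y i|) ^+ 2 * M.
Proof.
move=> wE df ddf fM; set S := \sum_(i <- r) _.
pose g (z : V) := f (z + w) - f z.
have dshift i (z' : V) := derivable_shift (df i (z' + w)).
have dg i z' : derivable g z' (v i).
  by apply: derivableB; [exact: (dshift i z').1|exact: df].
have Dg i z' : 'D_(v i) g z' = 'D_(v i) f (z' + w) - 'D_(v i) f z'.
  by rewrite deriveB; [rewrite (dshift i z').2|exact: (dshift i z').1|exact: df].
have gM i z' : `|'D_(v i) g z'| <= S * M.
  by rewrite Dg [z' + w]addrC wE; exact: (coord_lipschitz r (v := v) y z' (ddf i) (fM i)).
have := coord_lipschitz r (v := v) y (z - w) dg gM.
rewrite -wE -/S [w + _]addrC subrK /g subrK mulrA -expr2.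
by [].
Qed.

End DirectionalLipschitz.

Section LevyTest.
Context {R : realType} {d : nat}.
Variable nu : {measure set 'rV[R]_d -> \bar R}.
Hypothesis nu_levy : symmetric_levy_measure nu.
Local Notation V := 'rV[R]_d.
Local Notation VT := ('rV[R]_d * R)%type.
Implicit Types (f : VT -> R).

Definition vanishes_off (K : set VT) f := forall z, ~ K z -> f z = 0.

Lemma vanishes_off_bounded K f : compact K -> continuous f ->
  vanishes_off K f -> exists2 M : R, 0 <= M & forall z, `|f z| <= M.
Proof.
move=> cK cf fK.
have cfK : compact (f @` K).
  by apply: continuous_compact => //; exact: continuous_subspaceT.
have [M [_ hM]] := compact_bounded cfK.
exists (Num.max 0 (M + 1)) => [|z]; first by rewrite le_max lexx.
have [Kz|nKz] := pselect (K z); last by rewrite fK// normr0 le_max lexx.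
by rewrite le_max (hM (M + 1)) ?orbT// ?ltrDl//; exists z.
Qed.

Lemma vanishes_off_derive K f v : closed K -> vanishes_off K f ->
  vanishes_off K (fun z => 'D_v f z).
Proof.
move=> cK fK z nKz.
have E : \forall z' \near z, f z' = cst 0 z'.
  have : nbhs z (~` K) by apply: open_nbhs_nbhs; split => //; exact: closed_openC.
  by apply: filterS => z' /fK.
by rewrite (near_eq_derive _ E) derive_cst.
Qed.

Definition levy_test f (z : VT) : R := levy_op nu (fun x => f (x, z.2)) z.1.

Let kernel f (z : VT) (y : V) : R :=
  f z - (f (z.1 + y, z.2) + f (z.1 - y, z.2)) / 2.

Let levy_testE f z : levy_test f z = \int[nu]_y kernel f z y.
Proof. by case: z. Qed.

Let weight (y : V) : R := Num.min 1 (enorm y ^+ 2).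

Lemma levy_weight_integrable : nu.-integrable setT (EFin \o weight).
Proof.
have [_ _ _ h] := nu_levy; apply/integrableP; split.
  apply/measurable_EFinP; apply: measurable_minr => //.
  under eq_fun do rewrite enorm_sqr.
  by apply: measurable_sum => i; apply: measurable_funM; exact: measurable_coord.
rewrite (eq_integral (EFin \o weight))// => y _ /=.
by rewrite ger0_norm// le_min ler01 sqr_ge0.
Qed.

(** Taylor estimate near the origin and boundedness elsewhere; both constants
    are uniform because [f] has compact support. *)
Let kernel_le f K : smooth f -> compact K -> closed K -> vanishes_off K f ->
  exists2 C : R, 0 <= C & forall z y, `|kernel f z y| <= C * weight y.
Proof.
move=> sf cK clK fK.
have [M0 M00 h0] := vanishes_off_bounded cK (smooth_continuous sf) fK.
pose v (i : 'I_d) : VT := (delta_mx 0 i, 0).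
have s1 i := smooth_derive (v i) sf.
have v1 i := vanishes_off_derive (v i) clK fK.
have s2 i j := smooth_derive (v j) (s1 i).
have v2 i j := vanishes_off_derive (v j) clK (v1 i).
have [M hM] : exists M : 'I_d -> 'I_d -> R, forall i j z,
    `|'D_(v j) (fun z => 'D_(v i) f z) z| <= M i j.
  have /choice[M hM] : forall i, exists Mi : 'I_d -> R, forall j z,
      `|'D_(v j) (fun z => 'D_(v i) f z) z| <= Mi j.
    move=> i; have /choice[M hM] : forall j, exists Mj : R, forall z,
        `|'D_(v j) (fun z => 'D_(v i) f z) z| <= Mj.
      move=> j.
      have [M _ hM] := vanishes_off_bounded cK (smooth_continuous (s2 i j)) (v2 i j).
      by exists M.
    by exists M.
  by exists M.
pose M2 := \sum_i \sum_j `|M i j|.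
have M20 : 0 <= M2 by apply: sumr_ge0 => i _; exact: sumr_ge0.
have hM2 i j z : `|'D_(v j) (fun z => 'D_(v i) f z) z| <= M2.
  rewrite (le_trans (hM i j z))// (le_trans (ler_norm _))// /M2.
  rewrite (bigD1 i)//= (bigD1 j)//= -addrA lerDl addr_ge0//.
    exact: sumr_ge0.
  by apply: sumr_ge0 => k _; exact: sumr_ge0.
exists (2 * M0 + d%:R ^+ 2 * M2) => [|z y].
  by rewrite addr_ge0 ?mulr_ge0.
have wE : ((y, 0) : VT) = \sum_i y 0 i *: v i.
  rewrite [RHS]surjective_pairing; congr pair.
    rewrite [LHS]row_sum_delta (big_morph fst (id1 := 0) (op1 := +%R))//.
  rewrite (big_morph snd (id1 := 0) (op1 := +%R))// big1// => i _ /=.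
  by rewrite scaler0.
have S2 := second_difference z wE (fun i z => smooth_derivable sf)
  (fun i j z => smooth_derivable (s1 i)) hM2.
have yn : 0 <= \sum_i `|y 0 i| <= d%:R * `|y|.
  rewrite sumr_ge0//=; apply: le_trans (_ : \sum_(i < d) `|y| <= _).
    by apply: ler_sum => i _; exact: ler_coord_norm.
  by rewrite sumr_const card_ord mulr_natl.
have kE : kernel f z y = - (((f (z + (y, 0)) - f z) - (f z - f (z - (y, 0)))) / 2).
  have -> : f (z + (y, 0)) = f (z.1 + y, z.2).
    by rewrite [z in LHS]surjective_pairing; congr (f (_, _)); rewrite addr0.
  have -> : f (z - (y, 0)) = f (z.1 - y, z.2).
    by rewrite [z in LHS]surjective_pairing; congr (f (_, _)); rewrite /= subr0.
  by rewrite /kernel; field.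
have k1 : `|kernel f z y| <= 2 * M0.
  rewrite /kernel (le_trans (ler_normB _ _))// normrM [`|2^-1|]gtr0_norm ?invr_gt0//.
  have := ler_normD (f (z.1 + y, z.2)) (f (z.1 - y, z.2)).
  have := h0 z; have := h0 (z.1 + y, z.2); have := h0 (z.1 - y, z.2); lra.
have k2 : `|kernel f z y| <= d%:R ^+ 2 * M2 * enorm y ^+ 2.
  rewrite kE normrN normrM [`|2^-1|]gtr0_norm ?invr_gt0//.
  have h1 : (\sum_i `|y 0 i|) ^+ 2 * M2 <= d%:R ^+ 2 * M2 * enorm y ^+ 2.
    rewrite [leRHS]mulrAC ler_wpM2r// -exprMn lerXn2r ?nnegrE ?mulr_ge0 ?sqrtr_ge0//.
      by case/andP: yn.
    case/andP: yn => _ yn; rewrite (le_trans yn)// ler_wpM2l//.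
    exact: norm_le_enorm.
  have h2 := le_trans S2 h1.
  by apply: le_trans h2; rewrite ler_pdivrMr// ler_peMr// ler1n.
rewrite /weight minr_pMr ?addr_ge0 ?mulr_ge0// le_min mulr1; apply/andP; split.
  by rewrite (le_trans k1)// lerDl mulr_ge0.
by rewrite (le_trans k2)// ler_wpM2r ?sqr_ge0// lerDr mulr_ge0.
Qed.

Let measurable_kernel f z : continuous f -> measurable_fun setT (kernel f z).
Proof.
move=> cf; apply: continuous_measurable_rV => y.
have c (s : V -> V) : continuous s -> f (s y', z.2) @[y' --> y] --> f (s y, z.2).
  move=> cs; apply: (continuous_comp (f := fun y => (s y, z.2)) (g := f)); last exact: cf.
  exact: (cvg_pair (cs y) (cvg_cst z.2)).
have c0 (a : R) : {for y, continuous (fun _ : V => a)} by exact: cst_continuous.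
apply: (continuousB (c0 (f z))).
apply: (continuousM _ (c0 _)).
apply: continuousD.
  apply: (c (fun y => z.1 + y)) => y'.
  by apply: (@continuousD _ _ _ (fun=> z.1) id); [exact: cst_continuous|exact: cvg_id].
apply: (c (fun y => z.1 - y)) => y'.
by apply: (@continuousB _ _ _ (fun=> z.1) id); [exact: cst_continuous|exact: cvg_id].
Qed.

Let kernel_integrable f K z : smooth f -> compact K -> closed K ->
  vanishes_off K f -> nu.-integrable setT (EFin \o kernel f z).
Proof.
move=> sf cK clK fK; have [C C0 hC] := kernel_le sf cK clK fK.
apply: (le_integrable measurableT _ _ (integrableZl measurableT C levy_weight_integrable)).
  by apply/measurable_EFinP; apply: measurable_kernel; exact: smooth_continuous.
move=> y _ /=; rewrite lee_fin (le_trans (hC z y))//; exact: ler_norm.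
Qed.

Lemma levy_test_continuous f K : smooth f -> compact K -> closed K ->
  vanishes_off K f -> continuous (levy_test f).
Proof.
move=> sf cK clK fK z; have [C C0 hC] := kernel_le sf cK clK fK.
rewrite (_ : levy_test f = (fun z => \int[nu]_y kernel f z y)); last first.
  by apply/funext => z'; rewrite levy_testE.
apply: (@cvg_within_interior _ _ setT); first exact: filterT.
have cf := smooth_continuous sf.
apply: (cvg_Rintegral (g := fun y => C * weight y)) => //.
- by move=> z' _; exact: measurable_kernel.
- exact: measurable_kernel.
- exact: (integrableZl measurableT C levy_weight_integrable).
- move=> y; apply: cvg_within_filter.
  have c (w : V) : f (z'.1 + w, z'.2) @[z' --> z] --> f (z.1 + w, z.2).
    apply: (continuous_comp (f := fun z : VT => (z.1 + w, z.2)) (g := f)); last exact: cf.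
    have h1 : z'.1 + w @[z' --> z] --> z.1 + w.
      by apply: cvgD; [exact: cvg_fst|exact: cvg_cst].
    have h2 : z'.2 @[z' --> z] --> z.2 by exact: cvg_snd.
    exact: (cvg_pair h1 h2).
  apply: cvgB; first exact: cf.
  by apply: cvgM; [apply: cvgD; exact: c|exact: cvg_cst].
Qed.

Lemma levy_test_bounded f K : smooth f -> compact K -> closed K ->
  vanishes_off K f -> exists2 M : R, 0 <= M & forall z, `|levy_test f z| <= M.
Proof.
move=> sf cK clK fK; have [C C0 hC] := kernel_le sf cK clK fK.
have iw : nu.-integrable setT (fun y => (C * weight y)%:E).
  exact: (integrableZl measurableT C levy_weight_integrable).
have ik z := kernel_integrable z sf cK clK fK.
exists (\int[nu]_y (C * weight y)) => [|z].
  by apply: Rintegral_ge0 => y _; rewrite (le_trans _ (hC 0 y)).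
rewrite levy_testE; apply: le_trans (le_normr_Rintegral _ (ik z)) _ => //.
apply: le_Rintegral => //.
exact: (integrable_abse (ik z)).
Qed.

(** Where [f] and [g] vanish, the integrand of the operator is minus the average
    of the values at the two symmetric jumps, on which [|f| <= g] can be used. *)
Lemma levy_test_comparison f g K : smooth f -> smooth g -> compact K -> closed K ->
  vanishes_off K f -> vanishes_off K g -> (forall z, `|f z| <= g z) ->
  forall z, ~ K z -> `|levy_test f z| <= - levy_test g z.
Proof.
move=> sf sg cK clK fK gK fg z nKz.
have ik := kernel_integrable z sf cK clK fK.
have ig := kernel_integrable z sg cK clK gK.
rewrite !levy_testE; apply: le_trans (le_normr_Rintegral _ ik) _ => //.
have -> : - (\int[nu]_y kernel g z y) = \int[nu]_y (-1 * kernel g z y).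
  by rewrite RintegralZl// mulN1r.
apply: le_Rintegral => //.
- exact: (integrable_abse ik).
- exact: (integrableZl measurableT (-1) ig).
- move=> y _; rewrite /kernel fK// gK// !sub0r mulN1r opprK normrN normrM.
  rewrite [`|2^-1|]gtr0_norm ?invr_gt0// ler_pM2r ?invr_gt0//.
  by rewrite (le_trans (ler_normD _ _))// lerD.
Qed.

Lemma levy_test_off_time f z : (forall x, f (x, z.2) = 0) -> levy_test f z = 0.
Proof.
move=> f0; rewrite levy_testE /Rintegral integral0_eq// => y _.
by case: z f0 => x t /= f0; rewrite /kernel /= !f0 addr0 mul0r subr0.
Qed.

(** Test functions are differentiated as functions on space-time, whereas the
    equation differentiates them along a line. *)
Lemma derive1_timeE f (x : V) (t : R) :
  derive1 (fun s => f (x, s)) t = 'D_((0, 1) : VT) f (x, t).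
Proof.
have E : (fun h : R => h^-1 *: (f (x, h *: 1 + t) - f (x, t))) =
    (fun h : R => h^-1 *: (f (h *: ((0, 1) : VT) + (x, t)) - f (x, t))).
  apply/funext => h; congr (_ *: (f _ - _)).
  by rewrite [RHS]surjective_pairing /= scaler0 add0r.
by rewrite derive1E /derive /= E.
Qed.

End LevyTest.

(** * Test functions and integrals over space-time *)

Section Cylinder.
Context {R : realType} {d : nat}.
Local Notation V := 'rV[R]_d.
Local Notation VT := ('rV[R]_d * R)%type.
Local Notation lam := (lebesgue_rV R d).
Local Notation lamT := (lebesgue_rV R d \x lebesgue_measure)%E.

Lemma open_cylinder (T : R) : open (@cylinder R d T).
Proof.
have -> : @cylinder R d T = snd @^-1` `]0, T[%classic.
  by apply/seteqP; split=> -[x t]; rewrite /cylinder /= in_itv.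
by apply: open_comp; [move=> z _; exact: cvg_snd|exact: interval_open].
Qed.

Lemma measurable_cylinder (T : R) : measurable (@cylinder R d T).
Proof. by apply: open_measurable_prod; exact: open_cylinder. Qed.

Lemma integral_translate_prod (a : V) (f : VT -> \bar R) :
  measurable_fun setT f ->
  (\int[lamT]_z f ((z.1 + a)%R, z.2) = \int[lamT]_z f z)%E.
Proof.
move=> mf; rewrite integralE [RHS]integralE; congr (_ - _)%E.
  rewrite -(@ge0_integral_translate_prod R d a f^\+%E)//.
    by apply: eq_integral => x _; rewrite !funeposE.
  exact: measurable_funepos.
rewrite -(@ge0_integral_translate_prod R d a f^\-%E)//.
  by apply: eq_integral => x _; rewrite !funenegE.
exact: measurable_funeneg.
Qed.

Lemma measurable_shift_prod (a : V) :
  measurable_fun setT (fun z : VT => (z.1 + a, z.2)).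
Proof.
apply: measurable_fun_pair; last exact: measurable_snd.
by apply: (measurableT_comp (@measurable_shift R d a)); exact: measurable_fst.
Qed.

Variable T : R.
Variable w : VT -> R.
Hypothesis mw : measurable_fun setT w.
Hypothesis w_off : vanishes_off (@cylinder R d T) w.

Let iter_setT : (\int[lebesgue_measure]_(t in `]0%R, T[) \int[lam]_x (w (x, t))%:E =
  \int[lebesgue_measure]_t \int[lam]_x (w (x, t))%:E)%E.
Proof.
rewrite integral_mkcond; apply: eq_integral => t _; rewrite patchE.
case: ifPn => // /negP nt; rewrite integral0_eq// => x _; rewrite w_off//.
by move=> Tt; apply: nt; rewrite inE /= in_itv.
Qed.

(** The iterated integrals in the definition of solutions become integrals
    over the whole product space, where Fubini applies without restriction to
    a time interval. *)
Lemma ge0_iterated_cylinder : (forall z, 0 <= w z) ->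
  (\int[lebesgue_measure]_(t in `]0%R, T[) \int[lam]_x (w (x, t))%:E =
   \int[lamT]_z (w z)%:E)%E.
Proof.
move=> w0; rewrite iter_setT fubini_tonelli2//; exact/measurable_EFinP.
Qed.

Lemma iterated_cylinder : lamT.-integrable setT (EFin \o w) ->
  (\int[lebesgue_measure]_(t in `]0%R, T[) \int[lam]_x (w (x, t))%:E =
   \int[lamT]_z (w z)%:E)%E.
Proof. by move=> iw; rewrite iter_setT -(integral21_prod_meas1 iw). Qed.

End Cylinder.

Section TestFunctions.
Context {R : realType} {d : nat}.
Variable nu : {measure set 'rV[R]_d -> \bar R}.
Hypothesis nu_levy : symmetric_levy_measure nu.
Local Notation V := 'rV[R]_d.
Local Notation VT := ('rV[R]_d * R)%type.
Implicit Types (theta : VT -> R).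

Definition time_derive theta (z : VT) : R := 'D_((0, 1) : VT) theta z.

Lemma supp_vanishes theta : vanishes_off (supp theta) theta.
Proof.
move=> z nz; apply: contrapT => /eqP h; apply: nz.
by apply: subset_closure.
Qed.

(** The support is a compact subset of the open cylinder, hence its times
    stay away from 0. *)
Lemma test_function_slab T theta : test_function T theta ->
  exists r e tau : R, [/\ 0 <= r, 0 < e, 0 <= tau & supp theta `<=` slab r e tau].
Proof.
move=> [_ cK KT]; set K := supp theta in cK KT *.
have [M [_ hM]] := compact_bounded cK.
pose r := Num.max 0 (M + 1).
have r0 : 0 <= r by rewrite le_max lexx.
have hr z : K z -> `|z| <= r.
  move=> Kz; rewrite le_max; apply/orP; right; apply: (hM (M + 1)) => //.
  by rewrite ltrDl.
have [[z0 Kz0]|nK] := pselect (K !=set0); last first.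
  exists 0, 1, 0; split => // z Kz; exfalso; apply: nK; by exists z.
have [|c Kc hc] := compact_EVT_min (f := snd) (ex_intro _ z0 Kz0) cK.
  by apply: continuous_subspaceT => z; exact: cvg_snd.
exists r, c.2, r; split => //.
  by have /andP[] := KT c (set_mem Kc).
move=> z Kz; have := hr z Kz.
rewrite prod_normE ge_max => /andP[z1 z2]; split=> //.
by rewrite hc ?inE//= (le_trans (ler_norm _) z2).
Qed.

Lemma test_function_intro T theta r e tau : smooth theta -> 0 < e -> tau < T ->
  vanishes_off (slab r e tau) theta -> test_function T theta.
Proof.
move=> sth e0 tT th.
have sub : supp theta `<=` slab r e tau.
  rewrite (iffLR (closure_id _) (@closed_slab R d r e tau)).
  by apply: closure_subset => z /= /eqP; apply: contra_notP; exact: th.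
split=> //.
  apply: (@subclosed_compact _ _ (slab r e tau)) => //; last exact: compact_slab.
  exact: closed_closure.
by move=> z /sub[_ /andP[h1 h2]]; rewrite /cylinder /=; lra.
Qed.

Lemma smooth_shift theta (a : V) : smooth theta ->
  smooth (fun z => theta (z.1 + a, z.2)).
Proof.
move=> sth k; move: (sth k); rewrite /smooth; elim: k theta {sth} => [|k IH] theta /=.
  move=> cth z; apply: (continuous_comp (f := fun z : VT => (z.1 + a, z.2)) (g := theta)); last exact: cth.
  have h1 : z'.1 + a @[z' --> z] --> z.1 + a.
    by apply: cvgD; [exact: cvg_fst|exact: cvg_cst].
  have h2 : z'.2 @[z' --> z] --> z.2 by exact: cvg_snd.
  exact: (cvg_pair h1 h2).
have E : (fun z : VT => theta (z.1 + a, z.2)) = (fun z => theta (z + (a, 0))).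
  apply/funext => z; congr theta; rewrite [RHS]surjective_pairing /=.
  by rewrite addr0.
move=> [cth dth hth]; split.
- move=> z; apply: (continuous_comp (f := fun z : VT => (z.1 + a, z.2)) (g := theta)); last exact: cth.
  have h1 : z'.1 + a @[z' --> z] --> z.1 + a.
    by apply: cvgD; [exact: cvg_fst|exact: cvg_cst].
  have h2 : z'.2 @[z' --> z] --> z.2 by exact: cvg_snd.
  exact: (cvg_pair h1 h2).
- by move=> v z; rewrite E; have [] := derivable_shift (dth v (z + (a, 0))).
- move=> v; have := IH _ (hth v); congr class_C; apply/funext => z; rewrite E.
  have [_ ->] := derivable_shift (dth v (z + (a, 0))).
  congr ('D_v theta _); rewrite [RHS]surjective_pairing /=.
  by rewrite addr0.
Qed.

Lemma time_derive_shift theta (a : V) z : smooth theta ->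
  time_derive (fun z => theta (z.1 + a, z.2)) z = time_derive theta (z.1 + a, z.2).
Proof.
move=> sth; rewrite /time_derive.
have E : (fun z : VT => theta (z.1 + a, z.2)) = (fun z => theta (z + (a, 0))).
  apply/funext => z'; congr theta; rewrite [RHS]surjective_pairing /=.
  by rewrite addr0.
have dth : derivable theta (z + (a, 0)) ((0, 1) : VT) by exact: smooth_derivable.
have [_] := derivable_shift dth.
rewrite E => ->; congr ('D_((0, 1) : VT) theta _); rewrite [LHS]surjective_pairing /=.
by rewrite addr0.
Qed.

Lemma levy_test_shift theta (a : V) z :
  levy_test nu (fun z => theta (z.1 + a, z.2)) z = levy_test nu theta (z.1 + a, z.2).
Proof.
rewrite /levy_test /levy_op; apply: eq_Rintegral => y _ /=.
by congr (_ - (theta (_, _) + theta (_, _)) / 2); rewrite addrAC.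
Qed.

Section Regularity.
Variables (T : R) (theta : VT -> R).
Hypothesis ttheta : test_function T theta.

Let sth : smooth theta. Proof. by have [] := ttheta. Qed.
Let cK : compact (supp theta). Proof. by have [] := ttheta. Qed.
Let clK : closed (supp theta). Proof. exact: closed_closure. Qed.

Lemma measurable_levy_test : measurable_fun setT (levy_test nu theta).
Proof.
apply: continuous_measurable_prod; first exact: openT.
apply: continuous_subspaceT.
exact: (levy_test_continuous nu_levy sth cK clK (@supp_vanishes theta)).
Qed.

Lemma measurable_time_derive : measurable_fun setT (time_derive theta).
Proof.
apply: continuous_measurable_prod; first exact: openT.
apply: continuous_subspaceT.
exact: (smooth_continuous (smooth_derive ((0, 1) : VT) sth)).
Qed.

Lemma time_derive_off : vanishes_off (@cylinder R d T) (time_derive theta).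
Proof.
move=> z nz; apply: (vanishes_off_derive ((0, 1) : VT) clK (@supp_vanishes theta)).
by have [_ _ h] := ttheta; move=> /h.
Qed.

Lemma levy_test_off : vanishes_off (@cylinder R d T) (levy_test nu theta).
Proof.
move=> z nz; apply: levy_test_off_time => x.
by apply: supp_vanishes; have [_ _ h] := ttheta; move=> /h.
Qed.

End Regularity.

End TestFunctions.

(** * The weak equation for the heat kernel *)

Section HeatKernelWeak.
Context {R : realType} {d : nat}.
Variables (nu : {measure set 'rV[R]_d -> \bar R}) (P : 'rV[R]_d * R -> R).
Hypothesis nu_levy : symmetric_levy_measure nu.
Hypothesis HP : regular_heat_kernel nu P.
Hypothesis P_vws : forall T : R, 0 < T -> very_weak_solution nu T P.

Local Notation V := 'rV[R]_d.
Local Notation VT := ('rV[R]_d * R)%type.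
Local Notation lam := (lebesgue_rV R d).
Local Notation lamT := (lebesgue_rV R d \x lebesgue_measure)%E.
Local Notation L := (levy_test nu).
Local Notation cyl := (@cylinder R d).

(** Local integrability, which is part of being a solution, gives joint
    measurability of the kernel for positive times. *)
Lemma measurable_heat_cylinder (T : R) : 0 < T -> measurable_fun setT (P \_ (cyl T)).
Proof.
move=> T0; apply: (iffLR (measurable_restrictT _ _)).
  exact: measurable_cylinder.
by have [[]] := P_vws T0.
Qed.

Lemma heat_mulE (T : R) (h : VT -> R) (y : V) (z : VT) : vanishes_off (cyl T) h ->
  P (z.1 - y, z.2) * h z = (P \_ (cyl T)) (z.1 - y, z.2) * h z.
Proof.
move=> hT; rewrite patchE; case: ifPn => // /negP nz.
by rewrite hT ?mulr0// => zT; apply: nz; rewrite inE.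
Qed.

Lemma measurable_heat_mul (T : R) (h : VT -> R) (y : V) : 0 < T ->
  measurable_fun setT h -> vanishes_off (cyl T) h ->
  measurable_fun setT (fun z : VT => P (z.1 - y, z.2) * h z).
Proof.
move=> T0 mh hT; under eq_fun do rewrite (heat_mulE _ _ hT).
apply: measurable_funM => //.
apply: (@measurableT_comp _ _ _ _ _ _ (P \_ (cyl T)) _ (fun z : VT => (z.1 - y, z.2))).
  exact: measurable_heat_cylinder.
exact: measurable_shift_prod.
Qed.

Lemma heat_mul_le (T : R) (h1 h2 : VT -> R) (y : V) (z : VT) : vanishes_off (cyl T) h1 ->
  vanishes_off (cyl T) h2 -> h1 z <= h2 z ->
  P (z.1 - y, z.2) * h1 z <= P (z.1 - y, z.2) * h2 z.
Proof.
move=> h1T h2T h12; have [zT|nzT] := pselect (cyl T z); last first.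
  by rewrite h1T// h2T.
rewrite ler_wpM2l// (heat_ge0 HP)//.
by case/andP: zT.
Qed.

Lemma heat_mul_ge0 (T : R) (h : VT -> R) (y : V) (z : VT) : vanishes_off (cyl T) h ->
  (forall z, 0 <= h z) -> 0 <= P (z.1 - y, z.2) * h z.
Proof.
move=> hT h0; have := @heat_mul_le T (fun=> 0) h y z (fun _ _ => erefl) hT (h0 z).
by rewrite mulr0.
Qed.

Lemma vanishes_off_sub (K K' : set VT) (h : VT -> R) : K `<=` K' ->
  vanishes_off K h -> vanishes_off K' h.
Proof. by move=> KK hK z nz; apply: hK => /KK. Qed.

Lemma indic_vanishes_off (K : set VT) : vanishes_off K (\1_K : VT -> R).
Proof. by move=> z nz; rewrite indicE memNset. Qed.

Lemma slab_cylinder (r e tau T : R) : 0 < e -> tau < T -> slab r e tau `<=` cyl T.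
Proof. by move=> e0 tT z [_ /andP[h1 h2]]; rewrite /cylinder /=; lra. Qed.

(** On a slab the kernel is at most [C P_1(y)], and the slab has finite
    measure. *)
Lemma heat_slab_le (r e tau : R) : 0 < e -> exists2 C : R, 0 <= C & forall y : V,
  (\int[lamT]_z (P (z.1 - y, z.2) * \1_(slab r e tau) z)%:E <= (C * P (y, 1))%:E)%E.
Proof.
move=> e0; have [C C0 hC] := heat_shift_le HP tau r e0.
pose S := slab r e tau : set VT.
have mS : measurable S by exact: measurable_slab.
have Soo : (lamT S < +oo)%E by exact: slab_measure_lty.
have SE : lamT S = (fine (lamT S))%:E by rewrite fineK// ge0_fin_numE.
have T0 : 0 < Num.max tau 0 + 1 by rewrite ltr_wpDl// le_max lexx orbT.
have ST : S `<=` cyl (Num.max tau 0 + 1).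
  by apply: slab_cylinder => //; rewrite ltr_pwDr// le_max lexx.
have S_off := vanishes_off_sub ST (@indic_vanishes_off S).
exists (C * fine (lamT S)) => [|y]; first by rewrite mulr_ge0 ?fine_ge0// ltW.
apply: (@le_trans _ _ (\int[lamT]_z ((C * P (y, 1))%:E * (\1_S z)%:E))%E).
  apply: ge0_le_integral => //.
  - by move=> z _; rewrite lee_fin; apply: heat_mul_ge0 => // z'; exact: S_off.
  - by apply/measurable_EFinP; exact: (measurable_heat_mul _ T0 _ S_off).
  - by apply: emeasurable_funM => //; exact/measurable_EFinP.
  - move=> z _; rewrite -EFinM lee_fin indicE.
    case: (boolP (z \in S)) => [/set_mem[z1 z2]|_]; rewrite ?mulr0//= !mulr1.
    exact: hC.
have P0 : 0 <= P (y, 1) by exact: (heat_ge0 HP).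
rewrite ge0_integralZl//; last 2 first.
- exact/measurable_EFinP.
- by rewrite lee_fin mulr_ge0// ltW.
by rewrite integral_indic// setIT [X in (_ * X <= _)%E]SE -EFinM mulrAC.
Qed.

Lemma ge0_heat_mul_le (h : VT -> R) (r e tau : R) : 0 < e ->
  measurable_fun setT h -> (exists M : R, forall z, `|h z| <= M) ->
  vanishes_off (slab r e tau) h ->
  exists2 C : R, 0 <= C & forall y : V,
    (\int[lamT]_z (P (z.1 - y, z.2) * `|h z|)%:E <= (C * P (y, 1))%:E)%E.
Proof.
move=> e0 mh [M hM] hS.
have M0 : 0 <= M by rewrite (le_trans _ (hM 0)).
have [C C0 hC] := heat_slab_le r tau e0.
have T0 : 0 < Num.max tau 0 + 1 by rewrite ltr_wpDl// le_max lexx orbT.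
have ST : slab r e tau `<=` cyl (Num.max tau 0 + 1).
  by apply: slab_cylinder => //; rewrite ltr_pwDr// le_max lexx.
have h_off : vanishes_off (cyl (Num.max tau 0 + 1)) (fun z => `|h z|).
  by move=> z nz; rewrite (vanishes_off_sub ST hS)// normr0.
have mS := @measurable_slab R d r e tau.
have S_off : vanishes_off (cyl (Num.max tau 0 + 1)) (\1_(slab r e tau) : VT -> R).
  exact: (vanishes_off_sub ST (@indic_vanishes_off _)).
have MS_off : vanishes_off (cyl (Num.max tau 0 + 1))
    (fun z => M * \1_(slab r e tau) z).
  by move=> z nz; rewrite S_off// mulr0.
have mPS (y : V) : measurable_fun setT
    (fun z : VT => P (z.1 - y, z.2) * \1_(slab r e tau) z).
  by apply: (measurable_heat_mul _ T0 _ S_off).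
exists (M * C) => [|y]; first exact: mulr_ge0.
apply: (@le_trans _ _ (\int[lamT]_z (M%:E * (P (z.1 - y, z.2) * \1_(slab r e tau) z)%:E)))%E.
  apply: ge0_le_integral => //.
  - by move=> z _; rewrite lee_fin; apply: (heat_mul_ge0 _ _ h_off).
  - apply/measurable_EFinP; apply: (measurable_heat_mul _ T0 _ h_off).
    exact: measurableT_comp.
  - by apply: emeasurable_funM => //; apply/measurable_EFinP; exact: mPS.
  - move=> z _; rewrite -EFinM lee_fin mulrCA; apply: (heat_mul_le _ h_off MS_off).
    rewrite indicE; case: (boolP (z \in _)) => [_|]; first by rewrite mulr1.
    by rewrite notin_setE => nz; rewrite mulr0 hS// normr0.
rewrite ge0_integralZl//.
- by rewrite -mulrA EFinM lee_wpmul2l.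
- by apply/measurable_EFinP; exact: mPS.
- by move=> z _; rewrite lee_fin; apply: (heat_mul_ge0 _ _ S_off).
Qed.

Lemma integrable_heat_mul (h : VT -> R) (r e tau : R) (y : V) : 0 < e ->
  measurable_fun setT h -> (exists M : R, forall z, `|h z| <= M) ->
  vanishes_off (slab r e tau) h ->
  lamT.-integrable setT (fun z : VT => (P (z.1 - y, z.2) * h z)%:E).
Proof.
move=> e0 mh hM hS; have [C C0 hC] := ge0_heat_mul_le e0 mh hM hS.
have T0 : 0 < Num.max tau 0 + 1 by rewrite ltr_wpDl// le_max lexx orbT.
have ST : slab r e tau `<=` cyl (Num.max tau 0 + 1).
  by apply: slab_cylinder => //; rewrite ltr_pwDr// le_max lexx.
have h_off := vanishes_off_sub ST hS.
apply/integrableP; split.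
  by apply/measurable_EFinP; exact: (measurable_heat_mul _ T0 mh h_off).
apply: le_lt_trans (le_lt_trans (hC y) (ltry _)).
rewrite le_eqVlt; apply/orP; left; apply/eqP; apply: eq_integral => z _.
have n_off : vanishes_off (cyl (Num.max tau 0 + 1)) (fun z => `|h z|).
  by move=> z' nz; rewrite h_off// normr0.
rewrite /= normrM; congr EFin.
have [zT|nzT] := pselect (cyl (Num.max tau 0 + 1) z); last first.
  by rewrite h_off// normr0 !mulr0.
rewrite [`|P _|]ger0_norm// (heat_ge0 HP)//.
by case/andP: zT.
Qed.

Lemma heat_weak T theta : 0 < T -> test_function T theta ->
  [/\ lamT.-integrable setT (fun z : VT => (P z * L theta z)%:E),
      lamT.-integrable setT (fun z : VT => (P z * time_derive theta z)%:E) &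
      \int[lamT]_z (P z * (time_derive theta z - L theta z))%:E = 0]%E.
Proof.
move=> T0 tth; have [_ /(_ theta tth)[fin0 eq0]] := P_vws T0.
have mL := measurable_levy_test nu_levy tth.
have mD := measurable_time_derive tth.
have oL := levy_test_off nu tth.
have oD := time_derive_off tth.
have subr0z (z : VT) : (z.1 - 0, z.2) = z by rewrite subr0 -surjective_pairing.
have mPh h : measurable_fun setT h -> vanishes_off (cyl T) h ->
    measurable_fun setT (fun z : VT => P z * h z).
  move=> mh hT; have := measurable_heat_mul 0 T0 mh hT.
  by under eq_fun do rewrite subr0z.
have iL : lamT.-integrable setT (fun z : VT => (P z * L theta z)%:E).
  apply/integrableP; split; first by apply/measurable_EFinP; exact: mPh.
  rewrite [X in (X < _)%E](_ : _ = \int[lamT]_z (`|P z * L theta z|)%:E)%E//.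
  rewrite -(ge0_iterated_cylinder (T := T))//.
  - apply: le_lt_trans fin0; rewrite le_eqVlt; apply/orP; left; apply/eqP.
    apply: eq_integral => t _; apply: eq_integral => x _.
    by rewrite normrM.
  - by apply: measurableT_comp => //; exact: mPh.
  - by move=> z nz; rewrite oL// mulr0 normr0.
have iD : lamT.-integrable setT (fun z : VT => (P z * time_derive theta z)%:E).
  have [r [e [tau [r0 e0 tau0 sub]]]] := test_function_slab tth.
  have [sth cK sT] := tth.
  suff : lamT.-integrable setT
      (fun z : VT => (P (z.1 - 0, z.2) * time_derive theta z)%:E).
    by under eq_fun do rewrite subr0z.
  have hD : vanishes_off (supp theta) (time_derive theta).
    move=> z nz; apply: (vanishes_off_derive ((0, 1) : VT) _ (@supp_vanishes _ _ theta)) => //.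
    exact: closed_closure.
  apply: (integrable_heat_mul (r := r) (e := e) (tau := tau)) => //.
    have [M _ hM] := vanishes_off_bounded cK (smooth_continuous
      (smooth_derive ((0, 1) : VT) sth)) hD.
    by exists M.
  exact: (vanishes_off_sub sub).
split => //; rewrite -[RHS]eq0.
rewrite -(iterated_cylinder (T := T)).
- apply: eq_integral => t _; apply: eq_integral => x _.
  by rewrite derive1_timeE.
- by move=> z nz; rewrite oD// oL// subr0 mulr0.
- have := integrableB measurableT iD iL; apply: eq_integrable => // z _.
  by rewrite /= mulrBr EFinB.
Qed.

End HeatKernelWeak.

(** * The integral bound for the operator *)

Section TestFunctionBound.
Context {R : realType} {d : nat}.
Variables (nu : {measure set 'rV[R]_d -> \bar R}) (P : 'rV[R]_d * R -> R).
Hypothesis nu_levy : symmetric_levy_measure nu.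
Hypothesis HP : regular_heat_kernel nu P.
Hypothesis P_vws : forall T : R, 0 < T -> very_weak_solution nu T P.

Local Notation V := 'rV[R]_d.
Local Notation VT := ('rV[R]_d * R)%type.
Local Notation lam := (lebesgue_rV R d).
Local Notation lamT := (lebesgue_rV R d \x lebesgue_measure)%E.
Local Notation L := (levy_test nu).
Local Notation cyl := (@cylinder R d).

Lemma integrable_translate_prod (a : V) (f : VT -> \bar R) :
  measurable_fun setT f ->
  lamT.-integrable setT (fun z : VT => f (z.1 + a, z.2)) ->
  lamT.-integrable setT f.
Proof.
move=> mf /integrableP[_ fin]; apply/integrableP; split=> //.
rewrite -(ge0_integral_translate_prod a)//.
by apply: measurableT_comp.
Qed.

Lemma test_function_shift (T : R) (theta : VT -> R) (a : V) :
  test_function T theta -> test_function T (fun z => theta (z.1 + a, z.2)).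
Proof.
move=> [sth cK sT].
pose sh (z : VT) : VT := (z.1 - a, z.2).
have csh : continuous sh.
  move=> z; have h1 : z'.1 - a @[z' --> z] --> z.1 - a.
    by apply: cvgB; [exact: cvg_fst|exact: cvg_cst].
  have h2 : z'.2 @[z' --> z] --> z.2 by exact: cvg_snd.
  exact: (cvg_pair h1 h2).
have cK' : compact (sh @` supp theta).
  by apply: continuous_compact => //; exact: continuous_subspaceT.
have clK' : closed (sh @` supp theta).
  by apply: compact_closed => //; exact: norm_hausdorff.
have sub : supp (fun z : VT => theta (z.1 + a, z.2)) `<=` sh @` supp theta.
  rewrite (iffLR (closure_id _) clK'); apply: closure_subset => z /= nz.
  exists (z.1 + a, z.2); first exact: subset_closure.
  by rewrite /sh /= addrK -surjective_pairing.
split.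
- exact: smooth_shift.
- apply: (@subclosed_compact _ _ (sh @` supp theta)) => //; exact: closed_closure.
- by move=> z /sub[z' /sT zT <-].
Qed.

(** Translating the test function instead of the kernel, since the operator
    commutes with translations. *)
Lemma heat_weak_shift (T : R) (theta : VT -> R) (y : V) : 0 < T ->
  test_function T theta ->
  [/\ lamT.-integrable setT (fun z : VT => (P (z.1 - y, z.2)%R * L theta z)%:E),
      lamT.-integrable setT (fun z : VT => (P (z.1 - y, z.2)%R * time_derive theta z)%:E) &
      \int[lamT]_z (P (z.1 - y, z.2)%R * (time_derive theta z - L theta z))%:E = 0]%E.
Proof.
move=> T0 tth; have tsh := test_function_shift y tth.
have [iL iD eq0] := heat_weak nu_levy HP P_vws T0 tsh.
have sth : smooth theta by have [] := tth.
have mL := measurable_levy_test nu_levy tth.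
have mD := measurable_time_derive tth.
have oL := levy_test_off nu tth.
have oD := time_derive_off tth.
have addrKz (z : VT) : ((z.1 + y - y, z.2) : VT) = z.
  by rewrite addrK -surjective_pairing.
have mPL := measurable_heat_mul P_vws y T0 mL oL.
have mPD := measurable_heat_mul P_vws y T0 mD oD.
have mLD : measurable_fun setT (fun z : VT => time_derive theta z - L theta z).
  exact: measurable_funB.
have oLD : vanishes_off (cyl T) (fun z : VT => time_derive theta z - L theta z).
  by move=> z nz; rewrite oD// oL// subr0.
have mPLD := measurable_heat_mul P_vws y T0 mLD oLD.
split.
- apply: (integrable_translate_prod (a := y)); first exact/measurable_EFinP.
  apply: eq_integrable iL => // z _.
  by rewrite /= levy_test_shift addrKz.
- apply: (integrable_translate_prod (a := y)); first exact/measurable_EFinP.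
  apply: eq_integrable iD => // z _.
  by rewrite /= time_derive_shift// addrKz.
- rewrite -(integral_translate_prod y); last exact/measurable_EFinP.
  rewrite -[RHS]eq0; apply: eq_integral => z _.
  by rewrite /= levy_test_shift time_derive_shift// addrKz.
Qed.

Lemma heat_time_derive_le (T : R) (theta : VT -> R) : test_function T theta ->
  exists2 C : R, 0 <= C & forall y : V,
    (\int[lamT]_z (P (z.1 - y, z.2) * `|time_derive theta z|)%:E <= (C * P (y, 1))%:E)%E.
Proof.
move=> tth; have [r [e [tau [r0 e0 tau0 sub]]]] := test_function_slab tth.
have [sth cK sT] := tth.
have hD : vanishes_off (supp theta) (time_derive theta).
  move=> z nz; apply: (vanishes_off_derive ((0, 1) : VT) _ (@supp_vanishes _ _ theta)) => //.
  exact: closed_closure.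
apply: (ge0_heat_mul_le HP P_vws (r := r) (e := e) (tau := tau)) => //.
- exact: measurable_time_derive tth.
- have [M _ hM] := vanishes_off_bounded cK (smooth_continuous
    (smooth_derive ((0, 1) : VT) sth)) hD.
  by exists M.
- exact: (vanishes_off_sub sub).
Qed.

(** [L theta] is not compactly supported, but away from a compact set it is
    dominated by [- L eta] for a test function [eta >= |theta|], and the equation
    satisfied by the heat kernel converts [- L eta] into [- d_t eta], which is
    compactly supported. *)
Lemma heat_levy_test_le (T : R) (theta : VT -> R) : test_function T theta ->
  exists2 C : R, 0 <= C & forall y : V,
    (\int[lamT]_z (P (z.1 - y, z.2) * `|L theta z|)%:E <= (C * P (y, 1))%:E)%E.
Proof.
move=> tth; have [r [e [tau [r0 e0 tau0 sub]]]] := test_function_slab tth.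
have [sth cK sT] := tth.
have [M0 M00 hM0] := vanishes_off_bounded cK (smooth_continuous sth) (@supp_vanishes _ _ theta).
have e20 : 0 < e / 2 by rewrite divr_gt0.
have ee : e / 2 < e by lra.
have [c c0 hc] := @bump_lower R d r (e / 2) tau e ee.
(* A bump on a slightly larger slab, scaled to dominate [theta]. *)
pose eta (z : VT) := M0 / c * boxbump (r + 1) (e / 2) (tau + 1) z.
pose K := slab (r + 1) (e / 2) (tau + 1) : set VT.
have cpK : compact K by exact: compact_slab.
have clK : closed K by exact: closed_slab.
have mK : measurable K by exact: measurable_slab.
have r10 : 0 <= r + 1 by lra.
have seta : smooth eta.
  by move=> k; apply: class_CM; [exact: class_C_cst|exact: smooth_bump].
have etaK : vanishes_off K eta.
  by move=> z nz; rewrite /eta bump_out// mulr0.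
have subK : slab r e tau `<=` K.
  by move=> z [z1 /andP[z2 z3]]; split; lra.
have thK : vanishes_off K theta.
  by apply: vanishes_off_sub (@supp_vanishes _ _ theta) => z /sub/subK.
have th_eta z : `|theta z| <= eta z.
  have [Kz|nKz] := pselect (slab r e tau z); last first.
    rewrite (vanishes_off_sub sub (@supp_vanishes _ _ theta))// normr0.
    by rewrite mulr_ge0 ?bump_ge0// divr_ge0// ltW.
  rewrite (le_trans (hM0 z))// /eta mulrAC -mulrA ler_peMr//.
  by rewrite ler_pdivlMr// mul1r hc.
pose T' := tau + 2.
have T'0 : 0 < T' by rewrite /T'; lra.
have tT' : tau + 1 < T' by rewrite /T'; lra.
have teta : test_function T' eta by exact: (test_function_intro seta e20 tT' etaK).
have tth' : test_function T' theta by exact: (test_function_intro sth e20 tT' thK).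
have [C1 C10 hC1] := levy_test_bounded nu_levy seta cpK clK etaK.
have [C2 C20 hC2] := levy_test_bounded nu_levy sth cpK clK thK.
have cmp := levy_test_comparison nu_levy sth seta cpK clK thK etaK th_eta.
have KT : K `<=` cyl T' by exact: slab_cylinder.
have iK_off := vanishes_off_sub KT (@indic_vanishes_off _ _ K).
have oLeta := levy_test_off nu teta.
have oDeta := time_derive_off teta.
have oLth := levy_test_off nu tth'.
have mLeta := measurable_levy_test nu_levy teta.
have mDeta := measurable_time_derive teta.
have mLth := measurable_levy_test nu_levy tth'.
have D_off : vanishes_off K (time_derive eta).
  by move=> z nz; apply: (vanishes_off_derive ((0, 1) : VT) clK etaK).
have [C3 C30 hC3] := vanishes_off_bounded cpK (smooth_continuous
    (smooth_derive ((0, 1) : VT) seta)) D_off.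
(* [F] dominates [|L theta|]; [G] has the same integral against the kernel and is
   supported in [K]. *)
pose F (z : VT) := (C1 + C2) * \1_K z - L eta z.
pose G (z : VT) := (C1 + C2) * \1_K z - time_derive eta z.
have mK1 : measurable_fun setT (fun z : VT => (C1 + C2) * \1_K z).
  exact: measurable_funM.
have mF : measurable_fun setT F by exact: measurable_funB.
have mG : measurable_fun setT G by exact: measurable_funB.
have F_off : vanishes_off (cyl T') F.
  by move=> z nz; rewrite /F iK_off// oLeta// mulr0 subr0.
have G_off : vanishes_off K G.
  by move=> z nz; rewrite /G indic_vanishes_off// D_off// mulr0 subr0.
have G_bnd : exists M : R, forall z, `|G z| <= M.
  exists (C1 + C2 + C3) => z; rewrite (le_trans (ler_normB _ _))// lerD// ?hC3//.
  rewrite normrM ger0_norm ?addr_ge0// ler_piMr ?addr_ge0//.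
  by rewrite indicE; case: (_ \in _); rewrite ?normr1 ?normr0.
have [C C0 hC] := ge0_heat_mul_le HP P_vws e20 mG G_bnd G_off.
exists C => // y; apply: le_trans (hC y).
have F_ge z : `|L theta z| <= F z.
  rewrite /F indicE; have [Kz|nKz] := pselect (K z).
    rewrite mem_set// mulr1; have := hC1 z; have := hC2 z; rewrite !ler_norml; lra.
  by rewrite memNset// mulr0 sub0r cmp.
have nL_off : vanishes_off (cyl T') (fun z => `|L theta z|).
  by move=> z nz; rewrite oLth// normr0.
have GT_off := vanishes_off_sub KT G_off.
have nG_off : vanishes_off (cyl T') (fun z => `|G z|).
  by move=> z nz; rewrite GT_off// normr0.
have [iL iD eq0] := heat_weak_shift y T'0 teta.
have iG : lamT.-integrable setT (fun z : VT => (P (z.1 - y, z.2) * G z)%:E).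
  exact: (integrable_heat_mul HP P_vws y e20 mG G_bnd G_off).
have iZ : lamT.-integrable setT (fun z : VT =>
    (P (z.1 - y, z.2) * (time_derive eta z - L eta z))%:E).
  have := integrableB measurableT iD iL; apply: eq_integrable => // z _.
  by rewrite /= mulrBr EFinB.
apply: (@le_trans _ _ (\int[lamT]_z (P (z.1 - y, z.2) * F z)%:E)%E).
  apply: ge0_le_integral => //.
  - by move=> z _; rewrite lee_fin; apply: (heat_mul_ge0 HP _ _ nL_off).
  - apply/measurable_EFinP; apply: (measurable_heat_mul P_vws _ T'0 _ nL_off).
    exact: measurableT_comp.
  - by apply/measurable_EFinP; exact: (measurable_heat_mul P_vws _ T'0 mF F_off).
  - by move=> z _; rewrite lee_fin; apply: (heat_mul_le HP _ nL_off F_off).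
have -> : (\int[lamT]_z (P (z.1 - y, z.2) * F z)%:E =
    \int[lamT]_z (P (z.1 - y, z.2) * G z)%:E)%E.
  rewrite -[RHS]adde0 -eq0 -integralD_EFin//.
  by apply: eq_integral => z _; rewrite /F /G -EFinD; congr EFin; ring.
apply: le_integral => //.
- apply: eq_integrable (integrable_abse iG) => // z _ /=.
  rewrite normrM; have [zT|nzT] := pselect (cyl T' z); last first.
    by rewrite GT_off// normr0 !mulr0.
  by rewrite [`|P _|]ger0_norm// (heat_ge0 HP)//; case/andP: zT.
- move=> z _; rewrite lee_fin; apply: (heat_mul_le HP _ GT_off nG_off).
  exact: ler_norm.
Qed.

End TestFunctionBound.

(** * Potentials of positive measures *)

Section SpaceTime.
Context {R : realType} {d : nat}.
Local Notation VT := ('rV[R]_d * measurableTypeR R)%type.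

Definition space_time : {measure set VT -> \bar R} :=
  [the measure _ _ of (lebesgue_rV R d \x lebesgue_measure)%E].

Lemma space_time_sigma_finite : sigma_finite setT space_time.
Proof.
exists (fun n => slab n%:R (- n%:R) n%:R).
  apply/esym/seteqP; split=> // z _; exists (truncn `|z|).+1 => //.
  have := truncnS_gt `|z|; rewrite prod_normE gt_max => /andP[z1 z2].
  by split; [exact: ltW|rewrite -ler_norml ltW].
by move=> n; split; [exact: measurable_slab|exact: slab_measure_lty].
Qed.

(** Products with a further measure require the sigma-finite structure. *)
Definition space_time_sf : {sigma_finite_measure set VT -> \bar R} :=
  HB.pack_for {sigma_finite_measure set VT -> \bar R} (Measure.sort space_time)
    (Measure_isSigmaFinite.Build _ _ _ space_time space_time_sigma_finite).

End SpaceTime.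

Section Potential.
Context {R : realType} {d : nat}.
Variables (nu : {measure set 'rV[R]_d -> \bar R}) (P : 'rV[R]_d * R -> R).
Hypothesis nu_levy : symmetric_levy_measure nu.
Hypothesis HP : regular_heat_kernel nu P.
Hypothesis P_vws : forall T : R, 0 < T -> very_weak_solution nu T P.
Variable mu : {sigma_finite_measure set 'rV[R]_d -> \bar R}.
Hypothesis mu_P1 : (\int[mu]_y (P (y, 1%R))%:E < +oo)%E.

Local Notation V := 'rV[R]_d.
Local Notation VT := ('rV[R]_d * R)%type.
Local Notation lam := (lebesgue_rV R d).
Local Notation lamT := (lebesgue_rV R d \x lebesgue_measure)%E.
Local Notation L := (levy_test nu).
Local Notation cyl := (@cylinder R d).

Definition potential (z : VT) : R := \int[mu]_y P (z.1 - y, z.2).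

Lemma integrable_heat1_mu : mu.-integrable setT (fun y => (P (y, 1))%:E).
Proof.
apply/integrableP; split.
  by apply/measurable_EFinP; exact: (measurable_heat HP ltr01).
apply: le_lt_trans mu_P1; rewrite le_eqVlt; apply/orP; left; apply/eqP.
by apply: eq_integral => y _ /=; rewrite ger0_norm// (heat_ge0 HP).
Qed.

Lemma integral_heat1_muE :
  (\int[mu]_y (P (y, 1%R))%:E = (\int[mu]_y P (y, 1))%:E)%E.
Proof. by rewrite fineK//; apply: integrable_fin_num => //; exact: integrable_heat1_mu. Qed.

Lemma integrable_heat_mu (x : V) t : 0 < t ->
  mu.-integrable setT (fun y => (P (x - y, t))%:E).
Proof.
move=> t0; have [C C0 hC] := heat_shift_le HP t `|x| t0.
apply: (le_integrable measurableT _ _ (integrableZl measurableT C integrable_heat1_mu)).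
  by apply/measurable_EFinP; exact: (measurable_heatB HP).
move=> y _ /=; rewrite lee_fin !ger0_norm ?mulr_ge0 ?(ltW C0) ?(heat_ge0 HP)//.
by apply: hC; rewrite ?lexx.
Qed.

Lemma potentialE (z : VT) : 0 < z.2 ->
  (\int[mu]_y (P ((z.1 - y)%R, z.2))%:E = (potential z)%:E)%E.
Proof.
move=> z0; rewrite /potential fineK//; apply: integrable_fin_num => //.
exact: integrable_heat_mu.
Qed.

Lemma potential_ge0 (z : VT) : 0 < z.2 -> 0 <= potential z.
Proof. by move=> z0; apply: Rintegral_ge0 => y _; exact: (heat_ge0 HP). Qed.

(** In a neighbourhood of [z] the integrand is bounded by [C P_1(y)], whence
    dominated convergence and the joint continuity of the kernel. *)
Lemma potential_continuous (z : VT) : 0 < z.2 -> {for z, continuous potential}.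
Proof.
case: z => x0 t0 /= t00.
have t020 : 0 < t0 / 2 by rewrite divr_gt0.
have [C C0 hC] := heat_shift_le HP (2 * t0) (`|x0| + 1) t020.
pose D := [set z : VT | `|z.1| <= `|x0| + 1 /\ t0 / 2 <= z.2 <= 2 * t0].
have D0 z : D z -> 0 < z.2 by move=> [_ /andP[h _]]; lra.
apply: (@cvg_within_interior _ _ D).
  exists (ball x0 1, ball t0 (t0 / 2)) => /=.
    by split; apply: nbhsx_ballx.
  move=> [x t] /= [xr]; rewrite /ball/= ltr_distlC => /andP[t1 t2].
  split => /=; last lra.
  move: xr; rewrite -ball_normE /= => xr.
  have -> : x = x0 - (x0 - x) by rewrite subKr.
  by rewrite (le_trans (ler_normB _ _))// lerD2l ltW.
apply: (cvg_Rintegral (g := fun y => C * P (y, 1))).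
- by move=> z /D0 z0; exact: (measurable_heatB HP).
- exact: (measurable_heatB HP).
- exact: (integrableZl measurableT C integrable_heat1_mu).
- move=> z y [z1 z2]; rewrite ger0_norm; first exact: hC.
  by apply: (heat_ge0 HP); apply: D0.
- move=> y; apply: cvg_within_filter.
  apply: (continuous_comp (f := fun z : VT => (z.1 - y, z.2)) (g := P)).
    have h1 : z'.1 - y @[z' --> (x0, t0)] --> (x0, t0).1 - y.
      by apply: cvgB; [exact: cvg_fst|exact: cvg_cst].
    have h2 : z'.2 @[z' --> (x0, t0)] --> (x0, t0).2 by exact: cvg_snd.
    exact: (cvg_pair h1 h2).
  exact: (heat_continuous HP).
Qed.

Lemma potential_within T : {within cyl T, continuous potential}.
Proof.
rewrite (continuous_open_subspace _ (@open_cylinder R d T)) => z /set_mem zT.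
by apply: potential_continuous; case/andP: zT.
Qed.

Lemma measurable_potential T : measurable_fun (cyl T) potential.
Proof.
by apply: continuous_measurable_prod; [exact: open_cylinder|exact: potential_within].
Qed.

(** The integrand on the product of space-time with [R^d], cut off to
    positive times, where the kernel is known to be jointly measurable. *)
Let G T (h : VT -> R) (w : VT * V) : R :=
  (P \_ (cyl T)) (w.1.1 - w.2, w.1.2) * h w.1.

Let measurable_G T h : 0 < T -> measurable_fun setT h -> measurable_fun setT (G T h).
Proof.
move=> T0 mh; apply: measurable_funM; last first.
  by apply: (measurableT_comp mh); exact: measurable_fst.
apply: (@measurableT_comp _ _ _ _ _ _ (P \_ (cyl T)) _
  (fun w : VT * V => (w.1.1 - w.2, w.1.2))).
  exact: (measurable_heat_cylinder P_vws T0).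
have m1 : measurable_fun setT (fun w : VT * V => w.1.1).
  by apply: (measurableT_comp (f := fst) (g := fst)); exact: measurable_fst.
have m2 : measurable_fun setT (fun w : VT * V => w.1.2).
  by apply: (measurableT_comp (f := snd) (g := fst));
    [exact: measurable_snd|exact: measurable_fst].
apply: measurable_fun_pair => //.
apply: (@measurableT_comp _ _ _ _ _ _ (fun p : V * V => p.1 - p.2) _
  (fun w : VT * V => (w.1.1, w.2))); first exact: measurable_subr_rV.
by apply: measurable_fun_pair => //; exact: measurable_snd.
Qed.

Let GE T h z y : vanishes_off (cyl T) h -> G T h (z, y) = P (z.1 - y, z.2) * h z.
Proof. by move=> hT; rewrite /G /= -(heat_mulE P y z hT). Qed.

Let inner_mu T h z : vanishes_off (cyl T) h ->
  (\int[mu]_y (G T h (z, y))%:E = (potential z * h z)%:E)%E.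
Proof.
move=> hT; under eq_integral do rewrite GE// EFinM.
have [zT|nzT] := pselect (cyl T z); last first.
  rewrite hT// mulr0; apply: integral0_eq => y _; exact: mule0.
have z0 : 0 < z.2 by case/andP: zT.
by rewrite integralZr// ?potentialE// ?EFinM//; exact: integrable_heat_mu.
Qed.

Lemma ge0_potential_fubini T (h : VT -> R) : 0 < T -> measurable_fun setT h ->
  vanishes_off (cyl T) h -> (forall z, 0 <= h z) ->
  (\int[lamT]_z (potential z * h z)%:E =
   \int[mu]_y \int[lamT]_z (P ((z.1 - y)%R, z.2) * h z)%:E)%E.
Proof.
move=> T0 mh hT h0.
under eq_integral do rewrite -(inner_mu _ hT).
transitivity (\int[mu]_y \int[lamT]_z (G T h (z, y))%:E)%E.
  apply: (@fubini_tonelli _ _ _ _ R space_time_sf mu (fun w : VT * V => (G T h w)%:E)).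
    by apply/measurable_EFinP; exact: measurable_G.
  by move=> [z y]; rewrite lee_fin GE//; exact: (heat_mul_ge0 HP _ _ hT).
by apply: eq_integral => y _; apply: eq_integral => z _; rewrite GE.
Qed.

Lemma measurable_potential_mul T (h : VT -> R) : 0 < T -> measurable_fun setT h ->
  vanishes_off (cyl T) h -> measurable_fun setT (fun z => potential z * h z).
Proof.
move=> T0 mh hT.
have -> : (fun z => potential z * h z) = (fun z => (potential \_ (cyl T)) z * h z).
  apply/funext => z; rewrite patchE; case: ifPn => // /negP nz.
  by rewrite hT ?mulr0// => zT; apply: nz; rewrite inE.
apply: measurable_funM => //; apply: (iffLR (measurable_restrictT _ _)).
  exact: measurable_cylinder.
exact: measurable_potential.
Qed.

Lemma potential_mul_norm T (h : VT -> R) z : vanishes_off (cyl T) h ->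
  `|potential z * h z| = potential z * `|h z|.
Proof.
move=> hT; rewrite normrM; have [zT|nzT] := pselect (cyl T z); last first.
  by rewrite hT// normr0 !mulr0.
by rewrite [`|potential z|]ger0_norm// potential_ge0//; case/andP: zT.
Qed.

Lemma integrable_potential_mul T (h : VT -> R) C : 0 < T -> 0 <= C ->
  measurable_fun setT h -> vanishes_off (cyl T) h ->
  (forall y : V, (\int[lamT]_z (P ((z.1 - y)%R, z.2) * `|h z|)%:E <= (C * P (y, 1))%:E)%E) ->
  lamT.-integrable setT (fun z => (potential z * h z)%:E).
Proof.
move=> T0 C0 mh hT hC; apply/integrableP; split.
  by apply/measurable_EFinP; exact: (measurable_potential_mul T0).
have nT : vanishes_off (cyl T) (fun z => `|h z|).
  by move=> z nz; rewrite hT// normr0.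
have mn : measurable_fun setT (fun z => `|h z|) by exact: measurableT_comp.
rewrite [X in (X < _)%E](_ : _ = \int[lamT]_z (potential z * `|h z|)%:E)%E; last first.
  by apply: eq_integral => z _ /=; rewrite (potential_mul_norm _ hT).
rewrite (ge0_potential_fubini T0 mn nT)//.
have P10 (y : V) : 0 <= P (y, 1) by exact: (heat_ge0 HP).
have mP1 : measurable_fun setT (fun y => (P (y, 1))%:E).
  by apply/measurable_EFinP; exact: (measurable_heat HP).
apply: (@le_lt_trans _ _ (\int[mu]_y (C%:E * (P (y, 1))%:E))%E).
  apply: ge0_le_integral => //.
  - move=> y _; apply: integral_ge0 => z _; rewrite lee_fin.
    exact: (heat_mul_ge0 HP _ _ nT).
  - rewrite [X in measurable_fun _ X](_ : _ = fubini_G space_time_sf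
      (fun w : VT * V => (G T (fun z => `|h z|) w)%:E)); last first.
      by apply/funext => y; apply: eq_integral => z _; rewrite GE.
    apply: measurable_fun_fubini_tonelli_G.
      by apply/measurable_EFinP; exact: measurable_G.
    by move=> [z y]; rewrite lee_fin GE//; exact: (heat_mul_ge0 HP _ _ nT).
  - exact: emeasurable_funM.
rewrite ge0_integralZl//.
- by rewrite integral_heat1_muE -EFinM ltry.
- by move=> y _; rewrite lee_fin.
Qed.

Lemma potential_weak T theta : 0 < T -> test_function T theta ->
  [/\ lamT.-integrable setT (fun z : VT => (potential z * L theta z)%:E),
      lamT.-integrable setT (fun z : VT => (potential z * time_derive theta z)%:E) &
      \int[lamT]_z (potential z * (time_derive theta z - L theta z))%:E = 0]%E.
Proof.
move=> T0 tth.
have [C1 C10 hC1] := heat_levy_test_le nu_levy HP P_vws tth.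
have [C2 C20 hC2] := heat_time_derive_le HP P_vws tth.
have mL := measurable_levy_test nu_levy tth.
have mD := measurable_time_derive tth.
have oL := levy_test_off nu tth.
have oD := time_derive_off tth.
have iL := integrable_potential_mul T0 C10 mL oL hC1.
have iD := integrable_potential_mul T0 C20 mD oD hC2.
split => //.
pose h z := time_derive theta z - L theta z.
have mh : measurable_fun setT h by exact: measurable_funB.
have oh : vanishes_off (cyl T) h by move=> z nz; rewrite /h oD// oL// subr0.
have mG : measurable_fun setT (fun w : VT * V => (G T h w)%:E).
  by apply/measurable_EFinP; exact: measurable_G.
have ih : lamT.-integrable setT (fun z : VT => (potential z * h z)%:E).
  have := integrableB measurableT iD iL; apply: eq_integrable => // z _.
  by rewrite /= mulrBr EFinB.
have iG : (space_time_sf \x mu)%E.-integrable setT (fun w : VT * V => (G T h w)%:E).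
  apply/integrable12ltyP => //.
  have /integrableP[_] := ih; apply: le_lt_trans.
  rewrite le_eqVlt; apply/orP; left; apply/eqP; apply: eq_integral => z _.
  have nT : vanishes_off (cyl T) (fun z => `|h z|).
    by move=> z' nz; rewrite oh// normr0.
  rewrite [RHS]/= (potential_mul_norm _ oh) -(inner_mu _ nT).
  apply: eq_integral => y _; rewrite /= !GE// normrM; congr EFin.
  have [zT|nzT] := pselect (cyl T z); last by rewrite oh// normr0 !mulr0.
  by rewrite ger0_norm// (heat_ge0 HP)//; case/andP: zT.
have := Fubini iG; rewrite /fubini_F /fubini_G.
under eq_integral do rewrite (inner_mu _ oh).
move=> ->; rewrite integral0_eq// => y _.
have [_ _ <-] := heat_weak_shift nu_levy HP P_vws y T0 tth.
by apply: eq_integral => z _; rewrite GE.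
Qed.

End Potential.

(** * Time slices and initial trace *)

Section Slices.
Context {R : realType} {d : nat}.
Variables (nu : {measure set 'rV[R]_d -> \bar R}) (P : 'rV[R]_d * R -> R).
Hypothesis HP : regular_heat_kernel nu P.
Variable mu : {sigma_finite_measure set 'rV[R]_d -> \bar R}.
Hypothesis mu_P1 : (\int[mu]_y (P (y, 1%R))%:E < +oo)%E.

Local Notation V := 'rV[R]_d.
Local Notation lam := (lebesgue_rV R d).

(** The reflection turns the integral against the weight [P_1(-x)] into a
    convolution. *)
Lemma heat_backward (y : V) t : 0 < t ->
  (\int[lam]_x (P ((x - y)%R, t) * P ((- x)%R, 1%R))%:E = (P ((- y)%R, (1 + t)%R))%:E)%E.
Proof.
move=> t0; have t10 : 0 < 1 + t by rewrite addr_gt0.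
have mf : measurable_fun setT (fun x : V => (P (x - y, t) * P (- x, 1))%:E).
  apply/measurable_EFinP; apply: measurable_funM.
    by apply: (measurableT_comp (measurable_heat HP t0)); exact: measurable_shift.
  have := measurable_heatB HP 0 ltr01.
  by under eq_fun do rewrite sub0r.
rewrite -(ge0_integral_translate y)//; last first.
  by move=> x; rewrite lee_fin mulr_ge0// (heat_ge0 HP).
rewrite -(heat_semigroup HP (- y) ltr01 t0) -(ge0_heat_semigroup HP)//.
by apply: eq_integral => x _; rewrite addrK mulrC opprD addrC.
Qed.

Lemma heat_backward_le T : 0 < T -> exists2 C : R, 0 < C & forall (y : V) t,
  0 < t <= T ->
  (\int[lam]_x (P ((x - y)%R, t) * P ((- x)%R, 1%R))%:E <= (C * P (y, 1))%:E)%E.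
Proof.
move=> T0; have [C C0 hC] := heat_shift_le HP (1 + T) 0 ltr01.
exists C => // y t /andP[t0 tT]; rewrite heat_backward// lee_fin.
have := hC 0 y (1 + t); rewrite sub0r normr0; apply => //; lra.
Qed.

Section Weight.
Variables (w : V -> R) (C T : R).
Hypothesis mw : measurable_fun setT w.
Hypothesis C0 : 0 <= C.
Hypothesis wC : forall x, `|w x| <= C * P (- x, 1).
Hypothesis T0 : 0 < T.

Let Pw t (p : V * V) : R := w p.1 * P (p.1 - p.2, t).

Let measurable_Pw t : 0 < t -> measurable_fun setT (Pw t).
Proof.
move=> t0; apply: measurable_funM.
  by apply: (measurableT_comp mw); exact: measurable_fst.
by apply: (measurableT_comp (measurable_heat HP t0)); exact: measurable_subr_rV.
Qed.

(** For weights below [P_1(-x)] the semigroup property bounds the slices by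
    [P_1(y)], uniformly up to time [T]. *)
Lemma slice_le : exists2 C' : R, 0 <= C' & forall (y : V) t, 0 < t <= T ->
  (\int[lam]_x `|(w x * P ((x - y)%R, t))%:E| <= (C' * P (y, 1))%:E)%E.
Proof.
have [C1 C10 hC1] := heat_backward_le T0.
exists (C * C1) => [|y t tT]; first by rewrite mulr_ge0// ltW.
have /andP[t0 _] := tT.
have mN : measurable_fun setT (fun x : V => P (- x, 1)).
  have := measurable_heatB HP 0 ltr01.
  by under eq_fun do rewrite sub0r.
have mPy : measurable_fun setT (fun x : V => P (x - y, t)).
  by apply: (measurableT_comp (measurable_heat HP t0)); exact: measurable_shift.
apply: (@le_trans _ _ (\int[lam]_x (C%:E * (P ((x - y)%R, t) * P ((- x)%R, 1%R))%:E))%E).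
  apply: ge0_le_integral => //.
  - apply: measurableT_comp => //; apply/measurable_EFinP; exact: measurable_funM.
  - by apply: emeasurable_funM => //; apply/measurable_EFinP; exact: measurable_funM.
  - move=> x _ /=; rewrite lee_fin normrM [`|P _|]ger0_norm ?(heat_ge0 HP)//.
    by rewrite mulrCA mulrC ler_wpM2l ?(heat_ge0 HP).
rewrite ge0_integralZl//.
- by rewrite -mulrA EFinM lee_wpmul2l// hC1.
- by apply/measurable_EFinP; exact: measurable_funM.
- by move=> x _; rewrite lee_fin mulr_ge0// (heat_ge0 HP).
Qed.

Lemma slice_integrable t : 0 < t <= T ->
  (lam \x mu)%E.-integrable setT (fun p => (Pw t p)%:E).
Proof.
move=> tT; have /andP[t0 _] := tT; have [C' C'0 hC'] := slice_le.
apply/integrable21ltyP; first by apply/measurable_EFinP; exact: measurable_Pw.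
have mP1 : measurable_fun setT (fun y => (P (y, 1))%:E).
  by apply/measurable_EFinP; exact: (measurable_heat HP ltr01).
apply: (@le_lt_trans _ _ (\int[mu]_y (C'%:E * (P (y, 1))%:E))%E).
  apply: ge0_le_integral => //.
  - by move=> y _; exact: integral_ge0.
  - apply: (measurable_fun_fubini_tonelli_G (fun p : V * V => `|(Pw t p)%:E|%E)) => //.
    by apply: measurableT_comp => //; apply/measurable_EFinP; exact: measurable_Pw.
  - exact: emeasurable_funM.
  - by move=> y _; rewrite -EFinM; exact: hC'.
rewrite ge0_integralZl//.
- by rewrite (integral_heat1_muE HP mu_P1) -EFinM ltry.
- by move=> y _; rewrite lee_fin (heat_ge0 HP).
Qed.

Let inner_mu t x : 0 < t ->
  (\int[mu]_y (Pw t (x, y))%:E = (w x * potential P mu (x, t))%:E)%E.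
Proof.
move=> t0; rewrite /Pw /=; under eq_integral do rewrite EFinM.
rewrite integralZl//; last exact: (integrable_heat_mu HP mu_P1 x t0).
by rewrite EFinM -(potentialE HP mu_P1 (z := (x, t))).
Qed.

Lemma integrable_slice t : 0 < t <= T ->
  lam.-integrable setT (fun x => (w x * potential P mu (x, t))%:E).
Proof.
move=> tT; have /andP[t0 _] := tT.
apply: eq_integrable (integrable_fubini_F (slice_integrable tT)) => // x _.
by rewrite /fubini_F inner_mu.
Qed.

Lemma slice_fin (y : V) t : 0 < t <= T ->
  lam.-integrable setT (fun x => (w x * P (x - y, t))%:E).
Proof.
move=> tT; have /andP[t0 _] := tT; have [C' _ hC'] := slice_le.
apply/integrableP; split; last by apply: le_lt_trans (hC' y t tT) (ltry _).
apply/measurable_EFinP; apply: measurable_funM => //.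
by apply: (measurableT_comp (measurable_heat HP t0)); exact: measurable_shift.
Qed.

Lemma Rintegral_slice t : 0 < t <= T ->
  \int[lam]_x (w x * potential P mu (x, t)) =
  \int[mu]_y (\int[lam]_x (w x * P (x - y, t))).
Proof.
move=> tT; have /andP[t0 _] := tT.
have := Fubini (slice_integrable tT); rewrite /fubini_F /fubini_G.
under eq_integral do rewrite inner_mu//.
rewrite /Rintegral => ->; congr fine; apply: eq_integral => y _.
by rewrite fineK//; apply: integrable_fin_num => //; exact: slice_fin.
Qed.

Lemma Rintegral_slice_le : exists2 C' : R, 0 <= C' & forall (y : V) t, 0 < t <= T ->
  `|\int[lam]_x (w x * P (x - y, t))| <= C' * P (y, 1).
Proof.
have [C' C'0 hC'] := slice_le; exists C' => // y t tT.
apply: le_trans (le_normr_Rintegral _ (slice_fin y tT)) _ => //.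
rewrite -lee_fin; apply: le_trans (hC' y t tT); rewrite /Rintegral fineK//.
by apply: integrable_fin_num => //; exact: (integrable_abse (slice_fin y tT)).
Qed.

Lemma measurable_slice t : 0 < t <= T ->
  measurable_fun setT (fun y : V => \int[lam]_x (w x * P (x - y, t))).
Proof.
move=> tT; have /andP[t0 _] := tT; apply/measurable_EFinP.
apply: (eq_measurable_fun (fubini_G lam (fun p => (Pw t p)%:E))).
  move=> y _; rewrite /fubini_G /Rintegral /= fineK//.
  by apply: integrable_fin_num => //; exact: slice_fin.
exact: (measurable_fubini_G (slice_integrable tT)).
Qed.

End Weight.

(** The weight [P_1] is comparable to its reflection, to which the slice
    bound applies. *)
Lemma potential_L1 T : 0 < T -> exists C : R, forall t, 0 < t <= T ->
  (\int[lam]_x (potential P mu (x, t) * P (x, 1%R))%:E <= C%:E)%E.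
Proof.
move=> T0; have [C C0 hC] := heatN_le HP.
have mw : measurable_fun setT (fun x : V => P (x, 1)) by exact: (measurable_heat HP ltr01).
have wC x : `|P (x, 1)| <= C * P (- x, 1).
  by rewrite ger0_norm ?(heat_ge0 HP).
have [C' C'0 hC'] := Rintegral_slice_le mw (ltW C0) wC T0.
exists (\int[mu]_y (C' * P (y, 1))) => t tT.
have iS := integrable_slice mw (ltW C0) wC T0 tT.
have iP := integrableZl measurableT C' (integrable_heat1_mu HP mu_P1).
rewrite (eq_integral (fun x => (P (x, 1) * potential P mu (x, t))%:E)); last first.
  by move=> x _; rewrite mulrC.
rewrite -[leLHS]fineK; last by apply: integrable_fin_num.
rewrite lee_fin -/(Rintegral _ _ _) (Rintegral_slice mw (ltW C0) wC T0 tT).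
apply: le_Rintegral => //.
- apply: (le_integrable measurableT _ _ iP).
    by apply/measurable_EFinP; exact: (measurable_slice mw (ltW C0) wC T0 tT).
  move=> y _ /=; rewrite lee_fin [leRHS]ger0_norm; first exact: hC'.
  by rewrite mulr_ge0// (heat_ge0 HP).
- by move=> y _; apply: le_trans (ler_norm _) (hC' y t tT).
Qed.

Lemma Cc_le_heat (psi : V -> R) : Cc psi -> exists2 C : R, 0 <= C &
  forall x, `|psi x| <= C * P (- x, 1).
Proof.
move=> [cpsi ck].
have off x : ~ supp psi x -> psi x = 0.
  by move=> nx; apply: contrapT => /eqP h; apply: nx; exact: subset_closure.
have cimg : compact (psi @` supp psi).
  by apply: continuous_compact => //; exact: continuous_subspaceT.
have [M [_ hM]] := compact_bounded cimg.
have [r [_ hr]] := compact_bounded ck.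
have [C C0 hC] := @heat_shift_le _ _ _ _ HP 1 1 (r + 1) ltr01.
have P00 : 0 < P (0, 1) by have [_] := rhk_cont_pos HP ltr01.
exists (Num.max 0 (M + 1) * (C / P (0, 1))) => [|x].
  by rewrite mulr_ge0 ?le_max ?lexx// divr_ge0 ?ltW.
have [Kx|nKx] := pselect (supp psi x); last first.
  rewrite off// normr0 !mulr_ge0 ?(heat_ge0 HP) ?le_max ?lexx ?invr_ge0 ?(ltW C0)//.
  exact: ltW.
have xr : `|- x| <= r + 1 by rewrite normrN; apply: (hr (r + 1)) => //; rewrite ltrDl.
have := hC (- x) (- x) 1 xr; rewrite !lexx subrr => /(_ isT) h.
apply: (@le_trans _ _ (Num.max 0 (M + 1))).
  by rewrite le_max (hM (M + 1)) ?orbT// ?ltrDl//; exists x.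
by rewrite -mulrA ler_peMr ?le_max ?lexx// mulrAC ler_pdivlMr// mul1r.
Qed.

(** After Fubini, [mu] integrates the heat flow of [psi], which converges
    pointwise to [psi] and stays below a multiple of [P_1]. *)
Lemma potential_trace (psi : V -> R) : Cc psi ->
  (forall t, 0 < t <= 1 ->
     lam.-integrable setT (fun x => (psi x * potential P mu (x, t))%:E)) /\
  \int[lam]_x (psi x * potential P mu (x, t)) @[t --> 0^'+] --> \int[mu]_y psi y.
Proof.
move=> Cpsi; have [C C0 hC] := Cc_le_heat Cpsi.
have [cpsi _] := Cpsi.
have mw : measurable_fun setT psi by exact: continuous_measurable_rV.
split=> [t t1|]; first exact: (integrable_slice mw C0 hC ltr01 t1).
have [C' C'0 hC'] := Rintegral_slice_le mw C0 hC ltr01.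
pose D := [set t : R | 0 < t <= 1].
have cv : \int[mu]_y (\int[lam]_x (psi x * P (x - y, t)))
    @[t --> within D (nbhs (0 : R))] --> \int[mu]_y psi y.
  apply: (cvg_Rintegral (g := fun y => C' * P (y, 1))) => //.
  - by move=> t Dt; exact: (measurable_slice mw C0 hC ltr01 Dt).
  - exact: (integrableZl measurableT C' (integrable_heat1_mu HP mu_P1)).
  - by move=> t y Dt; exact: hC'.
  - move=> y.
    have hd : \int[lam]_z (psi (z + y) * P (z, t)) @[t --> 0^'+] --> psi (0 + y).
      have [M hM] : exists M, forall x, `|psi x| <= M.
        have [M1 hM1] := heat1_bounded HP; exists (C * M1) => x.
        by rewrite (le_trans (hC x))// ler_wpM2l.
      have cs : continuous (fun z : V => psi (z + y)).
        move=> z; apply: (continuous_comp (f := fun z : V => z + y) (g := psi)).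
          by apply: continuousD; [exact: cvg_id|exact: cst_continuous].
        exact: cpsi.
      apply: (heat_dirac HP (f := fun z => psi (z + y)) (M := M)) => //.
        by apply: (measurableT_comp mw); exact: measurable_shift.
      exact: cs.
    rewrite add0r in hd.
    have E t : 0 < t -> \int[lam]_x (psi x * P (x - y, t)) =
        \int[lam]_z (psi (z + y) * P (z, t)).
      move=> t0; rewrite /Rintegral -(integral_translate y); last first.
        apply/measurable_EFinP; apply: measurable_funM => //.
        by apply: (measurableT_comp (measurable_heat HP t0)); exact: measurable_shift.
      by congr fine; apply: eq_integral => z _; rewrite addrK.
    move=> A /hd[e /= e0 he]; exists e => //= t te /andP[t0 t1].
    by rewrite E//; exact: he.
move=> A /cv[e /= e0 he]; exists (Num.min e 1) => [|t]; first by rewrite /= lt_min e0 ltr01.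
rewrite /= lt_min => /andP[te]; rewrite sub0r normrN => t1 t0.
have Dt : 0 < t <= 1 by rewrite t0 ltW// (le_lt_trans (ler_norm _)).
by rewrite (Rintegral_slice mw C0 hC ltr01 Dt); exact: he.
Qed.

End Slices.

(** * Signed Radon measures *)

Section RadonMeasures.
Context {R : realType} {d : nat}.
Local Notation V := 'rV[R]_d.

Lemma compact_norm_le (r : R) : compact [set x : V | `|x| <= r].
Proof.
apply: bounded_closed_compact.
  exists r; split; first exact: num_real.
  by move=> M rM x /= xr; rewrite (le_trans xr)// ltW.
rewrite (_ : [set x : V | `|x| <= r] = (fun x : V => `|x|) @^-1` [set s | s <= r])//.
apply: closed_comp; last exact: closed_le.
by move=> x _; exact: norm_continuous.
Qed.

Lemma compact_measurable_rV (K : set V) : compact K -> measurable K.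
Proof.
move=> cK; apply: closed_measurable_rV.
by apply: compact_closed => //; exact: norm_hausdorff.
Qed.

(** Closed balls are compact and exhaust the space. The sigma-finite
    structure is built on the pushforward by the identity, a copy of [m]. *)
Lemma radon_sigma_finite (m : {measure set V -> \bar R}) : radon_on setT m ->
  exists s : {sigma_finite_measure set V -> \bar R}, s = m :> {measure set V -> \bar R}.
Proof.
move=> radon.
have sf : sigma_finite setT m.
  exists (fun n => [set x : V | `|x| <= n%:R]).
    apply/esym/seteqP; split=> // x _; exists (truncn `|x|).+1 => //=.
    by rewrite ltW// truncnS_gt.
  move=> n; have cn := @compact_norm_le n%:R.
  by split; [exact: compact_measurable_rV|exact: radon].
pose pm : {measure set V -> \bar R} :=
  measure_function_pushforward__canonical__measure_function_Measure m
    (@measurable_id _ V setT).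
have Epm : (pm : set V -> \bar R) = m by apply/funext.
have sfp : sigma_finite setT pm by rewrite Epm.
pose ms := Measure_isSigmaFinite.Build _ _ _ pm sfp.
exists (HB.pack_for {sigma_finite_measure set V -> \bar R} (Measure.sort pm) ms).
exact: eq_measure.
Qed.

Lemma lebesgue_rV_compact_lty (K : set V) : compact K -> (lebesgue_rV R d K < +oo)%E.
Proof.
move=> cK; have [r [_ hr]] := compact_bounded cK.
apply: le_lt_trans (@lebesgue_rV_ball_lty R d (r + 2)).
apply: le_measure; rewrite ?inE.
- exact: compact_measurable_rV.
- by apply: open_measurable_rV; exact: ball_open.
- move=> x Kx; rewrite -ball_normE /= sub0r normrN.
  apply: (@le_lt_trans _ _ (r + 1)); last by rewrite ltrD2l ltr1n.
  by apply: hr => //; rewrite ltrDl.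
Qed.

Lemma compact_space_time_lty (K : set (V * R)) : compact K -> measurable K ->
  ((lebesgue_rV R d \x lebesgue_measure)%E K < +oo)%E.
Proof.
move=> cK mK; have [r [_ hr]] := compact_bounded cK.
apply: le_lt_trans (@slab_measure_lty R d (r + 1) (- (r + 1)) (r + 1)).
apply: le_measure; rewrite ?inE//; first exact: measurable_slab.
move=> z Kz; have : `|z| <= r + 1 by apply: hr => //; rewrite ltrDl.
by rewrite prod_normE ge_max => /andP[z1 z2]; split; rewrite -?ler_norml.
Qed.

Lemma integral_bounded_lty disp (T : measurableType disp)
    (m : {measure set T -> \bar R}) (K : set T) (f : T -> R) (M : R) :
  measurable K -> (m K < +oo)%E -> measurable_fun K f ->
  (forall x, K x -> `|f x| <= M) -> (\int[m]_(x in K) `|f x|%:E < +oo)%E.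
Proof.
move=> mK mKoo mf fM.
have : m.-integrable K (EFin \o f).
  apply: measurable_bounded_integrable => //; exists M; split; first exact: num_real.
  by move=> r Mr x Kx /=; rewrite (le_trans (fM x Kx))// ltW.
by move=> /integrableP[].
Qed.

End RadonMeasures.

Section SignedPotential.
Context {R : realType} {d : nat}.
Context {nu : {measure set 'rV[R]_d -> \bar R}} {P : 'rV[R]_d * R -> R}.
Hypothesis HP : regular_heat_kernel nu P.
Local Notation V := 'rV[R]_d.
Local Notation lam := (lebesgue_rV R d).

Context {mp mn : {sigma_finite_measure set V -> \bar R}}.
Hypothesis mp_P1 : (\int[mp]_y (P (y, 1%R))%:E < +oo)%E.
Hypothesis mn_P1 : (\int[mn]_y (P (y, 1%R))%:E < +oo)%E.
Local Notation up := (potential P mp).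
Local Notation un := (potential P mn).
Context {U : V * R -> R}.
Hypothesis UE : forall z, U z = up z - un z.
Hypothesis cUt : forall t, 0 < t -> continuous (fun x => U (x, t)).

Lemma Linfty_L1_signed T : 0 < T -> Linfty_L1_weight T (fun x => P (x, 1)) U.
Proof.
move=> T0.
have [Cp hCp] := potential_L1 HP mp_P1 T0.
have [Cn hCn] := potential_L1 HP mn_P1 T0.
have mP1 : measurable_fun setT (fun x : V => P (x, 1)) by exact: (measurable_heat HP ltr01).
have mU t : 0 < t -> measurable_fun setT (fun x => U (x, t)).
  by move=> t0; apply: continuous_measurable_rV; exact: cUt.
have mpot (m : {sigma_finite_measure set V -> \bar R}) t :
    (\int[m]_y (P (y, 1%R))%:E < +oo)%E -> 0 < t ->
    measurable_fun setT (fun x => potential P m (x, t)).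
  move=> m_P1 t0; apply: continuous_measurable_rV => x.
  apply: (continuous_comp (f := fun x => (x, t)) (g := potential P m)).
    exact: (cvg_pair (@cvg_id _ (nbhs x)) (cvg_cst t)).
  exact: (potential_continuous HP).
have bnd t : 0 < t < T ->
    (\int[lam]_x (`|U (x, t)| * P (x, 1%R))%:E <= (Cp + Cn)%:E)%E.
  move=> /andP[t0 tT]; have tT' : 0 < t <= T by rewrite t0 ltW.
  rewrite EFinD; apply: le_trans (leeD (hCp _ tT') (hCn _ tT')).
  have mg (m : {sigma_finite_measure set V -> \bar R}) :
      (\int[m]_y (P (y, 1%R))%:E < +oo)%E ->
      measurable_fun setT (fun x => (potential P m (x, t) * P (x, 1))%:E).
    by move=> m_P1; apply/measurable_EFinP/measurable_funM => //; exact: mpot.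
  have g0 (m : {sigma_finite_measure set V -> \bar R}) x :
      0 <= potential P m (x, t) * P (x, 1).
    by rewrite mulr_ge0 ?(heat_ge0 HP)// (potential_ge0 HP).
  rewrite -ge0_integralD//; try (by move=> x _; rewrite lee_fin g0); try exact: mg.
  apply: ge0_le_integral => //.
  - by move=> x _; rewrite lee_fin mulr_ge0// (heat_ge0 HP).
  - apply/measurable_EFinP/measurable_funM => //; apply: measurableT_comp => //.
    exact: mU.
  - by apply: emeasurable_funD; exact: mg.
  - move=> x _; rewrite -EFinD lee_fin -mulrDl ler_wpM2r ?(heat_ge0 HP)// UE.
    by rewrite (le_trans (ler_normB _ _))// !ger0_norm// (potential_ge0 HP).
split.
  apply: aeW => t /andP[t0 tT]; split; last first.
    by rewrite (le_lt_trans (bnd t _)) ?ltry// t0.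
  split=> [|K cK]; first exact: mU.
  have cUK : compact ((fun x => U (x, t)) @` K).
    apply: continuous_compact => //; apply: continuous_subspaceT; exact: cUt.
  have [M [_ hM]] := compact_bounded cUK.
  apply: (integral_bounded_lty (M := M + 1)) => //.
  - exact: compact_measurable_rV.
  - exact: lebesgue_rV_compact_lty.
  - exact: measurable_funS (mU t t0).
  - by move=> x Kx; apply: hM; [rewrite ltrDl|exists x].
apply: (@le_lt_trans _ _ (maxr 0 (Cp + Cn))%:E); last exact: ltry.
apply/ess_supP; apply: aeW => t /=.
rewrite patchE; case: ifPn => [|_]; last by rewrite lee_fin le_max lexx.
rewrite inE /= in_itv /= => tT; apply: le_trans (bnd t tT) _.
by rewrite lee_fin le_max lexx orbT.
Qed.

Lemma initial_trace_signed (mu0 : signed_radon R d) :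
  mp = sr_pos mu0 :> {measure set V -> \bar R} ->
  mn = sr_neg mu0 :> {measure set V -> \bar R} ->
  initial_trace U mu0.
Proof.
move=> Ep En psi Cpsi W.
have [ip cp] := potential_trace HP mp_P1 Cpsi.
have [jn cn] := potential_trace HP mn_P1 Cpsi.
have srE : sr_fun mu0 psi = \int[mp]_y psi y - \int[mn]_y psi y.
  rewrite sr_funE//; congr (_ - _).
    by rewrite Ep.
  by rewrite En.
have cv : (\int[lam]_x (psi x * up (x, t)) - \int[lam]_x (psi x * un (x, t)))%:E
    @[t --> 0^'+] --> (sr_fun mu0 psi)%:E.
  rewrite srE; apply: cvg_comp; [exact: cvgB cp cn|exact: cvg_refl].
move=> /cv [e /= e0 he]; exists (minr e 1); first by rewrite lt_min e0 ltr01.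
apply: aeW => t; rewrite lt_min => /andP[t0 /andP[te t1]].
have tI : 0 < t <= 1 by rewrite t0 ltW.
rewrite (eq_integral (fun x => (psi x * up (x, t))%:E - (psi x * un (x, t))%:E)%E);
  last by move=> x _; rewrite UE mulrBr EFinB.
rewrite integralB_EFin//; [|exact: ip|exact: jn].
rewrite -[X in (X - _)%E]fineK; last by apply: integrable_fin_num => //; exact: ip.
rewrite -[X in (_ - X)%E]fineK; last by apply: integrable_fin_num => //; exact: jn.
by apply: he => //; rewrite /= sub0r normrN gtr0_norm.
Qed.

End SignedPotential.

Theorem theorem4p12 (R : realType) (d : nat)
    (nu : {measure set 'rV[R]_d -> \bar R}) (P : 'rV[R]_d * R -> R)
    (nu_levy : symmetric_levy_measure nu)
    (P_heat : heat_kernel nu P)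
    (P_vws : forall T : R, 0 < T -> very_weak_solution nu T P)
    (P_cont_pos : forall t : R, 0 < t ->
       continuous (fun x : 'rV[R]_d => P (x, t)) /\
       forall x : 'rV[R]_d, 0 < P (x, t))
    (P_time : forall eps tau : R, 0 < eps -> eps < tau ->
       exists2 C : R, 1 < C & forall (x : 'rV[R]_d) (t s : R),
         eps <= t <= tau -> eps <= s <= tau ->
         C^-1 * P (x, t) <= P (x, s) <= C * P (x, t))
    (P_space : forall r : R, 0 < r ->
       exists2 C : R, 0 < C & forall x y : 'rV[R]_d,
         enorm x < r -> P (x - y, 1) <= C * P (y, 1))
    (mu0 : signed_radon R d)
    (mu0_P1 : (\int[sr_total_variation mu0]_y (P (y, 1))%:E < +oo)%E) :
  let U := heat_extension P mu0 in
  (forall (x : 'rV[R]_d) (t : R), 0 < t ->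
     (sr_total_variation mu0).-integrable setT (fun y => (P (x - y, t))%:E)) /\
  forall T : R, 0 < T ->
    [/\ very_weak_solution nu T U,
        {within cylinder T, continuous U},
        Linfty_L1_weight T (fun x => P (x, 1)) U &
        initial_trace U mu0].
Proof.
pose V := 'rV[R]_d; pose lam := lebesgue_rV R d.
pose lamT := (lebesgue_rV R d \x @lebesgue_measure R)%E.
have HP : regular_heat_kernel nu P by exact: RegularHeatKernel.
have [mp Ep] := radon_sigma_finite (sr_pos_radon mu0).
have [mn En] := radon_sigma_finite (sr_neg_radon mu0).
have pE (f : V -> \bar R) : (\int[mp]_y f y = \int[sr_pos mu0]_y f y)%E.
  by apply: eq_measure_integral => A _ _; rewrite -Ep.
have nE (f : V -> \bar R) : (\int[mn]_y f y = \int[sr_neg mu0]_y f y)%E.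
  by apply: eq_measure_integral => A _ _; rewrite -En.
have mP1 : measurable_fun setT (fun y => (P (y, 1%R))%:E).
  by apply/measurable_EFinP; exact: (measurable_heat HP ltr01).
have P1_ge0 y : (0 <= (P (y, 1%R))%:E)%E by rewrite lee_fin (heat_ge0 HP).
have : (\int[mp]_y (P (y, 1%R))%:E + \int[mn]_y (P (y, 1%R))%:E < +oo)%E.
  by rewrite pE nE -ge0_integral_measure_add.
have ip0 : (0 <= \int[mp]_y (P (y, 1%R))%:E)%E by exact: integral_ge0.
have in0 : (0 <= \int[mn]_y (P (y, 1%R))%:E)%E by exact: integral_ge0.
move=> fin.
have finp : (\int[mp]_y (P (y, 1%R))%:E < +oo)%E.
  by apply: le_lt_trans fin; rewrite leeDl.
have finn : (\int[mn]_y (P (y, 1%R))%:E < +oo)%E.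
  by apply: le_lt_trans fin; rewrite leeDr.
move=> U.
pose up := potential P mp; pose un := potential P mn.
have UE z : U z = up z - un z.
  by rewrite /U /heat_extension /sr_integral /up /un /potential /Rintegral pE nE.
have cU (z : 'rV[R]_d * R) : 0 < z.2 -> {for z, continuous U}.
  move=> z0; have -> : U = (fun z => up z - un z) by apply/funext.
  by apply: cvgB; apply: (potential_continuous HP).
split=> [x t t0|T T0].
  have mB := measurable_heatB HP x t0.
  apply/integrableP; split; first exact/measurable_EFinP.
  rewrite ge0_integral_measure_add//; last by apply: measurableT_comp => //; exact/measurable_EFinP.
  have /integrableP[_ h1] := integrable_heat_mu HP finp x t0.
  have /integrableP[_ h2] := integrable_heat_mu HP finn x t0.
  by move: h1 h2; rewrite pE nE => h1 h2; exact: lte_add_pinfty.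
have wU : {within cylinder T, continuous U}.
  rewrite (continuous_open_subspace _ (@open_cylinder R d T)) => z /set_mem zT.
  by apply: cU; case/andP: zT.
have mU : measurable_fun (cylinder T) U.
  by apply: continuous_measurable_prod => //; exact: open_cylinder.
have cUt t : 0 < t -> continuous (fun x => U (x, t)).
  move=> t0 x; apply: (continuous_comp (f := fun x => (x, t)) (g := U)); last exact: cU.
  exact: (cvg_pair (@cvg_id _ (nbhs x)) (cvg_cst t)).
split => //.
- split.
    split=> // K cK KT.
    have mK : measurable K.
      apply: closed_measurable_prod.
      by apply: compact_closed cK; exact: (@norm_hausdorff _ (V * R)%type).
    have cUK : compact (U @` K).
      by apply: continuous_compact => //; exact: continuous_subspaceW wU.
    have [M [_ hM]] := compact_bounded cUK.
    apply: (integral_bounded_lty (M := M + 1)) => //.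
    + exact: compact_space_time_lty.
    + exact: measurable_funS (measurable_cylinder _) KT mU.
    + by move=> z Kz; apply: hM; [rewrite ltrDl|exists z].
  move=> theta tth /=.
  have [pL pD p0] := potential_weak nu_levy HP P_vws finp T0 tth.
  have [nL nD n0] := potential_weak nu_levy HP P_vws finn T0 tth.
  have mL := measurable_levy_test nu_levy tth.
  have mD := measurable_time_derive tth.
  have oL := levy_test_off nu tth.
  have oD := time_derive_off tth.
  have iUL : lamT.-integrable setT (fun z => (U z * levy_test nu theta z)%:E).
    have := integrableB measurableT pL nL; apply: eq_integrable => // z _.
    by rewrite /= UE mulrBl EFinB.
  have iUD : lamT.-integrable setT (fun z => (U z * time_derive theta z)%:E).
    have := integrableB measurableT pD nD; apply: eq_integrable => // z _.
    by rewrite /= UE mulrBl EFinB.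
  have mUL : measurable_fun setT (fun z => U z * levy_test nu theta z).
    by apply/measurable_EFinP; exact: (measurable_int _ iUL).
  split.
    have /integrableP[_] := iUL.
    rewrite [X in (X < _)%E](_ : _ =
      \int[lamT]_z (`|U z * levy_test nu theta z|)%:E)%E//.
    rewrite -(ge0_iterated_cylinder (T := T))//.
    + move=> fin0; apply: le_lt_trans fin0; rewrite le_eqVlt; apply/orP; left; apply/eqP.
      apply: eq_integral => t _; apply: eq_integral => x _.
      by rewrite normrM.
    + by apply: measurableT_comp => //.
    + by move=> z nz; rewrite oL// mulr0 normr0.
  have iw (u : V * R -> R) :
      lamT.-integrable setT (fun z => (u z * levy_test nu theta z)%:E) ->
      lamT.-integrable setT (fun z => (u z * time_derive theta z)%:E) ->
      lamT.-integrable setT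
        (fun z => (u z * (time_derive theta z - levy_test nu theta z))%:E).
    move=> iL iD; have := integrableB measurableT iD iL; apply: eq_integrable => // z _.
    by rewrite /= mulrBr EFinB.
  have eq0 : (\int[lamT]_z (U z * (time_derive theta z - levy_test nu theta z))%:E = 0)%E.
    transitivity (\int[lamT]_z ((up z * (time_derive theta z - levy_test nu theta z))%:E -
        (un z * (time_derive theta z - levy_test nu theta z))%:E))%E.
      by apply: eq_integral => z _; rewrite UE mulrBl EFinB.
    rewrite integralB_EFin//; [|exact: iw|exact: iw].
    by rewrite p0 n0 sube0.
  rewrite -[RHS]eq0 -(iterated_cylinder (T := T)).
  + apply: eq_integral => t _; apply: eq_integral => x _.
    by rewrite derive1_timeE.
  + by move=> z nz; rewrite oD// oL// subr0 mulr0.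
  + exact: iw.
- exact: (Linfty_L1_signed HP finp finn UE cUt T0).
- exact: (initial_trace_signed HP finp finn UE Ep En).
Qed.
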